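(* Let $T>0$, let $u_0\in H^1(\Omega)$, $\phi\in H^1([0,T];L^2(\Gamma))\cap L^2([0,T];H^1(\Gamma))$, $\bar\phi\in H^1([0,T])$, and let $\hat u_0\in H^1(\mathbb{R}^2)$ be an extension of $u_0$ (i.e. $\hat u_0=u_0$ on $\Omega$) such that $\nabla\hat u_0\in L^p(\mathbb{R}^2)$ for some $2<p\le\infty$. Put $q:=p/(p-1)$ (with $q=1$ if $p=\infty$). Let $\hat u$ be the mild solution of the point-source problem on $\mathbb{R}^2$ with data $(\hat u_0,\bar\phi)$, and let $$c^*(t):=\int_0^t\|\phi(\tau)-d\nabla\hat u(\tau)\cdot n\|_{L^2(\Gamma)}^2\,d\tau .$$ Then there is a constant $C$ depending only on $d$ and $q$ such that for all $0<t\le T$ $$c^*(t)\le 2\int_0^t\|\phi(\tau)\|_{L^2(\Gamma)}^2\,d\tau+2d^2|\Gamma|\,C\,t^{\frac2q-1}\,\|\nabla\hat u_0\|_{L^p(\mathbb{R}^2)}^2+4d^2C_\Gamma\int_0^t\|\bar\phi\|_{L^1(0,\tau)}^2\,d\tau,$$ where $C_\Gamma:=\int_\Gamma\bigl(\sup_{\tau>0}\|\nabla G_\tau(x)\|\bigr)^2\,d\sigma(x)$.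
   Context: Geometry: $\Omega_{\mathcal O}\subset\mathbb{R}^2$ is a bounded open domain with $0\in\Omega_{\mathcal O}$, whose boundary $\Gamma:=\partial\Omega_{\mathcal O}$ is $C^2$ and has finite length $|\Gamma|$; $\Omega:=\mathbb{R}^2\setminus\overline{\Omega_{\mathcal O}}$. $n$ is the unit normal on $\Gamma$ pointing outwards from $\Omega$ (i.e. into $\Omega_{\mathcal O}$); $d\sigma$ is arc length measure on $\Gamma$. $d>0$ is a fixed diffusion coefficient. $\phi:\Gamma\times[0,T]\to\mathbb{R}$ and $\bar\phi$ are real-valued; the initial data $u_0,\hat u_0$ are nonnegative functions. Green's function on $\mathbb{R}^2$: $G_t(x)=\frac{1}{4\pi dt}e^{-|x|^2/(4dt)}$; $\nabla$ is the gradient in $x$ and $\|\cdot\|$ without subscript is the Euclidean norm on $\mathbb{R}^2$. Point-source problem: $\partial_t\hat u=d\Delta\hat u+\bar\phi\,\delta_0$ on $\mathbb{R}^2$, $\hat u(0)=\hat u_0$, with $\delta_0$ the Dirac measure at the origin. Its mild solution is $$\hat u(x,t)=\int_{\mathbb{R}^2}G_t(x-y)\hat u_0(y)\,dy+\int_0^tG_{t-s}(x)\bar\phi(s)\,ds.$$ The normal flux $d\nabla\hat u\cdot n$ on $\Gamma$ is understood in the sense of traces of $\hat u|_\Omega$. *)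

(* Defs.v *)
From HB Require Import structures.
From mathcomp Require Import all_boot all_order all_algebra.
From mathcomp Require Import all_classical all_reals all_analysis.
From mathcomp Require Import lra zify.
Set Implicit Arguments.
Unset Strict Implicit.
Unset Printing Implicit Defensive.
Import Order.TTheory GRing.Theory Num.Theory.
Import numFieldNormedType.Exports.

Local Open Scope classical_set_scope.
Local Open Scope ring_scope.

Definition enorm {R : realType} (x : R * R) : R :=
  Num.sqrt (x.1 ^+ 2 + x.2 ^+ 2).

Section hausdorff.
Context {R : realType}.
Local Open Scope ereal_scope.
Implicit Types (A B X : set (R * R)) (delta : R).

(* Euclidean diameter, with value 0 on the empty set. *)
Definition ediam A : \bar R :=
  ereal_sup (0 |` [set (enorm (x - y)%R)%:E | x in A & y in A]).

Definition hausdorff1_gauge delta A : \bar R :=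
  if ediam A <= delta%:E then ediam A else +oo.

(* One-dimensional Hausdorff measure; on a C^1 curve it is the arc length.
   mu_ext takes the infimum over countable covers by Borel sets, which costs
   nothing since a set and its closure have the same diameter. *)
Definition hausdorff1 A : \bar R :=
  ereal_sup [set mu_ext (hausdorff1_gauge delta) A
            | delta in [set delta | (0 < delta)%R]].

Lemma ediam_ge0 A : 0 <= ediam A.
Proof. by apply: ereal_sup_ubound; left. Qed.

Lemma ediam0 : ediam set0 = 0.
Proof.
apply/eqP; rewrite eq_le ediam_ge0 andbT; apply: ge_ereal_sup.
by move=> _ [->//|[x []]].
Qed.

Lemma gauge_ge0 delta A : 0 <= hausdorff1_gauge delta A.
Proof. by rewrite /hausdorff1_gauge; case: ifP => _; rewrite ?ediam_ge0. Qed.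

Lemma gauge0 delta : (0 < delta)%R -> hausdorff1_gauge delta set0 = 0.
Proof. by move=> d0; rewrite /hausdorff1_gauge ediam0 lee_fin ltW. Qed.

Lemma hausdorff1_set0 : hausdorff1 set0 = 0.
Proof.
apply/eqP; rewrite eq_le; apply/andP; split.
  apply: ge_ereal_sup => _ [delta d0 <-].
  by rewrite mu_ext0//; [exact: gauge0|exact: gauge_ge0].
apply: ereal_sup_ubound; exists 1%R => //=.
by rewrite mu_ext0//; [exact: gauge0|exact: gauge_ge0].
Qed.

Lemma hausdorff1_ge0 A : 0 <= hausdorff1 A.
Proof.
apply: (@le_trans _ _ (mu_ext (hausdorff1_gauge 1) A)).
  by apply: mu_ext_ge0 => ?; exact: gauge_ge0.
by apply: ereal_sup_ubound; exists 1%R => //=.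
Qed.

Lemma le_hausdorff1 : {homo hausdorff1 : A B / A `<=` B >-> A <= B}.
Proof.
move=> A B AB; apply: ge_ereal_sup => _ [delta d0 <-].
apply: (@le_trans _ _ (mu_ext (hausdorff1_gauge delta) B)); first exact: le_mu_ext.
by apply: ereal_sup_ubound; exists delta.
Qed.

Lemma hausdorff1_sigma_subadditive : sigma_subadditive hausdorff1.
Proof.
move=> F; apply: ge_ereal_sup => _ [delta d0 <-].
apply: le_trans.
  apply: mu_ext_sigma_subadditive; first exact: gauge_ge0.
apply: lee_nneseries => [i _ _|i _].
  by apply: mu_ext_ge0 => ?; exact: gauge_ge0.
by apply: ereal_sup_ubound; exists delta.
Qed.

HB.instance Definition _ := isOuterMeasure.Build R (R * R)%type hausdorff1
  hausdorff1_set0 hausdorff1_ge0 le_hausdorff1 hausdorff1_sigma_subadditive.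

Lemma gauge_le delta delta' A : (delta <= delta')%R ->
  hausdorff1_gauge delta' A <= hausdorff1_gauge delta A.
Proof.
move=> dd; rewrite /hausdorff1_gauge; case: ifPn => [le1|nle1].
  by case: ifPn => // _; rewrite leey.
case: ifPn => // le2; move: nle1; rewrite (le_trans le2)//.
Qed.

Lemma mu_ext_gauge_le delta delta' A : (delta <= delta')%R ->
  mu_ext (hausdorff1_gauge delta') A <= mu_ext (hausdorff1_gauge delta) A.
Proof.
move=> dd; apply: le_ereal_inf_tmp => _ [F cF <-].
apply: ge_ereal_inf; exists (\sum_(k <oo) hausdorff1_gauge delta' (F k)); first by exists F.
by apply: lee_nneseries => i _; [move=> *; exact: gauge_ge0|exact: gauge_le].
Qed.

Lemma mu_ext_gauge_separated delta A B : (0 < delta)%R ->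
  (forall x y, A x -> B y -> (delta < enorm (x - y))%R) ->
  mu_ext (hausdorff1_gauge delta) A + mu_ext (hausdorff1_gauge delta) B
    <= mu_ext (hausdorff1_gauge delta) (A `|` B).
Proof.
move=> d0 sepAB; apply: le_ereal_inf_tmp => _ [F [mF cF] <-].
pose G (C : set (R * R)) k := if `[< F k `&` C !=set0 >] then F k else set0.
have cG C : C `<=` A `|` B -> measurable_cover C (G C).
  move=> CAB; split=> [k|x Cx]; first by rewrite /G; case: ifP.
  have [k _ Fkx] := cF x (CAB x Cx).
  by exists k => //; rewrite /G; case: asboolP => // -[]; exists x.
have le1 C : C `<=` A `|` B ->
    mu_ext (hausdorff1_gauge delta) C <= \sum_(k <oo) hausdorff1_gauge delta (G C k).
  by move=> CAB; apply: ereal_inf_lbound; exists (G C) => //; exact: cG.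
apply: le_trans.
  by apply: leeD; apply: le1; [exact: subsetUl|exact: subsetUr].
rewrite -nneseriesD; [|by move=> *; exact: gauge_ge0..].
apply: lee_nneseries => [k _ _|k _]; first by rewrite adde_ge0// gauge_ge0.
rewrite {1 2}/G; case: asboolP => [[x [Fx Ax]]|_]; last first.
  by rewrite gauge0// add0e; case: ifP => // _; rewrite gauge0 ?gauge_ge0.
case: asboolP => [[y [Fy By]]|_]; last by rewrite gauge0// adde0.
suff -> : hausdorff1_gauge delta (F k) = +oo by rewrite leey.
rewrite /hausdorff1_gauge ifF//; apply/negbTE; rewrite -ltNge.
apply: (@lt_le_trans _ _ (enorm (x - y))%:E).
  by rewrite lte_fin; exact: sepAB.
by apply: ereal_sup_ubound; right; exists x => //; exists y.
Qed.

Lemma hausdorff1_separated (eta : R) A B : (0 < eta)%R ->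
  (forall x y, A x -> B y -> (eta <= enorm (x - y))%R) ->
  hausdorff1 A + hausdorff1 B <= hausdorff1 (A `|` B).
Proof.
move=> e0 sepAB.
have key (d1 d2 : R) : (0 < d1)%R -> (0 < d2)%R ->
    mu_ext (hausdorff1_gauge d1) A + mu_ext (hausdorff1_gauge d2) B <= hausdorff1 (A `|` B).
  move=> d10 d20; pose d : R := Num.min (eta / 2)%R (Num.min d1 d2).
  have d0 : (0 < d)%R by rewrite !lt_min d10 d20 divr_gt0.
  have dd1 : (d <= d1)%R by rewrite /d !ge_min lexx orbT.
  have dd2 : (d <= d2)%R by rewrite /d !ge_min lexx !orbT.
  apply: le_trans (leeD (mu_ext_gauge_le A dd1) (mu_ext_gauge_le B dd2)) _.
  apply: le_trans (_ : mu_ext (hausdorff1_gauge d) (A `|` B) <= _).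
    apply: mu_ext_gauge_separated => // x y Ax By.
    apply: lt_le_trans (sepAB _ _ Ax By).
    by rewrite gt_min; apply/orP; left; rewrite ltr_pdivrMr// ltr_pMr// ltr1n.
  by apply: ereal_sup_ubound; exists d.
have m0 d C : 0 <= mu_ext (hausdorff1_gauge d) C.
  by apply: mu_ext_ge0 => ?; exact: gauge_ge0.
have [->|fB] := eqVneq (hausdorff1 (A `|` B)) +oo; first by rewrite leey.
have finH C : C `<=` A `|` B -> hausdorff1 C \is a fin_num.
  move=> CAB; rewrite ge0_fin_numE ?hausdorff1_ge0//.
  by rewrite (le_lt_trans (le_hausdorff1 CAB))// ltey.
rewrite -leeBrDr ?finH//; apply: ge_ereal_sup => _ [d1 d10 <-].
have finA : mu_ext (hausdorff1_gauge d1) A \is a fin_num.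
  rewrite ge0_fin_numE//; apply: le_lt_trans (_ : hausdorff1 A < +oo).
    by apply: ereal_sup_ubound; exists d1.
  by rewrite -ge0_fin_numE ?hausdorff1_ge0// finH.
rewrite leeBrDr ?finH// addeC -leeBrDr//; apply: ge_ereal_sup => _ [d2 d20 <-].
by rewrite leeBrDr// addeC key.
Qed.


Lemma caratheodory_level (f : R * R -> R) (a : R) :
  (forall x y, `|f x - f y| <= enorm (x - y))%R ->
  hausdorff1.-caratheodory [set x | (a < f x)%R].
Proof.
move=> f1; apply: (@le_caratheodory_measurable _ _ hausdorff1) => X /=.
have [->|XNy] := eqVneq (hausdorff1 X) +oo; first by rewrite leey.
have finX : hausdorff1 X < +oo by rewrite ltey.
have sep (A B : set (R * R)) (b c : R) : (b < c)%R ->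
    (forall x, A x -> (c <= f x)%R) -> (forall y, B y -> (f y <= b)%R) ->
    hausdorff1 A + hausdorff1 B <= hausdorff1 (A `|` B).
  move=> bc Ac Bb; apply: (@hausdorff1_separated (c - b)%R); rewrite ?subr_gt0//.
  move=> x y /Ac cx /Bb yb; apply: le_trans (f1 x y).
  by rewrite ger0_norm; lra.
set Y := X `&` [set x | (a < f x)%R]; set Z := X `&` ~` _.
pose c (k : nat) : R := (a + k.+1%:R^-1)%R.
have cS k : (c k.+1 < c k)%R.
  by rewrite /c ltrD2l ltf_pV2 ?posrE// ltr_nat.
have ca k : (a < c k)%R by rewrite ltrDl.
have cle k n : (k <= n)%N -> (c n <= c k)%R.
  by move=> kn; rewrite /c lerD2l lef_pV2 ?posrE// ler_nat.
pose Yn n := Y `&` [set x | (c n <= f x)%R].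
pose L k := Y `&` [set x | (c k.+1 <= f x < c k)%R].
have LX k : L k `<=` X by move=> x [[]].
pose U j n := \big[setU/set0]_(k < n) L (k.*2 + j)%N.
have UX j n : U j n `<=` X.
  by rewrite /U; apply: (big_ind (fun B => B `<=` X)) => // A B AX BX x [/AX|/BX].
have Uc j n x : U j n x -> (c (n.*2 + j).-1 <= f x)%R.
  rewrite /U -(bigcup_mkord n (fun k => L (k.*2 + j)%N)) => -[k /= kn [_ /andP[cx _]]].
  by apply: le_trans cx; apply: cle; lia.
have sumU j n : \sum_(k < n) hausdorff1 (L (k.*2 + j)%N) <= hausdorff1 (U j n).
  elim: n => [|n ih]; first by rewrite big_ord0 hausdorff1_ge0.
  rewrite big_ord_recr/= /U big_ord_recr/= -/(U j n).
  case: n ih => [|n] ih.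
    by rewrite big_ord0 add0e /U big_ord0 set0U.
  apply: le_trans (leeD2r _ ih) _.
  pose m := (n.+1.*2 + j)%N.
  have [A0|/set0P[x0 Lx0]] := eqVneq (L m) set0.
    by rewrite -/m A0 hausdorff1_set0 adde0 setU0.
  have main b : (b < c m.-1)%R -> (forall y, L m y -> (f y <= b)%R) ->
      hausdorff1 (U j n.+1) + hausdorff1 (L m) <= hausdorff1 (U j n.+1 `|` L m).
    by move=> bc Lb; apply: (sep _ _ b (c m.-1)) => // x; exact: Uc.
  apply: (main (c m)).
    by have := cS m.-1; rewrite prednK// /m; lia.
  by move=> y [_ /andP[_ /ltW]].
have sumLX n : \sum_(0 <= k < n) hausdorff1 (L k)
    <= hausdorff1 X + hausdorff1 X.
  apply: (@le_trans _ _ (\sum_(0 <= k < n.*2) hausdorff1 (L k))).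
    rewrite (@big_cat_nat _ _ _ n 0 n.*2)//=; last by lia.
    by rewrite leeDl// sume_ge0// => k _; exact: hausdorff1_ge0.
  have -> : \sum_(0 <= k < n.*2) hausdorff1 (L k) =
     \sum_(k < n) hausdorff1 (L (k.*2 + 0)%N) +
     \sum_(k < n) hausdorff1 (L (k.*2 + 1)%N).
    elim: n => [|n ih]; first by rewrite double0 big_geq// !big_ord0 adde0.
    rewrite doubleS !big_nat_recr//= ih !big_ord_recr/= addn0 addn1.
    by rewrite -!addeA; congr (_ + _); rewrite addeCA.
  by apply: leeD; apply: le_trans (sumU _ _) (le_hausdorff1 (UX _ _)).
have L0 k : 0 <= hausdorff1 (L k) by exact: hausdorff1_ge0.
have tail0 : \sum_(n <= k <oo) hausdorff1 (L k) @[n --> \oo] --> 0.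
  apply: nneseries_tail_cvg => //.
  apply: (@le_lt_trans _ _ (hausdorff1 X + hausdorff1 X)).
    apply: lime_le; first by apply: is_cvg_nneseries.
    by apply: nearW => n; exact: sumLX.
  by rewrite lte_add_pinfty.
have bound n : hausdorff1 Y + hausdorff1 Z <=
    hausdorff1 X + \sum_(n <= k <oo) hausdorff1 (L k).
  have YE : Y `<=` Yn n `|` \bigcup_(k in ~` `I_n) L k.
    move=> x Yx; have [cx|xc] := leP (c n) (f x); first by left.
    right; have ax : (a < f x)%R by case: Yx.
    pose P k := (c k <= f x)%R.
    have exP : exists k, P k.
      have fa : (0 < f x - a)%R by rewrite subr_gt0.
      have [k _ /(_ k (leqnn k)) kP] := near_infty_natSinv_lt (PosNum fa).
      exists k; rewrite /P /c. move: kP => /= kP. by rewrite -lerBrDl ltW.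
    case: (ex_minnP exP) => m Pm mmin.
    have nm : (n < m)%N.
      rewrite ltnNge; apply/negP => /cle /(lt_le_trans xc).
      by rewrite ltNge; move: Pm; rewrite /P => ->.
    exists m.-1 => /=; first by lia.
    split=> //=; rewrite prednK; last by lia.
    apply/andP; split; first exact: Pm.
    rewrite ltNge; apply/negP => /mmin; lia.
  apply: le_trans (leeD2r _ (le_hausdorff1 YE)) _.
  apply: le_trans (leeD2r _ (outer_measureU2 hausdorff1 _ _)) _.
  rewrite addeAC; apply: leeD.
    apply: (@le_trans _ _ (hausdorff1 (Yn n `|` Z))).
      apply: (sep _ _ a (c n)) => // [x [_]//|y [_ /=]].
      by move=> /negP; rewrite -leNgt.
    by apply: le_hausdorff1 => x [[[]]|[]].
  exact: (outer_measure_sigma_subadditive_tail hausdorff1).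
have : hausdorff1 X + \sum_(n <= k <oo) hausdorff1 (L k) @[n --> \oo]
    --> hausdorff1 X + 0.
  apply: cvgeD => //; last exact: cvg_cst.
  by rewrite fin_num_adde_defl.
rewrite adde0 => cvgX; rewrite -(cvg_lim _ cvgX)//.
apply: lime_ge; first by apply/cvg_ex; exists (hausdorff1 X).
by apply: nearW => n; exact: bound.
Qed.

Lemma borel_caratheodory_hausdorff1 (A : set (R * R)) :
  measurable A -> hausdorff1.-caratheodory A.
Proof.
pose cT := caratheodory_type (hausdorff1 : set (R * R) -> \bar R).
have mf (f : R * R -> R) : (forall x y, `|f x - f y| <= enorm (x - y))%R ->
    measurable_fun (setT : set cT) (f : cT -> R).
  move=> f1; apply: (measurability _ (@measurable_realfun.RGenOInfty.measurableE R)).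
  move=> _ [_ [a ->] <-]; rewrite setTI.
  rewrite (_ : _ @^-1` _ = [set x | (a < f x)%R]).
    exact: caratheodory_level.
  by apply/seteqP; split => x /=; rewrite in_itv/= andbT.
have m1 : measurable_fun (setT : set cT) (fst : cT -> R).
  apply: mf => x y; rewrite /enorm -sqrtr_sqr ler_wsqrtr//=.
  by rewrite lerDl sqr_ge0.
have m2 : measurable_fun (setT : set cT) (snd : cT -> R).
  apply: mf => x y; rewrite /enorm -sqrtr_sqr ler_wsqrtr//=.
  by rewrite lerDr sqr_ge0.
have mid : measurable_fun (setT : set cT) (id : cT -> R * R).
  by apply/measurable_fun_pairP; split.
by move=> mA; have := mid measurableT A mA; rewrite setTI preimage_id.
Qed.

Let hausdorff1_sigma_additive :
  semi_sigma_additive (hausdorff1 : set (R * R) -> \bar R).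
Proof.
move=> F mF tF mUF.
apply: (@caratheodory_measure_sigma_additive _ _ hausdorff1) => // [k|].
  exact: borel_caratheodory_hausdorff1.
exact: borel_caratheodory_hausdorff1.
Qed.

HB.instance Definition _ := isMeasure.Build _ _ _
  hausdorff1 hausdorff1_set0 hausdorff1_ge0 hausdorff1_sigma_additive.

End hausdorff.

Definition dot {R : realType} (x y : R * R) : R := x.1 * y.1 + x.2 * y.2.

Definition rot90 {R : realType} (x : R * R) : R * R := (- x.2, x.1).

Definition grad {R : realType} (v : R * R -> R) (x : R * R) : R * R :=
  ('D_((1, 0) : R * R) v x, 'D_((0, 1) : R * R) v x).

Notation leb2 := (lebesgue_measure \x lebesgue_measure)%E.

Section function_spaces.
Context {R : realType}.
Implicit Types (U : set (R * R)) (u v w : R * R -> R) (T : R).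

Definition L2 d (X : measurableType d) (mu : {measure set X -> \bar R})
    (D : set X) (f : X -> R) : Prop :=
  f \_ D \in Lfun mu 2%:E.

Definition C1c U v : Prop :=
  [/\ forall x, derivable v x ((1, 0) : R * R) /\
                derivable v x ((0, 1) : R * R),
      continuous (grad v) &
      exists K, [/\ compact K, K `<=` U & forall x, ~ K x -> v x = 0]].

Definition C1c_line (I : set R) (eta : R -> R) : Prop :=
  [/\ forall t, derivable eta t 1,
      continuous (derive1 eta) &
      exists K, [/\ compact K, K `<=` I & forall t, ~ K t -> eta t = 0]].

(* u is in H^1(U), with weak gradient g. Testing with C^1 functions of compact
   support defines the same weak derivatives as testing with smooth ones. *)
Definition sobolev1 U u (g : R * R -> R * R) : Prop :=
  [/\ L2 leb2 U u, L2 leb2 U (fst \o g), L2 leb2 U (snd \o g) &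
      forall v, C1c U v ->
        \int[leb2]_(x in U) (u x * (grad v x).1) =
          - (\int[leb2]_(x in U) ((g x).1 * v x)) /\
        \int[leb2]_(x in U) (u x * (grad v x).2) =
          - (\int[leb2]_(x in U) ((g x).2 * v x))].

(* H^1([0, T]) *)
Definition sobolev1_time T (f : R -> R) : Prop :=
  L2 lebesgue_measure (`[0, T]%classic) f /\
  exists2 f', L2 lebesgue_measure (`[0, T]%classic) f' &
    forall eta, C1c_line (`]0, T[%classic) eta ->
      \int[lebesgue_measure]_(t in `]0, T[) (f t * derive1 eta t) =
        - (\int[lebesgue_measure]_(t in `]0, T[) (f' t * eta t)).

Definition L2_sqnorm (Gamma : set (R * R)) (f : R * R -> R) : \bar R :=
  (\int[hausdorff1]_(x in Gamma) ((f x ^+ 2)%:E))%E.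

(* L^2([0, T]; L^2(Gamma)), through jointly measurable representatives. *)
Definition L2_L2 T (Gamma : set (R * R)) (phi : R -> R * R -> R) : Prop :=
  measurable_fun (`[0, T] `*` Gamma) (fun z : R * (R * R) => phi z.1 z.2) /\
  (\int[lebesgue_measure]_(t in `[0%R, T]) L2_sqnorm Gamma (phi t) < +oo)%E.

(* H^1([0, T]; L^2(Gamma)): the weak derivative phi' is characterized by the
   identity \int phi eta' = - \int phi' eta between elements of L^2(Gamma). *)
Definition H1_L2 T (Gamma : set (R * R)) (phi : R -> R * R -> R) : Prop :=
  L2_L2 T Gamma phi /\
  exists2 phi', L2_L2 T Gamma phi' &
    forall eta, C1c_line (`]0, T[%classic) eta ->
      {ae hausdorff1, forall x, Gamma x ->
        \int[lebesgue_measure]_(t in `]0, T[) (phi t x * derive1 eta t) =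
          - (\int[lebesgue_measure]_(t in `]0, T[) (phi' t x * eta t))}.

(* w is in H^1(Gamma), with weak arc length derivative w' in the direction
   of the unit tangent rot90 n. The curve Gamma is closed, hence integration by
   parts along it has no boundary term. *)
Definition sobolev1_curve (Gamma : set (R * R)) (n : R * R -> R * R)
    (w w' : R * R -> R) : Prop :=
  [/\ L2 hausdorff1 Gamma w, L2 hausdorff1 Gamma w' &
      forall v, C1c setT v ->
        \int[hausdorff1]_(x in Gamma) (w x * dot (grad v x) (rot90 (n x))) =
          - (\int[hausdorff1]_(x in Gamma) (w' x * v x))].

(* L^2([0, T]; H^1(Gamma)) *)
Definition L2_H1 T (Gamma : set (R * R)) (n : R * R -> R * R)
    (phi : R -> R * R -> R) : Prop :=
  L2_L2 T Gamma phi /\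
  exists2 phi', L2_L2 T Gamma phi' &
    {ae lebesgue_measure, forall t, `[0, T]%classic t ->
      sobolev1_curve Gamma n (phi t) (phi' t)}.

End function_spaces.

Section boundary.
Context {R : realType}.
Implicit Types (U : set (R * R)) (x e : R * R) (r : R) (f : R -> R).

(* In the ball of radius r around x0, U is the part above the graph of the
   C^2 function f in the orthonormal frame (e, rot90 e). A frame (e, - rot90 e)
   is covered as well, through - e and the function s |-> f (- s). *)
Definition graph_chart U x0 r e f : Prop :=
  [/\ 0 < r, enorm e = 1,
      [/\ forall s, derivable f s 1, forall s, derivable (derive1 f) s 1 &
          continuous (derive1 (derive1 f))] &
      forall x, enorm (x - x0) < r -> (U x <-> f (dot x e) < dot x (rot90 e))].

Definition topological_boundary U : set (R * R) := closure U `\` interior U.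

Definition C2_boundary U : Prop :=
  forall x0, topological_boundary U x0 -> exists r e f, graph_chart U x0 r e f.

Definition outward_unit_normal U x0 (nu : R * R) : Prop :=
  exists r e f, graph_chart U x0 r e f /\
    let f'0 := derive1 f (dot x0 e) in
    nu = (Num.sqrt (1 + f'0 ^+ 2))^-1 *: (f'0 *: e - rot90 e).

(* h is the trace on Gamma of w in H^1(Omega): the trace is the continuous
   extension to H^1(Omega) of the restriction of C^1 functions to Gamma. *)
Definition is_trace (Omega Gamma : set (R * R)) (w h : R * R -> R) : Prop :=
  L2 hausdorff1 Gamma h /\
  exists (g : R * R -> R * R) (v : nat -> R * R -> R),
    [/\ sobolev1 Omega w g,
        forall k, C1c setT (v k),
        (\int[leb2]_(x in Omega) ((v k x - w x) ^+ 2 +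
           enorm (grad (v k) x - g x) ^+ 2)%:E)%E @[k --> \oo] --> 0%E &
        L2_sqnorm Gamma (fun x => v k x - h x) @[k --> \oo] --> 0%E].

(* psi is the flux d (grad u . n) on Gamma, the components of the weak
   gradient of u in Omega being understood in the sense of traces. *)
Definition is_normal_flux (d : R) (Omega Gamma : set (R * R))
    (n : R * R -> R * R) (u psi : R * R -> R) : Prop :=
  exists g h : R * R -> R * R,
    [/\ sobolev1 Omega u g,
        is_trace Omega Gamma (fst \o g) (fst \o h),
        is_trace Omega Gamma (snd \o g) (snd \o h) &
        forall x, Gamma x -> psi x = d * dot (h x) (n x)].

End boundary.

Section heat.
Context {R : realType}.
Implicit Types (d t : R) (x : R * R).

Definition green d t x : R :=
  (4 * pi * d * t)^-1 * expR (- (enorm x ^+ 2 / (4 * d * t))).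

Definition mild_solution d (u0 : R * R -> R) (phibar : R -> R) t x : R :=
  \int[leb2]_y (green d t (x - y) * u0 y) +
  \int[lebesgue_measure]_(s in `[0, t]) (green d (t - s) x * phibar s).

Definition flux_defect (Gamma : set (R * R)) (phi psi : R -> R * R -> R) t
    : \bar R :=
  (\int[lebesgue_measure]_(tau in `[0%R, t])
     L2_sqnorm Gamma (fun x => (phi tau x - psi tau x)%R))%E.

Definition C_Gamma d (Gamma : set (R * R)) : \bar R :=
  (\int[hausdorff1]_(x in Gamma)
     ereal_sup [set (enorm (grad (green d tau) x))%:E
               | tau in [set tau : R | (0 < tau)%R]] ^+ 2)%E.

End heat.

(* Main.v *)
Require Import Defs.
From HB Require Import structures.
From mathcomp Require Import all_boot all_order all_algebra.
From mathcomp Require Import all_classical all_reals all_analysis.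
From mathcomp Require Import measurable_realfun ess_sup_inf.
From mathcomp Require Import ring lra.
Set Implicit Arguments.
Unset Strict Implicit.
Unset Printing Implicit Defensive.
Import Order.TTheory GRing.Theory Num.Theory.
Import numFieldNormedType.Exports.
Local Open Scope classical_set_scope.
Local Open Scope ring_scope.

(** Since (phi - psi)^2 <= 2 phi^2 + 2 psi^2, everything rests on a pointwise
    bound of the flux psi(tau) at almost every boundary point x and time tau,

      |psi(tau, x)| <= d (A(tau) + S(x) B(tau)),

    where A(tau) is the norm of the heat kernel in L^q times that of the initial
    gradient in L^p, S(x) is the supremum over time of the slope of the heat
    kernel at x, and B(tau) is the L^1 norm of phibar on [0, tau].
    Squaring and integrating over the boundary and over time gives the estimate:
    A(tau)^2 is a multiple of tau^(2/q - 2), which is integrable at 0 because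
    p > 2 means q < 2, and the integral of S^2 is C_Gamma.

    Away from the origin the weak gradient of the mild solution is the sum of the
    heat kernel convolved with the initial gradient, bounded by A through
    Hoelder's inequality (initial_part_le), and of the integral of the gradient
    of the kernel against phibar, bounded by S B (source_part_le). That the weak
    gradient is this sum (mild_solution_gradient) follows from Fubini,
    integration by parts against C^1 test functions, and the fundamental lemma
    of the calculus of variations. The scaling of a product of two normal
    densities gives the norm of the kernel (Lnorm_green, heat_norm_sqr), and
    maximizing u^2 exp(- u) gives S(x) = 8 e^(-2) / (pi |x|^3)
    (sup_enorm_grad_green).

    The bound holds almost everywhere in the exterior domain and has to be
    carried to the trace of the gradient, which is only defined by approximation
    in H^1. Let e' be the vertical direction of a chart of the boundary. By
    Cauchy-Schwarz along rays, a C^1 function v satisfies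
    |v(x) - v(x - s e')|^2 <= delta int |grad v|^2 for s <= delta, and the
    integral over x and s of a function of x - s e' is at most a multiple of its
    integral over the plane, because length on the graph of the chart is at most
    a multiple of ds and frames preserve area (strip_comparison). Hence the mean
    square distance between a trace and the values of the function along rays of
    length delta tends to 0 with delta (trace_ray), so that a bound of the
    function near a boundary point is a bound of its trace (trace_bound). As S is
    continuous, local constant bounds give the bound of the flux (flux_le). *)

(** * Integrals of nonnegative functions and invariance of area *)

Section lower_integral.
Context d (X : measurableType d) (R : realType).
Variable mu : {measure set X -> \bar R}.
Local Open Scope ereal_scope.

Import HBNNSimple.

(** The integral of a nonnegative function is the supremum of the integrals of
    the simple functions below it, so it is monotone without measurability.
    This is what allows to bound the flux, which as a trace chosen separately
    at each time carries no joint measurability. *)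
Lemma le_lower_integral (D : set X) (f g : X -> \bar R) :
  (forall x, D x -> 0 <= f x) -> (forall x, D x -> f x <= g x) ->
  \int[mu]_(x in D) f x <= \int[mu]_(x in D) g x.
Proof.
move=> f0 fg; have g0 x : D x -> 0 <= g x by move=> Dx; exact: le_trans (f0 _ Dx) (fg _ Dx).
rewrite !ge0_integralE//; apply: ge_ereal_sup => _ [h /= hf <-].
apply: ereal_sup_ubound; exists h => // x /=.
apply: le_trans (hf x) _; rewrite /patch; case: ifPn => // /set_mem; exact: fg.
Qed.

(** Raising g to +oo on the null set makes the inequality hold everywhere and
    does not change the integral of g. *)
Lemma ae_le_lower_integral (D : set X) (f g : X -> \bar R) :
  measurable D -> measurable_fun D (g : X -> \bar R) ->
  (forall x, D x -> 0 <= f x) -> (forall x, D x -> 0 <= g x) ->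
  {ae mu, forall x, D x -> f x <= g x} ->
  \int[mu]_(x in D) f x <= \int[mu]_(x in D) g x.
Proof.
move=> mD mg f0 g0 [N [mN N0 subN]].
pose g' x := if x \in N then +oo else g x.
have mg' : measurable_fun D g'.
  apply: measurable_fun_if => //.
    apply: (measurable_fun_bool true); rewrite (_ : _ @^-1` _ = N); first exact: measurableI.
    by apply/seteqP; split=> x /=; [move/set_mem|move/mem_set].
  by apply: measurable_funS mg => //; apply: subIsetl.
apply: (@le_trans _ _ (\int[mu]_(x in D) g' x)).
  apply: le_lower_integral => // x Dx; rewrite /g'; case: ifPn => [|xN]; first by rewrite leey.
  by apply: contrapT => h; move/negP: xN; apply; apply/mem_set/subN => /(_ Dx).
rewrite (@ge0_ae_eq_integral _ _ _ mu D g' g)//.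
  by move=> x Dx; rewrite /g'; case: ifP => // _; exact: g0.
exists N; split => // x /= /not_implyP[Dx]; rewrite /g'; case: ifPn => // xN _.
exact: set_mem.
Qed.

Lemma le_lower_integral_subset (A B : set X) (f g : X -> \bar R) : A `<=` B ->
  (forall x, A x -> 0 <= f x) -> (forall x, A x -> f x <= g x) ->
  (forall x, B x -> 0 <= g x) ->
  \int[mu]_(x in A) f x <= \int[mu]_(x in B) g x.
Proof.
move=> AB f0 fg g0; rewrite (integral_mkcond A) (integral_mkcond B).
apply: le_lower_integral => x _; rewrite /patch.
  by case: ifPn => // /set_mem; exact: f0.
case: ifPn => [/set_mem Ax|_].
  by rewrite ifT; [exact: fg|apply/mem_set/AB].
by case: ifPn => // /set_mem; exact: g0.
Qed.

Lemma ge0_integral_lincomb (D : set X) (f g : X -> \bar R) (a b : R) :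
  measurable D -> (0 <= a)%R -> (0 <= b)%R ->
  (forall x, D x -> 0 <= f x) -> (forall x, D x -> 0 <= g x) ->
  measurable_fun D f -> measurable_fun D g ->
  \int[mu]_(x in D) (a%:E * f x + b%:E * g x) =
  a%:E * \int[mu]_(x in D) f x + b%:E * \int[mu]_(x in D) g x.
Proof.
move=> mD a0 b0 f0 g0 mf mg; rewrite ge0_integralD//.
- by rewrite !ge0_integralZl//.
- by move=> x Dx; apply: mule_ge0; [rewrite lee_fin|exact: f0].
- exact: measurable_funeM.
- by move=> x Dx; apply: mule_ge0; [rewrite lee_fin|exact: g0].
- exact: measurable_funeM.
Qed.

End lower_integral.

Section lebesgue_invariance.
Context {R : realType}.
Local Open Scope ereal_scope.
Local Notation mu := (@lebesgue_measure R).
Implicit Types (u : R * R -> \bar R).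

Lemma lebesgue_measureD (c : R) (A : set R) : measurable A ->
  pushforward mu ((fun x => x + c)%R : _ -> measurableTypeR R) A = mu A.
Proof.
move=> mA; have mD : measurable_fun setT ((fun x => x + c)%R : R -> R).
  exact: measurable_funD.
apply/esym/lebesgue_measure_unique => //= _ [[a b]] _ <-.
rewrite /pushforward/= (_ : _ @^-1` _ = `](a - c)%R, (b - c)%R]%classic); last first.
  by apply/seteqP; split => x /=; rewrite !in_itv/= ltrBlDr lerBrDr.
rewrite !lebesgue_measure_itv/= !lte_fin ltrD2r -!EFinB.
by case: ifP => // _; congr (_%:E); lra.
Qed.

Lemma ge0_integral_translate (f : R -> \bar R) (c : R) :
  measurable_fun setT f -> (forall x, 0 <= f x) ->
  \int[mu]_x f (x + c)%R = \int[mu]_x f x.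
Proof.
move=> mf f0.
have mD : measurable_fun setT ((fun x => x + c)%R : R -> R).
  exact: measurable_funD.
transitivity (\int[pushforward mu ((fun x => x + c)%R : _ -> measurableTypeR R)]_x f x).
  by rewrite ge0_integral_pushforward//= preimage_setT.
by apply: eq_measure_integral => //= A mA _; exact: lebesgue_measureD.
Qed.

Lemma ge0_integral_opp (f : R -> \bar R) :
  measurable_fun setT f -> (forall x, 0 <= f x) ->
  \int[mu]_x f (- x)%R = \int[mu]_x f x.
Proof.
move=> mf f0.
transitivity (\int[pushforward mu (-%R : _ -> measurableTypeR R)]_x f x).
  by rewrite ge0_integral_pushforward//= preimage_setT.
by apply: eq_measure_integral => //= A mA _; exact: lebesgue_measureN.
Qed.

Lemma leb2_int12 u : measurable_fun setT u -> (forall z, 0 <= u z) ->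
  \int[leb2]_z u z = \int[mu]_x \int[mu]_y u (x, y).
Proof. by move=> mu_ u0; rewrite fubini_tonelli1. Qed.

Lemma leb2_int21 u : measurable_fun setT u -> (forall z, 0 <= u z) ->
  \int[leb2]_z u z = \int[mu]_y \int[mu]_x u (x, y).
Proof. by move=> mu_ u0; rewrite fubini_tonelli2. Qed.

Lemma measurable_pairl (x : R) : measurable_fun setT (fun y : R => (x, y)).
Proof. exact: measurable_fun_pair. Qed.

Lemma measurable_pairr (y : R) : measurable_fun setT (fun x : R => (x, y)).
Proof. exact: measurable_fun_pair. Qed.

Lemma leb2_shear1 u (c : R) : measurable_fun setT u -> (forall z, 0 <= u z) ->
  \int[leb2]_z u (z.1 + c * z.2, z.2)%R = \int[leb2]_z u z.
Proof.
move=> mu_ u0.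
have ms : measurable_fun setT (fun z : R * R => u (z.1 + c * z.2, z.2)%R).
  apply: (measurableT_comp mu_); apply: measurable_fun_pair => //=.
  by apply: measurable_funD => //; apply: measurable_funM.
rewrite (leb2_int21 mu_ u0) (leb2_int21 ms (fun=> u0 _)).
apply: eq_integral => y _ /=.
rewrite (ge0_integral_translate (f := fun x => u (x, y)))//.
by apply: measurableT_comp mu_ _; exact: measurable_pairr.
Qed.

Lemma leb2_shear2 u (c : R) : measurable_fun setT u -> (forall z, 0 <= u z) ->
  \int[leb2]_z u (z.1, z.2 + c * z.1)%R = \int[leb2]_z u z.
Proof.
move=> mu_ u0.
have ms : measurable_fun setT (fun z : R * R => u (z.1, z.2 + c * z.1)%R).
  apply: (measurableT_comp mu_); apply: measurable_fun_pair => //=.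
  by apply: measurable_funD => //; apply: measurable_funM.
rewrite (leb2_int12 mu_ u0) (leb2_int12 ms (fun=> u0 _)).
apply: eq_integral => x _ /=.
rewrite (ge0_integral_translate (f := fun y => u (x, y)))//.
by apply: measurableT_comp mu_ _; exact: measurable_pairl.
Qed.

Lemma leb2_opp u : measurable_fun setT u -> (forall z, 0 <= u z) ->
  \int[leb2]_z u (- z.1, - z.2)%R = \int[leb2]_z u z.
Proof.
move=> mu_ u0.
have ms : measurable_fun setT (fun z : R * R => u (- z.1, - z.2)%R).
  by apply: (measurableT_comp mu_); apply: measurable_fun_pair => //=; exact: measurableT_comp.
rewrite (leb2_int12 mu_ u0) (leb2_int12 ms (fun=> u0 _)).
have mF : measurable_fun setT (fun x => \int[mu]_y u (x, y)).
  exact: measurable_fun_fubini_tonelli_F.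
have F0 x : 0 <= \int[mu]_y u (x, y) by exact: integral_ge0.
rewrite -[RHS](ge0_integral_opp mF F0).
apply: eq_integral => x _ /=.
rewrite (ge0_integral_opp (f := fun y => u ((- x)%R, y)))//.
by apply: measurableT_comp mu_ _; exact: measurable_pairl.
Qed.

Lemma leb2_translate u (c : R * R) : measurable_fun setT u -> (forall z, 0 <= u z) ->
  \int[leb2]_z u (z + c)%R = \int[leb2]_z u z.
Proof.
move=> mu_ u0.
have ms : measurable_fun setT (fun z : R * R => u (z + c)%R).
  apply: (measurableT_comp mu_) => /=; apply: measurable_fun_pair => //=;
  exact: measurable_funD.
rewrite (leb2_int12 mu_ u0) (leb2_int12 ms (fun=> u0 _)).
have mF : measurable_fun setT (fun x => \int[mu]_y u (x, y)).
  exact: measurable_fun_fubini_tonelli_F.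
have F0 x : 0 <= \int[mu]_y u (x, y) by exact: integral_ge0.
rewrite -[RHS](ge0_integral_translate c.1 mF F0).
apply: eq_integral => x _ /=.
rewrite -[RHS](ge0_integral_translate (f := fun y => u ((x + c.1)%R, y)) c.2)//.
by apply: measurableT_comp mu_ _; exact: measurable_pairl.
Qed.

(** A rotation is a product of three shears, unless it is plus or minus the
    identity; shears preserve area by translation invariance on each line. *)
Lemma leb2_rotate u (e : R * R) : (e.1 ^+ 2 + e.2 ^+ 2 = 1)%R ->
  measurable_fun setT u -> (forall z, 0 <= u z) ->
  \int[leb2]_z u (z.1 *: e + z.2 *: rot90 e)%R = \int[leb2]_z u z.
Proof.
case: e => a b /= ab1 mu_ u0; rewrite /rot90/=.
have [b0|b0] := eqVneq b 0%R.
  have /orP[/eqP a1|/eqP a1] : ((a == 1) || (a == -1))%R.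
  - by rewrite -eqf_sqr expr1n; move: ab1; rewrite b0 expr0n addr0 => ->.
  - by apply: eq_integral => -[x y] _; congr (u (_, _)); rewrite /= b0 a1 /GRing.scale/=; ring.
  - rewrite -[RHS]leb2_opp//.
    by apply: eq_integral => -[x y] _; congr (u (_, _)); rewrite /= b0 a1 /GRing.scale/=; ring.
pose c := ((a - 1) / b)%R.
pose u1 z := u (z.1 + c * z.2, z.2)%R.
pose u2 z := u1 (z.1, z.2 + b * z.1)%R.
have mu1 : measurable_fun setT u1.
  apply: (measurableT_comp mu_); apply: measurable_fun_pair => //=.
  by apply: measurable_funD => //; apply: measurable_funM.
have mu2 : measurable_fun setT u2.
  apply: (measurableT_comp mu1); apply: measurable_fun_pair => //=.
  by apply: measurable_funD => //; apply: measurable_funM.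
rewrite -[RHS](leb2_shear1 c)// -[RHS](leb2_shear2 b mu1)//; last by move=> ?; exact: u0.
rewrite -[RHS](leb2_shear1 c mu2)//; last by move=> ?; exact: u0.
have cb : (c * b = a - 1)%R by rewrite /c; field.
have ca : (c * (a + 1) = - b)%R.
  have : (b ^+ 2 = 1 - a ^+ 2)%R by rewrite -ab1; ring.
  move=> b2; apply: (mulIf b0); rewrite mulrAC cb mulNr -expr2 b2; ring.
apply: eq_integral => -[x y] _; rewrite /u2 /u1/=; congr (u (_, _)); rewrite /= /GRing.scale/=.
  rewrite -ca [RHS](_ : _ = x * (1 + c * b) + y * (c * (1 + (1 + c * b))))%R; last by ring.
  by rewrite cb; ring.
rewrite [RHS](_ : _ = x * b + y * (1 + c * b))%R; last by ring.
by rewrite cb; ring.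
Qed.

End lebesgue_invariance.

(** * Length of Lipschitz curves *)

Section hausdorff_curve.
Context {R : realType}.
Local Open Scope ereal_scope.
Local Notation mu := (@lebesgue_measure R).
Implicit Types (g : R -> R * R) (J E : set R).

Lemma ediam_le (A : set (R * R)) (c : R) : (0 <= c)%R ->
  (forall x y, A x -> A y -> (enorm (x - y) <= c)%R) -> ediam A <= c%:E.
Proof.
by move=> c0 Ac; apply: ge_ereal_sup => _ [->|[x Ax [y Ay <-]]]; rewrite lee_fin//; exact: Ac.
Qed.

(** N pieces of diameter at most c form a cover of cost at most N c, which is
    admissible at scale delta as soon as c <= delta. *)
Lemma mu_ext_gauge_pieces (delta c : R) (P : nat -> set (R * R)) (N : nat) (A : set (R * R)) :
  (0 < delta)%R -> (0 <= c <= delta)%R ->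
  (forall k, measurable (P k)) -> (forall k, ediam (P k) <= c%:E) ->
  A `<=` \bigcup_(k < N) P k ->
  mu_ext (hausdorff1_gauge delta) A <= (c *+ N)%:E.
Proof.
move=> d0 /andP[c0 cd] mP dP AP.
pose F k := if (k < N)%N then P k else set0.
have gF k : hausdorff1_gauge delta (F k) <= (if (k < N)%N then c else 0)%:E.
  rewrite /F; case: ifPn => _; last by rewrite gauge0.
  by rewrite /hausdorff1_gauge ifT ?dP//; apply: le_trans (dP k) _; rewrite lee_fin.
have sF n : \sum_(0 <= k < n) hausdorff1_gauge delta (F k) <= (c *+ minn n N)%:E.
  elim: n => [|n ih]; first by rewrite big_geq// min0n mulr0n.
  rewrite big_nat_recr//=; apply: le_trans (leeD ih (gF n)) _.
  rewrite -EFinD lee_fin; case: ltnP => nN.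
    by rewrite (minn_idPl nN) mulrSr.
  by rewrite addr0 (minn_idPr (leqW nN)).
apply: (@le_trans _ _ (\sum_(k <oo) hausdorff1_gauge delta (F k))).
  apply: ereal_inf_lbound; exists F => //; split=> [k|x /AP[k /= kN Pk]].
    by rewrite /F; case: ifP.
  by exists k => //; rewrite /F kN.
apply: lime_le; first by apply: is_cvg_nneseries => *; exact: gauge_ge0.
apply: nearW => n; apply: le_trans (sF n) _; rewrite lee_fin.
by rewrite -[leLHS]mulr_natr -[leRHS]mulr_natr ler_wpM2l// ler_nat geq_minr.
Qed.

(** The interval is cut into N equal parts, whose images have diameter at most
    L (b - a) / N; N is taken large enough for this to be below delta. *)
Lemma hausdorff1_curve_itv g J (L a b : R) : (0 <= L)%R -> (a <= b)%R ->
  (forall s t, J s -> J t -> (enorm (g s - g t) <= L * `|s - t|)%R) ->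
  (forall s t, measurable (g @` (`]s, t] `&` J))) ->
  hausdorff1 (g @` (`]a, b] `&` J)) <= (L * (b - a))%:E.
Proof.
move=> L0 ab gL mg; apply: ge_ereal_sup => _ [delta /= d0 <-].
pose N := (Num.truncn (L * (b - a) / delta)).+1.
pose h := ((b - a) / N%:R)%R.
have h0 : (0 <= h)%R by rewrite divr_ge0// subr_ge0.
have hN : (h *+ N = b - a)%R by rewrite -[LHS]mulr_natr /h divfK// pnatr_eq0.
have Lhd : (L * h <= delta)%R.
  rewrite /h mulrA ler_pdivrMr// -ler_pdivrMl// [leLHS]mulrC.
  by apply/ltW/truncnS_gt.
have -> : (L * (b - a) = (L * h) *+ N)%R by rewrite -mulrnAr hN.
apply: (@mu_ext_gauge_pieces _ _ (fun k => g @` (`](a + h *+ k)%R, (a + h *+ k.+1)%R] `&` J))) => //.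
- by rewrite Lhd mulr_ge0.
- move=> k; apply: ediam_le; first exact: mulr_ge0.
  move=> _ _ [s [/= /[!in_itv]/= /andP[s1 s2] Js] <-] [t [/= /[!in_itv]/= /andP[t1 t2] Jt] <-].
  apply: le_trans (gL _ _ Js Jt) _; apply: ler_wpM2l => //.
  by rewrite ler_norml; move: s2 t2 s1 t1; rewrite mulrSr => *; lra.
- move=> _ [s [/= /[!in_itv]/= /andP[as_ sb] Js] <-].
  have h_gt0 : (0 < h)%R by rewrite divr_gt0// subr_gt0; exact: lt_le_trans sb.
  have exk : exists k, (s <= a + h *+ k.+1)%R.
    by exists N.-1; rewrite /= hN addrC subrK.
  case: (ex_minnP exk) => k sk kmin; exists k => /=.
    by rewrite ltnS; apply: kmin; rewrite /= hN addrC subrK.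
  exists s => //; split => //=; rewrite in_itv/= sk andbT.
  case: k sk kmin => [|k] sk kmin; first by rewrite mulr0n addr0.
  by rewrite ltNge; apply/negP => /kmin; rewrite ltnn.
Qed.

(** Covering E by intervals, the outer measure E |-> H^1(g(E)) is bounded by L
    times length because it is so on intervals. *)
Lemma hausdorff1_curve g J (L : R) E : (0 < L)%R ->
  (forall s t, J s -> J t -> (enorm (g s - g t) <= L * `|s - t|)%R) ->
  (forall s t, measurable (g @` (`]s, t] `&` J))) ->
  hausdorff1 (g @` (E `&` J)) <= L%:E * mu E.
Proof.
move=> L0 gL mg.
rewrite -lee_pdivrMl//; apply: le_ereal_inf_tmp => _ [F [mF EF] <-].
rewrite lee_pdivrMl//.
apply: (@le_trans _ _ (hausdorff1 (\bigcup_k g @` (F k `&` J)))).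
  apply: le_hausdorff1 => _ [s [Es Js] <-]; have [k _ Fk] := EF _ Es.
  by exists k => //; exists s.
apply: le_trans (hausdorff1_sigma_subadditive _) _.
rewrite -nneseriesZl; last by move=> k _; exact: (wlength_ge0 idfun).
apply: lee_nneseries => [*|k _]; first exact: hausdorff1_ge0.
have [[a b] _ <-] := mF k => /=.
have [ab|ba] := leP a b.
  rewrite wlength_itv_bnd// -EFinM; apply: hausdorff1_curve_itv => //; exact: ltW.
have -> : [set` `]a, b]] = set0 by apply: set_itv_ge; rewrite -leNgt bnd_simp; exact: ltW.
by rewrite set0I image_set0 hausdorff1_set0 wlength0 mule0.
Qed.

End hausdorff_curve.

(** * Topology and measurability in the plane *)

Section plane_topology.
Context {R : realType}.
Implicit Types (U : set (R * R)) (x y : R * R) (q : (rat * rat) * (rat * rat)).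

Definition rat_box q : set (R * R) :=
  (`]ratr q.1.1, ratr q.1.2[ `*` `]ratr q.2.1, ratr q.2.2[)%classic.

Definition rat_cbox q : set (R * R) :=
  (`[ratr q.1.1, ratr q.1.2] `*` `[ratr q.2.1, ratr q.2.2])%classic.

Lemma measurable_rat_box q : measurable (rat_box q).
Proof. by apply: measurableX. Qed.

Lemma rat_box_sub q : rat_box q `<=` rat_cbox q.
Proof.
by move=> [a b] [/= h1 h2]; split => /=; [move: h1|move: h2];
  rewrite !in_itv/= => /andP[/ltW-> /ltW->].
Qed.

Lemma nbhs_rat_box U x : nbhs x U -> exists q, rat_box q x /\ rat_cbox q `<=` U.
Proof.
case: x => a b /nbhs_ballP[e /= e0 eU].
have [q1 /[!in_itv]/= /andP[q11 q12]] := @rat_in_itvoo R (a - e) a ltac:(lra).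
have [q2 /[!in_itv]/= /andP[q21 q22]] := @rat_in_itvoo R a (a + e) ltac:(lra).
have [q3 /[!in_itv]/= /andP[q31 q32]] := @rat_in_itvoo R (b - e) b ltac:(lra).
have [q4 /[!in_itv]/= /andP[q41 q42]] := @rat_in_itvoo R b (b + e) ltac:(lra).
exists ((q1, q2), (q3, q4)); split => /=.
  by split; rewrite /= in_itv/=; apply/andP.
move=> [c d] [/= /[!in_itv]/= /andP[c1 c2] /andP[d1 d2]]; apply: eU.
split; rewrite /ball/= ltr_norml; apply/andP; split; lra.
Qed.

Lemma open_bigcup_rat_box U : open U ->
  U = \bigcup_(q in [set q | rat_cbox q `<=` U]) rat_box q.
Proof.
move=> oU; apply/seteqP; split => [x Ux|x [q /= qU /rat_box_sub/qU //]].
have [|q [qx qU]] := @nbhs_rat_box U x; first exact: open_nbhs_nbhs.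
by exists q.
Qed.

Lemma bigcup_rat_box_measurable (P : set ((rat * rat) * (rat * rat))) :
  measurable (\bigcup_(q in P) (rat_box q)).
Proof.
rewrite bigcup_mkcond; apply: countable_bigcupT_measurable => // q.
by case: ifP => // _; exact: measurable_rat_box.
Qed.

Lemma open_measurable2 U : open U -> measurable U.
Proof. by move/open_bigcup_rat_box->; exact: bigcup_rat_box_measurable. Qed.

Lemma closed_measurable2 U : closed U -> measurable U.
Proof. by rewrite -openC => /open_measurable2/measurableC; rewrite setCK. Qed.

(** A property that holds almost everywhere near each point of a set holds
    almost everywhere on it, because the plane is second countable. *)
Lemma ae_local d (X : measurableType d) (mu : {measure set X -> \bar R})
    (pi : X -> R * R) (A : set (R * R)) (P : R * R -> Prop) :
  (forall x, A x -> exists2 U, nbhs x U &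
    {ae mu, forall y : X, A (pi y) -> U (pi y) -> P (pi y)}) ->
  {ae mu, forall y : X, A (pi y) -> P (pi y)}.
Proof.
move=> Aloc.
pose good q := {ae mu, forall y : X, A (pi y) -> rat_box q (pi y) -> P (pi y)}.
have H n : {ae mu, forall y : X, A (pi y) ->
    forall q, unpickle n = Some q -> good q -> rat_box q (pi y) -> P (pi y)}.
  case: (unpickle n) => [q|]; last by apply: aeW.
  have [gq|ngq] := pselect (good q); last by apply: aeW => y Ay q' [<-].
  by apply: filterS gq => y h Ay q' [<-] _; exact: h.
have := ae_foralln H; apply: filterS => y Hy Ay.
have [U yU AUP] := Aloc _ Ay.
have [q [qy qU]] := nbhs_rat_box yU.
apply: (Hy (pickle q) Ay q) => //; first by rewrite pickleK.
by apply: filterS AUP => z h Az qz; apply: h => //; exact/qU/rat_box_sub.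
Qed.

Lemma continuous2_fst : continuous (fst : R * R -> R).
Proof. by move=> x; exact: cvg_fst. Qed.

Lemma continuous2_snd : continuous (snd : R * R -> R).
Proof. by move=> x; exact: cvg_snd. Qed.

Lemma continuous_dot (e : R * R) : continuous (fun x => dot x e).
Proof.
move=> x; rewrite /dot; apply: cvgD; apply: cvgM; try exact: cvg_cst.
  exact: continuous2_fst.
exact: continuous2_snd.
Qed.

Lemma continuous_enorm : continuous (@enorm R).
Proof.
move=> x; apply: continuous_comp; last exact: sqrt_continuous.
apply: cvgD; apply: (continuous_comp (f := _) (g := fun z : R => z ^+ 2)); try exact: exprn_continuous.
  exact: continuous2_fst.
exact: continuous2_snd.
Qed.

Lemma continuous_enormB (a : R * R) : continuous (fun x => enorm (x - a)).
Proof.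
move=> x; apply: (continuous_comp (f := fun x => x - a)); last exact: continuous_enorm.
by apply: cvgB => //; exact: cvg_cst.
Qed.

Lemma continuous_measurable2 (f : R * R -> R) : continuous f -> measurable_fun setT f.
Proof.
move=> cf; apply: (measurability _ (RGenOInfty.measurableE R)) => _ [_ [a ->] <-].
rewrite setTI; apply: open_measurable2; apply: open_comp; first by move=> x _; exact: cf.
by apply: interval_open.
Qed.

End plane_topology.

(** * Orthonormal frames and boundary charts *)

Section frames.
Context {R : realType}.
Implicit Types (x y z e : R * R).

Lemma enorm_ge0 x : 0 <= enorm x. Proof. exact: sqrtr_ge0. Qed.

Lemma enorm_sqr x : enorm x ^+ 2 = x.1 ^+ 2 + x.2 ^+ 2.
Proof. by rewrite sqr_sqrtr// addr_ge0// sqr_ge0. Qed.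

Lemma dot_sqr_le x y : dot x y ^+ 2 <= enorm x ^+ 2 * enorm y ^+ 2.
Proof.
rewrite !enorm_sqr -subr_ge0 (_ : _ - _ = (x.1 * y.2 - x.2 * y.1) ^+ 2) ?sqr_ge0//.
by rewrite /dot; ring.
Qed.

Lemma dot_le_enorm x y : dot x y <= enorm x * enorm y.
Proof.
have [d0|d0] := leP (dot x y) 0; first by rewrite (le_trans d0)// mulr_ge0// enorm_ge0.
rewrite -(@ler_pXn2r _ 2)// ?nnegrE ?mulr_ge0 ?enorm_ge0 ?(ltW d0)//.
by rewrite exprMn; exact: dot_sqr_le.
Qed.

Lemma enormN x : enorm (- x) = enorm x.
Proof. by rewrite /enorm /= !sqrrN. Qed.

Lemma enormB x y : enorm (x - y) = enorm (y - x).
Proof. by rewrite -enormN opprB. Qed.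

Lemma enormZ (c : R) x : enorm (c *: x) = `|c| * enorm x.
Proof.
rewrite /enorm /= /GRing.scale/= !exprMn -mulrDr sqrtrM ?sqr_ge0//.
by rewrite sqrtr_sqr.
Qed.

Lemma enormD_le x y : enorm (x + y) <= enorm x + enorm y.
Proof.
rewrite -(@ler_pXn2r _ 2)// ?nnegrE ?addr_ge0 ?enorm_ge0//.
rewrite sqrrD !enorm_sqr (_ : _ + _ = x.1 ^+ 2 + x.2 ^+ 2 + dot x y *+ 2 + (y.1 ^+ 2 + y.2 ^+ 2)).
  by rewrite !lerD2r lerD2l lerMn2r/= dot_le_enorm.
by rewrite /dot/=; ring.
Qed.

Lemma enorm1_sqr e : enorm e = 1 -> e.1 ^+ 2 + e.2 ^+ 2 = 1.
Proof. by move=> e1; rewrite -enorm_sqr e1 expr1n. Qed.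

Lemma enorm_rot90 e : enorm (rot90 e) = enorm e.
Proof. by rewrite /enorm/= sqrrN addrC. Qed.

Lemma dotB x y z : dot (x - y) z = dot x z - dot y z.
Proof. by rewrite /dot/=; ring. Qed.

Lemma dotBZ x (c : R) y z : dot (x - c *: y) z = dot x z - c * dot y z.
Proof. by rewrite /dot/= /GRing.scale/=; ring. Qed.

Lemma dot_rot90 e : dot (rot90 e) e = 0.
Proof. by rewrite /dot/=; ring. Qed.

Lemma dot_self e : enorm e = 1 -> dot e e = 1.
Proof. by move=> /enorm1_sqr <-; rewrite /dot -!expr2. Qed.

Definition frame e (s y : R) : R * R := s *: e + y *: rot90 e.

Lemma frame_coords e (s y : R) : frame e s y = (s * e.1 - y * e.2, s * e.2 + y * e.1).
Proof. by rewrite /frame /rot90; congr (_, _); rewrite /= /GRing.scale/=; ring. Qed.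

Lemma frameB e (s y t w : R) : frame e s y - frame e t w = frame e (s - t) (y - w).
Proof. by rewrite !frame_coords; congr (_, _) => /=; ring. Qed.

Lemma dot_frame1 e (s y : R) : enorm e = 1 -> dot (frame e s y) e = s.
Proof.
move=> /enorm1_sqr e1; rewrite -[RHS]mulr1 -e1 frame_coords /dot/=; ring.
Qed.

Lemma dot_frame2 e (s y : R) : enorm e = 1 -> dot (frame e s y) (rot90 e) = y.
Proof.
move=> /enorm1_sqr e1; rewrite -[RHS]mulr1 -e1 frame_coords /dot/=; ring.
Qed.

Lemma frameE e x : enorm e = 1 -> frame e (dot x e) (dot x (rot90 e)) = x.
Proof.
move=> /enorm1_sqr e1; case: x => a b; rewrite frame_coords /dot /rot90/=.
by congr (_, _); rewrite -[RHS]mulr1 -e1; ring.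
Qed.

Lemma enorm_frame e (s y : R) : enorm e = 1 -> enorm (frame e s y) ^+ 2 = s ^+ 2 + y ^+ 2.
Proof.
move=> /enorm1_sqr e1; rewrite enorm_sqr.
rewrite [RHS](_ : _ = (s ^+ 2 + y ^+ 2) * 1); last by rewrite mulr1.
by rewrite -e1 frame_coords/=; ring.
Qed.

Lemma le_enorm_sum (s y c : R) : 0 <= c -> s ^+ 2 + y ^+ 2 <= c ^+ 2 -> forall x, enorm x ^+ 2 = s ^+ 2 + y ^+ 2 -> enorm x <= c.
Proof.
by move=> c0 h x xE; rewrite -(@ler_pXn2r _ 2)// ?nnegrE ?enorm_ge0// xE.
Qed.

Lemma dot_in_ball e x y (r : R) : enorm e = 1 -> enorm (x - y) < r ->
  dot y e - r <= dot x e <= dot y e + r.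
Proof.
move=> e1 xr; have h1 := dot_le_enorm (x - y) e; have h2 := dot_le_enorm (y - x) e.
by move: h1 h2; rewrite e1 !mulr1 !dotB [enorm (y - x)]enormB => *; apply/andP; split; lra.
Qed.

End frames.

Section integral_restriction.
Context d (X : measurableType d) (R : realType).
Variables (m : {measure set X -> \bar R}) (D : set X) (mD : measurable D).
Local Open Scope ereal_scope.

Lemma ge0_integral_mrestr (f : X -> \bar R) : (forall x, 0 <= f x) ->
  measurable_fun setT f ->
  \int[mrestr m mD]_x f x = \int[m]_(x in D) f x.
Proof.
move=> f0 mf.
have N0 : mrestr m mD (~` D) = 0 by rewrite /mrestr setICl measure0.
rewrite (ge0_negligible_integral (measurableC mD) measurableT mf (fun x _ => f0 x) N0).
rewrite setTD setCK; apply: eq_measure_integral => A mA AD.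
by rewrite /= /mrestr setIidl.
Qed.

End integral_restriction.

Section charts.
Context {R : realType}.
Implicit Types (O : set (R * R)) (x e : R * R) (r : R) (f : R -> R).

Lemma chart_continuous O (x0 : R * R) r e f : graph_chart O x0 r e f -> continuous f.
Proof. by move=> [_ _ [df _ _] _] s; apply: differentiable_continuous; apply/derivable1_diffP; exact: df. Qed.

(** The derivative of the C^2 function f is bounded on [a, b] by compactness. *)
Lemma chart_lipschitz O (x0 : R * R) r e f (a b : R) : graph_chart O x0 r e f ->
  exists2 L, 0 < L & forall s t, a <= s <= b -> a <= t <= b ->
    enorm (frame e s (f s) - frame e t (f t)) <= L * `|s - t|.
Proof.
move=> ch; have cf := chart_continuous ch; case: ch => _ e1 [df ddf _] _.
have cdf : continuous (derive1 f).
  by move=> s; apply: differentiable_continuous; apply/derivable1_diffP; exact: ddf.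
have [M M0 fM] : exists2 M, 0 <= M & forall s, a <= s <= b -> `|derive1 f s| <= M.
  have [ab|ba] := leP a b; last first.
    by exists 0 => // s /andP[as_ sb]; have := le_trans as_ sb; rewrite leNgt ba.
  have [c cab cM] := @EVT_max R (fun s => `|derive1 f s|) a b ab ltac:(
    apply: continuous_subspaceT => s; apply: continuous_comp; [exact: cdf|exact: norm_continuous]).
  by exists `|derive1 f c| => // s sab; apply: cM; rewrite in_itv.
have lip s t : a <= s <= b -> a <= t <= b -> `|f s - f t| <= M * `|s - t|.
  wlog st : s t / t <= s.
    move=> H sab tab; have [ts|/ltW st] := leP t s; first exact: H.
    by rewrite distrC [X in _ * X]distrC; exact: H.
  move=> /andP[as_ sb] /andP[at_ tb].
  have [|c] := @MVT_segment R f (derive1 f) t s st _ (continuous_subspaceT cf).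
    by move=> c _; rewrite derive1E; apply/derivableP; exact: df.
  rewrite in_itv/= => /andP[tc cs] ->; rewrite normrM ler_wpM2r//; apply: fM.
  by rewrite (le_trans at_ tc) (le_trans cs).
exists (1 + M); first lra.
move=> s t sab tab; rewrite frameB.
apply: (@le_enorm_sum _ (s - t) (f s - f t)); last exact: enorm_frame.
  by rewrite mulr_ge0//; lra.
have := lip _ _ sab tab; set u := f s - f t; set v := s - t => uv.
have v0 : 0 <= `|v| by [].
have u2 : u ^+ 2 <= (M * `|v|) ^+ 2.
  by rewrite -[u ^+ 2]real_normK ?num_real// ler_pXn2r// nnegrE// mulr_ge0.
rewrite -[v ^+ 2]real_normK ?num_real//; apply: le_trans (lerD (lexx _) u2) _.
rewrite -subr_ge0 (_ : _ - _ = M * `|v| ^+ 2 *+ 2); first by rewrite mulrn_wge0// mulr_ge0// sqr_ge0.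
by ring.
Qed.

Lemma chart_image_measurable O (x0 : R * R) r e f (J : set R) : graph_chart O x0 r e f ->
  measurable J -> measurable [set frame e s (f s) | s in J].
Proof.
move=> ch mJ; have cf := chart_continuous ch; case: ch => _ e1 _ _.
have mfd : measurable_fun setT (fun x => dot x (rot90 e) - f (dot x e)).
  apply: continuous_measurable2 => x; apply: cvgB; first exact: continuous_dot.
  by apply: (continuous_comp (f := fun x => dot x e)); [exact: continuous_dot|exact: cf].
have mde : measurable_fun setT (fun x => dot x e).
  by apply: continuous_measurable2; exact: continuous_dot.
rewrite (_ : image _ _ = (fun x => dot x e) @^-1` J `&`
    (fun x => dot x (rot90 e) - f (dot x e)) @^-1` [set 0]).
  apply: measurableI; first by rewrite -[X in measurable X]setTI; exact: mde.
  by rewrite -[X in measurable X]setTI; apply: mfd.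
apply/seteqP; split=> [_ [s Js <-]|x [/= Jx /subr0_eq xf]] /=.
  by rewrite dot_frame1// dot_frame2// subrr.
by exists (dot x e) => //; rewrite -xf frameE.
Qed.

(** The region below the graph is a neighbourhood of y that misses O. *)
Lemma chart_below O (x0 : R * R) r e f y : graph_chart O x0 r e f -> enorm (y - x0) < r ->
  dot y (rot90 e) < f (dot y e) -> ~ closure O y.
Proof.
move=> ch yr yf; have cf := chart_continuous ch; case: ch => _ e1 _ chO.
have : nbhs y [set z | enorm (z - x0) < r /\ dot z (rot90 e) < f (dot z e)].
  apply: filterI; first exact: (@continuous_enormB R x0 y _ (lt_nbhsl yr)).
  have h : continuous (fun z => dot z (rot90 e) - f (dot z e)).
    move=> x; apply: cvgB; first exact: continuous_dot.
    by apply: (continuous_comp (f := fun x => dot x e)); [exact: continuous_dot|exact: cf].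
  have fy : dot y (rot90 e) - f (dot y e) < 0 by rewrite subr_lt0.
  have H : nbhs y [set z | dot z (rot90 e) - f (dot z e) < 0] := h y _ (lt_nbhsl fy).
  by apply: filterS H => z /=; rewrite subr_lt0.
move=> yN /(_ _ yN)[z [/= Oz [zr zf]]].
by have /chO[h _] := zr; have := h Oz; rewrite ltNge ltW.
Qed.

(** Near x0 the points above the graph are interior to O and the points below
    it are exterior, which leaves only the graph. *)
Lemma chart_boundary O (x0 : R * R) r e f x : open O -> graph_chart O x0 r e f ->
  topological_boundary O x -> enorm (x - x0) < r ->
  dot x (rot90 e) = f (dot x e).
Proof.
move=> oO ch [cx nx] xr; case: (ltgtP (dot x (rot90 e)) (f (dot x e))) => // h.
  by have := chart_below ch xr h.
exfalso; apply: nx; move/interior_id: (oO) => ->.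
by case: ch => _ _ _ /(_ _ xr)[_]; apply.
Qed.

Lemma topological_boundary_closed O : closed (topological_boundary O).
Proof.
rewrite /topological_boundary setDE; apply: closedI; first exact: closed_closure.
by apply: open_closedC; exact: open_interior.
Qed.

End charts.

(** * Sweeping the boundary over a strip *)

Section strip.
Context {R : realType}.
Local Open Scope ereal_scope.
Local Notation mu := (@lebesgue_measure R).
Implicit Types (O : set (R * R)) (e : R * R) (r : R) (f : R -> R).

Lemma measurable_ray_map (v : R * R) :
  measurable_fun setT (fun z : (R * R) * R => z.1 - z.2 *: v)%R.
Proof.
apply: measurable_fun_pair => /=.
  apply: measurable_funB; first exact: (measurableT_comp measurable_fst).
  by apply: measurable_funM.
apply: measurable_funB; first exact: (measurableT_comp measurable_snd).
by apply: measurable_funM.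
Qed.

Lemma measurable_ray_pt (x v : R * R) : measurable_fun setT (fun s : R => x - s *: v)%R.
Proof.
by apply: measurable_fun_pair => /=; apply: measurable_funB => //; apply: measurable_funM.
Qed.

Lemma measurable_ray (u : R * R -> \bar R) (v : R * R) : measurable_fun setT u ->
  measurable_fun setT (fun z : (R * R) * R => u (z.1 - z.2 *: v)%R).
Proof. by move=> mu_; apply: (measurableT_comp mu_); exact: measurable_ray_map. Qed.

Lemma measurable_frame e f : measurable_fun setT f ->
  measurable_fun setT (fun s => frame e s (f s)).
Proof.
move=> mf; under eq_fun do rewrite frame_coords.
apply: measurable_fun_pair; [apply: measurable_funB|apply: measurable_funD];
  by apply: measurable_funM.
Qed.

Lemma measurable_boundary_ball O (x0 : R * R) r :
  measurable (topological_boundary O `&` [set x | (enorm (x - x0) < r)%R]).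
Proof.
apply: measurableI; first by apply: closed_measurable2; exact: topological_boundary_closed.
rewrite (_ : [set _ | _] = (fun x => enorm (x - x0)%R) @^-1` `]-oo, r[).
  by rewrite -[X in measurable X]setTI; apply: continuous_measurable2 => //; exact: continuous_enormB.
by apply/seteqP; split=> x /=; rewrite in_itv.
Qed.

(** Length on a chart is at most L ds, and (s, y) |-> s e + y e' preserves
    area, so sweeping the boundary along the normal direction of the chart
    costs at most L times area. *)
Lemma strip_comparison O (x0 : R * R) r e f :
  open O -> graph_chart O x0 r e f ->
  exists2 L : R, (0 < L)%R & forall u : R * R -> \bar R,
    measurable_fun setT u -> (forall x, 0 <= u x) ->
    \int[hausdorff1]_(x in topological_boundary O `&` [set x | (enorm (x - x0) < r)%R])
      \int[mu]_s u (x - s *: rot90 e)%R <= L%:E * \int[leb2]_z u z.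
Proof.
move=> oO ch; have cf := chart_continuous ch; have [r0 e1 _ _] := ch.
have [L L0 gL] := chart_lipschitz (dot x0 e - r) (dot x0 e + r) ch.
exists L => // u mu_ u0; set G := _ `&` _.
have mG : measurable G by exact: measurable_boundary_ball.
pose U (x : R * R) : \bar R := \int[mu]_s u (x - s *: rot90 e)%R.
have mU : measurable_fun setT U.
  have h := @measurable_fun_fubini_tonelli_F _ _ _ _ R mu _ (measurable_ray (rot90 e) mu_) (fun=> u0 _). exact: h.
have U0 x : 0 <= U x by apply: integral_ge0.
rewrite -(@ge0_integral_mrestr _ _ _ hausdorff1 _ mG U)//.
pose g s := frame e s (f s).
have mg : measurable_fun setT g by apply: measurable_frame; exact: continuous_measurable_fun.
pose m2 := mscale (NngNum (ltW L0)) (pushforward mu (g : measurableTypeR R -> _)).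
have {}mg : measurable_fun (setT : set (measurableTypeR R)) g by exact: mg.
apply: (@le_trans _ _ (\int[m2 mg]_x U x)).
  apply: ge0_le_measure_integral => // A mA.
  rewrite /mrestr/= /m2 /mscale/= /pushforward.
  pose J : set R := `[(dot x0 e - r)%R, (dot x0 e + r)%R]%classic.
  apply: (@le_trans _ _ (hausdorff1 (g @` ((g @^-1` A) `&` J)))).
    apply: le_hausdorff1 => x [Ax [Gx /= xr]].
    have xf := chart_boundary oO ch Gx xr.
    have gx : g (dot x e) = x by rewrite /g -xf frameE.
    exists (dot x e) => //; split => /=; first by rewrite gx.
    rewrite /J/= in_itv/=.
    exact: dot_in_ball.
  apply: hausdorff1_curve => //.
  by move=> s t; apply: chart_image_measurable ch _; apply: measurableI; exact: measurable_itv.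
rewrite ge0_integral_mscale// ge0_integral_pushforward//= preimage_setT.
apply: lee_wpmul2l; first by rewrite lee_fin ltW.
rewrite -[leRHS](leb2_rotate (enorm1_sqr e1))//.
have mrot : measurable_fun setT (fun z : R * R => u (frame e z.1 z.2)).
  apply: (measurableT_comp mu_); under eq_fun do rewrite frame_coords.
  by apply: measurable_fun_pair; [apply: measurable_funB|apply: measurable_funD];
     apply: measurable_funM.
rewrite (leb2_int12 mrot (fun=> u0 _)).
rewrite le_eqVlt; apply/orP; left; apply/eqP; apply: eq_integral => s _.
have mrots : measurable_fun setT (fun y => u (frame e s y)).
  by apply: (measurableT_comp mrot (measurable_pairl s)).
rewrite /U -[RHS](@ge0_integral_translate _ _ (f s))//.
rewrite -[RHS]ge0_integral_opp//; last first.
  apply: (measurableT_comp mrots); exact: measurable_funD.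
apply: eq_integral => y _; congr (u _).
by rewrite /g !frame_coords /=; congr (_, _); rewrite /= /GRing.scale/=; ring.
Qed.

End strip.

(** * Functions of class C^1 *)

Section C1_functions.
Context {R : realType}.
Implicit Types (v : R * R -> R) (x y u a b k : R * R).

(** As in C1c, only partial derivatives are asked to exist; the continuity of
    the gradient then makes v continuous and differentiable along any line. *)
Definition C1 v : Prop :=
  (forall x, derivable v x ((1, 0) : R * R) /\ derivable v x ((0, 1) : R * R)) /\
  continuous (grad v).

Lemma C1c_C1 U v : C1c U v -> C1 v.
Proof. by case. Qed.

Lemma is_derive_lim (phi : R -> R) (t l : R) :
  (forall e, 0 < e -> exists2 d, 0 < d & forall h, h != 0 -> `|h| < d ->
    `|phi (t + h) - phi t - l * h| <= e * `|h|) ->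
  is_derive t 1 phi l.
Proof.
move=> H.
have cl : (fun h => h^-1 *: ((phi \o shift t) (h *: 1) - phi t)) @ 0^' --> l.
  apply/cvgrPdist_le => e e0; have [d d0 Hd] := H _ e0.
  near=> h => /=.
  have h0 : h != 0 by near: h; exact: nbhs_dnbhs_neq.
  have hd : `|h| < d by near: h; apply: dnbhs0_lt.
  have := Hd h h0 hd; rewrite [h *: 1]mulr1 [h + t]addrC /GRing.scale/= => Hh.
  have hp : 0 < `|h| by rewrite normr_gt0.
  rewrite -(ler_pM2r hp); apply: le_trans Hh.
  rewrite -normrM mulrBl mulrAC mulVf// mul1r.
  by rewrite distrC.
apply: DeriveDef; first by apply/cvg_ex; exists l.
exact: cvg_lim.
Unshelve. all: by end_near. Qed.

Lemma quotient_fst v (a1 a2 : R) :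
  (fun h : R => h^-1 *: ((v \o shift (a1, a2)) (h *: ((1, 0) : R * R)) - v (a1, a2))) =
  (fun h : R => h^-1 *: (((fun t => v (t, a2)) \o shift a1) (h *: 1) - v (a1, a2))).
Proof.
apply/funext => h /=; congr (_ *: (v _ - _)); congr (_, _).
by rewrite /= [h *: 0]mulr0 add0r.
Qed.

Lemma quotient_snd v (a1 a2 : R) :
  (fun h : R => h^-1 *: ((v \o shift (a1, a2)) (h *: ((0, 1) : R * R)) - v (a1, a2))) =
  (fun h : R => h^-1 *: (((fun t => v (a1, t)) \o shift a2) (h *: 1) - v (a1, a2))).
Proof.
apply/funext => h /=; congr (_ *: (v _ - _)); congr (_, _).
by rewrite /= [h *: 0]mulr0 add0r.
Qed.

Lemma is_derive_fst v (a1 a2 : R) : derivable v (a1, a2) ((1, 0) : R * R) ->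
  is_derive a1 1 (fun t => v (t, a2)) (grad v (a1, a2)).1.
Proof.
by move=> dv; apply: DeriveDef; [move: dv; rewrite /derivable quotient_fst|rewrite /grad/= /derive quotient_fst].
Qed.

Lemma is_derive_snd v (a1 a2 : R) : derivable v (a1, a2) ((0, 1) : R * R) ->
  is_derive a2 1 (fun t => v (a1, t)) (grad v (a1, a2)).2.
Proof.
by move=> dv; apply: DeriveDef; [move: dv; rewrite /derivable quotient_snd|rewrite /grad/= /derive quotient_snd].
Qed.

Lemma MVT_increment (phi dphi : R -> R) (t k : R) :
  (forall s : R, is_derive s 1 phi (dphi s)) ->
  exists2 c, `|c - t| <= `|k| & phi (t + k) - phi t = dphi c * k.
Proof.
move=> dp.
have cp : continuous phi.
  by move=> s; apply: differentiable_continuous; apply/derivable1_diffP; exact: ex_derive.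
have [k0|k0] := leP 0 k.
  have [|c] := @MVT_segment R phi dphi t (t + k) _ (fun s _ => dp s) (continuous_subspaceT cp).
    by rewrite lerDl.
  rewrite in_itv/= => /andP[tc ck] E; exists c.
    by rewrite !ger0_norm ?subr_ge0// lerBlDl.
  by rewrite E; congr (_ * _); ring.
have [|c] := @MVT_segment R phi dphi (t + k) t _ (fun s _ => dp s) (continuous_subspaceT cp).
  by rewrite gerDl ltW.
rewrite in_itv/= => /andP[kc ct] E; exists c.
  rewrite ler0_norm ?subr_le0// ltr0_norm//; lra.
by rewrite -opprB E; ring.
Qed.

(** One coordinate is moved at a time, each by the mean value theorem. *)
Lemma C1_increment v b k : C1 v ->
  exists c, [/\ `|c.1 - b.1| <= `|k.1|, `|c.2 - b.2| <= `|k.2| &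
    v (b + k) - v b = (grad v (c.1, b.2 + k.2)).1 * k.1 + (grad v (b.1, c.2)).2 * k.2].
Proof.
case: b k => b1 b2 [k1 k2] [dv _] /=.
have [c1 c1b E1] := MVT_increment b1 k1 (fun s => is_derive_fst (dv (s, b2 + k2)).1).
have [c2 c2b E2] := MVT_increment b2 k2 (fun s => is_derive_snd (dv (b1, s)).2).
exists (c1, c2); split => //=; rewrite -E1 -E2; ring.
Qed.

Lemma grad_near v b (e : R) : C1 v -> 0 < e -> exists2 d, 0 < d & forall x,
  `|x.1 - b.1| < d -> `|x.2 - b.2| < d ->
  `|(grad v x).1 - (grad v b).1| < e /\ `|(grad v x).2 - (grad v b).2| < e.
Proof.
move=> [_ cg] e0.
have : nbhs b (grad v @^-1` (ball (grad v b) e)) by apply: cg; exact: nbhsx_ballx.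
move=> /nbhs_ballP[d /= d0 dP].
exists d => // x x1 x2.
have [] : ball (grad v b) e (grad v x).
  by apply: dP; split; rewrite /ball/= distrC.
rewrite /ball/= => h1 h2.
by rewrite distrC h1 distrC h2.
Qed.

Lemma C1_is_derive_line v a u (t : R) : C1 v ->
  is_derive t 1 (fun s => v (a + s *: u)) (dot (grad v (a + t *: u)) u).
Proof.
move=> cv; apply: is_derive_lim => e e0.
pose N := `|u.1| + `|u.2| + 1.
have N0 : 0 < N by rewrite /N ltr_wpDl// addr_ge0.
move En : (a + t *: u) => b.
have [d d0 gd] := @grad_near v b (e / N) cv (divr_gt0 e0 N0).
exists (d / N); first exact: divr_gt0.
move=> h h0 hd.
have hN : `|h| * N < d by rewrite -ltr_pdivlMr.
have -> : a + (t + h) *: u = b + h *: u.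
  by rewrite scalerDl addrA En.
have [c [c1 c2 ->]] := C1_increment b (h *: u) cv.
move: c1 c2; rewrite /= /GRing.scale/= !normrM => c1 c2.
have u1N : `|h| * `|u.1| < d.
  by apply: le_lt_trans hN; rewrite ler_wpM2l// /N -addrA lerDl addr_ge0.
have u2N : `|h| * `|u.2| < d.
  by apply: le_lt_trans hN; rewrite ler_wpM2l// /N addrAC lerDr addr_ge0.
have [|/=|g1 _] := gd (c.1, b.2 + h * u.2); first exact: le_lt_trans u1N.
  by rewrite addrAC subrr add0r normrM.
have [|/=|_ g2] := gd (b.1, c.2); [by rewrite subrr normr0|exact: le_lt_trans u2N|].
move: g1 g2; set X := (grad v _).1 - _; set Y := (grad v _).2 - _ => g1 g2.
rewrite (_ : _ - _ = (X * u.1 + Y * u.2) * h); last by rewrite /X /Y /dot /grad /=; ring.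
clearbody X Y.
rewrite normrM ler_wpM2r//; apply: le_trans (ler_normD _ _) _; rewrite !normrM.
apply: (@le_trans _ _ (e / N * N)); last by rewrite divfK// gt_eqF.
have eN0 : 0 <= e / N by rewrite ltW// divr_gt0.
rewrite /N !mulrDr mulr1 -[leLHS]addr0; apply: lerD => //.
apply: lerD; apply: ler_wpM2r; rewrite ?normr_ge0//; [exact: ltW g1|exact: ltW g2].
Qed.

Lemma C1_continuous v : C1 v -> continuous v.
Proof.
move=> cv b; apply/cvgrPdist_le => e e0.
have [d d0 gd] := @grad_near v b 1 cv ltr01.
pose M := `|(grad v b).1| + `|(grad v b).2| + 2.
have M0 : 0 < M by rewrite /M ltr_wpDl// addr_ge0.
pose r := Num.min d (e / M).
have r0 : 0 < r by rewrite lt_min d0 divr_gt0.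
have : nbhs b (ball b r) by exact: nbhsx_ballx.
apply: filterS => x [/=]; rewrite /ball/= => x1 x2.
have xb : x = b + (x - b) by rewrite addrC subrK.
rewrite distrC {1}xb; have [c [c1 c2 ->]] := C1_increment b (x - b) cv.
move: c1 c2; rewrite /=.
have [x1d x1e] : `|x.1 - b.1| < d /\ `|x.1 - b.1| < e / M.
  by move: x1; rewrite lt_min distrC => /andP[].
have [x2d x2e] : `|x.2 - b.2| < d /\ `|x.2 - b.2| < e / M.
  by move: x2; rewrite lt_min distrC => /andP[].
move=> c1 c2.
have [|/=|g1 _] := gd (c.1, b.2 + (x.2 - b.2)); first exact: le_lt_trans x1d.
  by rewrite addrAC subrr add0r.
have [|/=|_ g2] := gd (b.1, c.2); [by rewrite subrr normr0|exact: le_lt_trans x2d|].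
apply: le_trans (ler_normD _ _) _; rewrite !normrM.
apply: (@le_trans _ _ (M * (e / M))); last by rewrite mulrC divfK// gt_eqF.
have G (p q : R) : `|p - q| < 1 -> `|p| <= `|q| + 1.
  move=> pq; rewrite -[p](subrK q); apply: le_trans (ler_normD _ _) _.
  by rewrite addrC lerD2l ltW.
have ME : M = (`|(grad v b).1| + 1) + (`|(grad v b).2| + 1) by rewrite /M; ring.
rewrite ME mulrDl -ME; apply: lerD.
  exact: (ler_pM (normr_ge0 _) (normr_ge0 _) (G _ _ g1) (ltW x1e)).
exact: (ler_pM (normr_ge0 _) (normr_ge0 _) (G _ _ g2) (ltW x2e)).
Qed.

(** Cauchy-Schwarz along a segment, obtained from 2 c D - c^2 s <= int D'^2 with
    c the mean slope. *)
Lemma sqr_increment_le (phi dphi : R -> R) (s d : R) : 0 <= s <= d ->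
  (forall t : R, is_derive t 1 phi (dphi t)) -> continuous dphi ->
  (((phi s - phi 0) ^+ 2)%:E <=
    d%:E * \int[lebesgue_measure]_(t in `[0%R, d]) (dphi t ^+ 2)%:E)%E.
Proof.
move=> /andP[s0 sd] dp cdp.
have d0 := le_trans s0 sd.
have I0 (c : R) : (0 <= \int[lebesgue_measure]_(t in `[0%R, c]) (dphi t ^+ 2)%:E)%E.
  by apply: integral_ge0 => t _; rewrite lee_fin sqr_ge0.
move: s0; rewrite le_eqVlt => /predU1P[<-|s0].
  by rewrite subrr expr0n/= mule_ge0// lee_fin.
have md : measurable_fun setT (fun t => (dphi t ^+ 2)%:E).
  apply/measurable_EFinP; apply: measurable_funX; exact: continuous_measurable_fun.
apply: (@le_trans _ _ (s%:E * \int[lebesgue_measure]_(t in `[0%R, s]) (dphi t ^+ 2)%:E)%E); last first.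
  apply: lee_pmul; rewrite ?lee_fin//; first exact: ltW.
  apply: ge0_subset_integral => //; first exact: measurable_funTS.
    by move=> t _; rewrite lee_fin sqr_ge0.
  by move=> t /=; rewrite !in_itv/= => /andP[-> /le_trans->].
pose D := phi s - phi 0; pose c := D / s.
rewrite -lee_pdivrMl//.
have -> : (s^-1%:E * ((phi s - phi 0) ^+ 2)%:E)%E =
    (\int[lebesgue_measure]_(t in `[0%R, s]) (2 * c * dphi t - c ^+ 2)%:E)%E.
  have dF (t : R) : is_derive t 1 (fun t => 2 * c * phi t - c ^+ 2 * t) (2 * c * dphi t - c ^+ 2).
    have := dp t => dpt.
    have -> : 2 * c * dphi t - c ^+ 2 = (2 * c) *: dphi t - (c ^+ 2) *: 1.
      by rewrite [(c ^+ 2) *: 1]mulr1.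
    by apply: is_deriveB; apply: is_deriveZ.
  rewrite (@continuous_FTC2 _ _ (fun t => 2 * c * phi t - c ^+ 2 * t) 0 s)//.
  - rewrite -EFinB -EFinM; congr (_%:E); rewrite /c /D; field.
    by rewrite gt_eqF.
  - apply: continuous_subspaceT => t; apply: cvgB; last exact: cvg_cst.
    by apply: cvgM; [exact: cvg_cst|exact: cdp].
  - have cF : continuous (fun t => 2 * c * phi t - c ^+ 2 * t).
      by move=> t; apply: differentiable_continuous; apply/derivable1_diffP; (have dFt := dF t; exact: ex_derive).
    split; first by move=> t _; (have dFt := dF t; exact: ex_derive).
      by apply: cvg_at_right_filter; exact: cF.
    by apply: cvg_at_left_filter; exact: cF.
  - by move=> t _; rewrite derive1E; (have dFt := dF t; exact: derive_val).
apply: le_integral; first exact: measurable_itv.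
- apply: (@continuous_compact_integrable _ (fun t => 2 * c * dphi t - c ^+ 2)); first exact: segment_compact.
  apply: continuous_subspaceT => t; apply: cvgB; last exact: cvg_cst.
  by apply: cvgM; [exact: cvg_cst|exact: cdp].
- apply: (@continuous_compact_integrable _ (fun t => dphi t ^+ 2)); first exact: segment_compact.
  apply: continuous_subspaceT => t.
  apply: (continuous_comp (f := dphi) (g := fun z : R => z ^+ 2)); [exact: cdp|exact: exprn_continuous].
- move=> t _; rewrite lee_fin -subr_ge0 (_ : _ - _ = (dphi t - c) ^+ 2) ?sqr_ge0//.
  by ring.
Qed.

Lemma C1_sqr_increment_le v x u (s d : R) : C1 v -> enorm u = 1 -> 0 <= s <= d ->
  (((v x - v (x - s *: u)) ^+ 2)%:E <=
    d%:E * \int[lebesgue_measure]_(t in `[0%R, d]) (enorm (grad v (x - t *: u)) ^+ 2)%:E)%E.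
Proof.
move=> cv u1 sd.
have cgu : continuous (fun t : R => grad v (x + t *: - u)).
  move=> t; apply: (continuous_comp (f := fun t : R => x + t *: - u)); last exact: cv.2.
  by apply: cvgD; [exact: cvg_cst|apply: cvgZr_tmp; exact: cvg_id].
have := @sqr_increment_le (fun t => v (x + t *: - u)) _ s d sd
  (fun t => C1_is_derive_line x (- u) t cv).
rewrite /= scale0r addr0 scalerN -[_ - v x]opprB sqrrN => H.
apply: le_trans (H _) _.
  by move=> t; apply: (continuous_comp (f := fun t : R => grad v (x + t *: - u)) (g := fun z => dot z (- u)));
    [exact: cgu|exact: continuous_dot].
apply: lee_wpmul2l; first by case/andP: sd => h1 h2; rewrite lee_fin (le_trans h1).
apply: le_lower_integral => t _; rewrite lee_fin; first exact: sqr_ge0.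
apply: le_trans (dot_sqr_le _ _) _.
by rewrite enormN u1 expr1n mulr1 scalerN.
Qed.

End C1_functions.

(** * Traces as limits along rays *)

Section L2_facts.
Context d (X : measurableType d) (R : realType) (mu : {measure set X -> \bar R}).
Implicit Types (D : set X) (f : X -> R).

Lemma L2_measurable_restrict D f : L2 mu D f -> measurable_fun setT (f \_ D).
Proof. by rewrite /L2 inE => /andP[]; rewrite inE. Qed.

Lemma L2_measurable D f : measurable D -> L2 mu D f -> measurable_fun D f.
Proof. by move=> mD /L2_measurable_restrict/(measurable_restrictT _ mD).2. Qed.

Lemma L2_sqr_lty D f : L2 mu D f ->
  (\int[mu]_(x in D) (f x ^+ 2)%:E < +oo)%E.
Proof.
move=> /Lfun2_integrable_sqr /integrableP[_]; apply: le_lt_trans.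
rewrite integral_mkcond; apply: le_lower_integral => x _; rewrite /patch/=; case: ifP => // _;
  by rewrite ?expr0n ?lee_fin ?sqr_ge0 ?normr0 ?ler_norm.
Qed.

End L2_facts.

Section measurability.
Context {R : realType}.
Local Open Scope ereal_scope.

Lemma measurable_integral_on d (X : measurableType d) (D : set R) (F : X * R -> \bar R) :
  measurable D -> measurable_fun setT F -> (forall z, 0 <= F z) ->
  measurable_fun setT (fun x => \int[lebesgue_measure]_(s in D) F (x, s)).
Proof.
move=> mD mF F0.
have mS : measurable (snd @^-1` D : set (X * R)).
  by rewrite -[X in measurable X]setTI; exact: measurable_snd.
have mG : measurable_fun setT (F \_ (snd @^-1` D)).
  exact: ((measurable_restrictT F mS).1 (measurable_funTS mF)).
have h := @measurable_fun_fubini_tonelli_F _ _ _ _ R lebesgue_measure _ mG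
  (fun z => ltac:(rewrite /patch; case: ifP => // _; exact: F0)).
rewrite (_ : (fun x => _) = fubini_F lebesgue_measure (F \_ (snd @^-1` D)))//.
apply/funext => x; rewrite /fubini_F [LHS]integral_mkcond; apply: eq_integral => s _.
by rewrite /patch; congr (if _ then _ else _); apply/idP/idP => /set_mem h'; apply/mem_set.
Qed.

Lemma measurable_sqr_enorm d (X : measurableType d) (D : set X) (a : X -> R * R) :
  measurable_fun D (fst \o a) -> measurable_fun D (snd \o a) ->
  measurable_fun D (fun x => (enorm (a x) ^+ 2)%:E).
Proof.
move=> m1 m2; apply/measurable_EFinP; under eq_fun do rewrite enorm_sqr.
by apply: measurable_funD; apply: measurable_funX.
Qed.

End measurability.

Section trace.
Context {R : realType}.
Local Open Scope ereal_scope.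
Local Notation mu := (@lebesgue_measure R).
Implicit Types (O : set (R * R)) (e : R * R) (r : R) (f : R -> R) (w h : R * R -> R).

Lemma graph_chart_shrink O (x0 : R * R) r r' e f : (0 < r')%R -> (r' <= r)%R ->
  graph_chart O x0 r e f -> graph_chart O x0 r' e f.
Proof.
move=> r0 rr [_ e1 df H]; split => // x xr; apply: H; exact: lt_le_trans rr.
Qed.

(** The boundary point lies on the graph, so the ray runs strictly below it. *)
Lemma chart_ray_exterior O (x0 : R * R) r e f x (s : R) : open O -> graph_chart O x0 r e f ->
  topological_boundary O x -> (enorm (x - x0) < r / 2)%R -> (0 < s)%R -> (s <= r / 2)%R ->
  (enorm (x - s *: rot90 e - x0) < r)%R /\ ~ closure O (x - s *: rot90 e)%R.
Proof.
move=> oO ch Ox xr s0 sr; have [r0 e1 _ _] := ch.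
have yr : (enorm (x - s *: rot90 e - x0) < r)%R.
  rewrite addrAC; apply: le_lt_trans (enormD_le _ _) _.
  by rewrite enormN enormZ enorm_rot90 e1 mulr1 gtr0_norm//; lra.
split => //; apply: (chart_below ch yr).
have xf : dot x (rot90 e) = f (dot x e) by apply: chart_boundary ch Ox _ => //; lra.
rewrite !dotBZ dot_rot90 mulr0 subr0 -xf dot_self ?enorm_rot90//; lra.
Qed.

Lemma cvge0_ex_le (u : nat -> \bar R) (v : nat -> \bar R) (eps : R) : (0 < eps)%R ->
  u @ \oo --> 0 -> v @ \oo --> 0 -> exists k, u k <= eps%:E /\ v k <= eps%:E.
Proof.
move=> e0 u0 v0.
have H (z : nat -> \bar R) : z @ \oo --> 0 -> \forall k \near \oo, z k <= eps%:E.
  move=> /(_ [set y | y < eps%:E]) zz.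
  have : nbhs (0 : \bar R) [set y | y < eps%:E] by apply: open_nbhs_nbhs; split; [exact: open_ereal_lt_ereal|rewrite /= lte_fin].
  move=> /zz hz; have hz2 : \oo [set k | z k < eps%:E] by exact: hz.
  by apply: filterS hz2 => k /= /ltW.
have [k [uk vk]] := filter_ex (filterI (H _ u0) (H _ v0)).
by exists k.
Qed.

Lemma sqr_sum3 (a b c : R) : ((a + b + c) ^+ 2 <= 3 * a ^+ 2 + 3 * b ^+ 2 + 3 * c ^+ 2)%R.
Proof.
rewrite -subr_ge0 (_ : _ - _ = (a - b) ^+ 2 + (b - c) ^+ 2 + (a - c) ^+ 2)%R; last by ring.
by rewrite !addr_ge0// sqr_ge0.
Qed.

Lemma sqr_sum2 (a b : R) : ((a + b) ^+ 2 <= 2 * a ^+ 2 + 2 * b ^+ 2)%R.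
Proof.
rewrite -subr_ge0 (_ : _ - _ = (a - b) ^+ 2)%R; last by ring.
exact: sqr_ge0.
Qed.

Section trace_ray.
Variables (O : set (R * R)) (x0 : R * R) (r : R) (e : R * R) (f : R -> R).
Hypotheses (oO : open O) (ch : graph_chart O x0 r e f).
Let G := topological_boundary O.
Let Omega := ~` closure O.
Let Gr := G `&` [set x | (enorm (x - x0) < r / 2)%R].

(** The squared L^2 distance, along the ray of length delta issued from x into
    Omega, between w and the constant h x. *)
Definition ray_defect w h (delta : R) (x : R * R) : \bar R :=
  \int[mu]_(s in `]0%R, delta]) (((h \_ G) x - (w \_ Omega) (x - s *: rot90 e)) ^+ 2)%:E.

Let mG : measurable G.
Proof. by apply: closed_measurable2; exact: topological_boundary_closed. Qed.

Let mGr : measurable Gr.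
Proof. exact: measurable_boundary_ball. Qed.

Let mOmega : measurable Omega.
Proof. by apply: measurableC; apply: closed_measurable2; exact: closed_closure. Qed.

Lemma measurable_ray_defect w h delta : L2 leb2 Omega w -> L2 hausdorff1 G h ->
  measurable_fun setT (ray_defect w h delta).
Proof.
move=> Lw Lh.
apply: (measurable_integral_on (F := fun z : (R * R) * R =>
    (((h \_ G) z.1 - (w \_ Omega) (z.1 - z.2 *: rot90 e)) ^+ 2)%:E)) => //.
  apply/measurable_EFinP; apply: measurable_funX; apply: measurable_funB.
    exact: (measurableT_comp (L2_measurable_restrict Lh) measurable_fst).
  apply: (measurableT_comp (L2_measurable_restrict Lw)).
  exact: measurable_ray_map.
by move=> z; rewrite lee_fin sqr_ge0.
Qed.

(** The trace is the limit of the translates of w along the rays leaving the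
    boundary: approximate w by C^1 functions v; then v(x) - v(x - s e') is
    controlled by the gradient of v on a strip of width delta. The rays have
    length delta, so the mean square distance along them is O(delta). *)
Lemma trace_ray w h : is_trace Omega G w h ->
  exists2 K : R, (0 <= K)%R & forall delta, (0 < delta)%R -> (delta <= r / 2)%R ->
    \int[hausdorff1]_(x in Gr) ray_defect w h delta x <= (K * delta ^+ 2)%:E.
Proof.
move=> [Lh [g [v [[Lw Lg1 Lg2 _] Cv cvO cvG]]]].
have [r0 e1 _ _] := ch.
have r20 : (0 < r / 2)%R by rewrite divr_gt0.
have chr : graph_chart O x0 (r / 2) e f by apply: graph_chart_shrink ch => //; lra.
have [L L0 strip] := strip_comparison oO chr.
have mw : measurable_fun Omega w by exact: (@L2_measurable _ _ _ leb2 _ _ mOmega Lw).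
have mg1 : measurable_fun Omega (fst \o g) by exact: (@L2_measurable _ _ _ leb2 _ _ mOmega Lg1).
have mg2 : measurable_fun Omega (snd \o g) by exact: (@L2_measurable _ _ _ leb2 _ _ mOmega Lg2).
have mh := L2_measurable mG Lh.
have mv k : measurable_fun setT (v k) by apply: continuous_measurable2; apply: C1_continuous; exact: C1c_C1 (Cv k).
have mgv1 k : measurable_fun setT (fst \o grad (v k)).
  by apply: continuous_measurable2 => x; apply: continuous_comp; [exact: (C1c_C1 (Cv k)).2|exact: continuous2_fst].
have mgv2 k : measurable_fun setT (snd \o grad (v k)).
  by apply: continuous_measurable2 => x; apply: continuous_comp; [exact: (C1c_C1 (Cv k)).2|exact: continuous2_snd].
pose Mg := \int[leb2]_(x in Omega) (enorm (g x) ^+ 2)%:E.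
have Mgfin : Mg < +oo.
  have -> : Mg = \int[leb2]_(x in Omega) ((g x).1 ^+ 2)%:E + \int[leb2]_(x in Omega) ((g x).2 ^+ 2)%:E.
    rewrite -ge0_integralD//; first by apply: eq_integral => x _; rewrite enorm_sqr EFinD.
    - by move=> x _; rewrite lee_fin sqr_ge0.
    - by apply/measurable_EFinP; apply: measurable_funX.
    - by move=> x _; rewrite lee_fin sqr_ge0.
    - by apply/measurable_EFinP; apply: measurable_funX.
  by rewrite lte_add_pinfty//; exact: L2_sqr_lty.
have Mg0 : 0 <= Mg by apply: integral_ge0 => x _; rewrite lee_fin sqr_ge0.
have MgE : Mg = (fine Mg)%:E by rewrite fineK// ge0_fin_numE.
have fMg0 : (0 <= fine Mg)%R by rewrite fine_ge0.
exists (6 * L * fine Mg)%R; first by rewrite !mulr_ge0// ltW.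
move=> delta d0 dr.
apply/lee_addgt0Pr => eps eps0.
pose B := (3 * delta + 6 * delta ^+ 2 * L + 3 * L + 1)%R.
have B0 : (0 < B)%R.
  by rewrite /B ltr_wpDl// !addr_ge0// ?mulr_ge0 ?sqr_ge0//; exact: ltW.
have [k [Jk Ak]] := cvge0_ex_le (divr_gt0 eps0 B0) cvO cvG.
set eB := (eps / B)%R in Jk Ak.
have eB0 : (0 < eB)%R by exact: divr_gt0.
pose u := (fun z => ((v k z - w z) ^+ 2)%:E) \_ Omega.
pose U := (fun z => (enorm (grad (v k) z) ^+ 2)%:E) \_ Omega.
have u0 z : 0 <= u z by rewrite /u /patch; case: ifP => // _; rewrite lee_fin sqr_ge0.
have U0 z : 0 <= U z by rewrite /U /patch; case: ifP => // _; rewrite lee_fin sqr_ge0.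
have mu_ : measurable_fun setT u.
  apply: (measurable_restrictT (fun z => ((v k z - w z) ^+ 2)%:E) mOmega).1.
  apply/measurable_EFinP; apply: measurable_funX.
  by apply: measurable_funB => //; exact: measurable_funTS.
have mU : measurable_fun setT U.
  apply: (measurable_restrictT (fun z => (enorm (grad (v k) z) ^+ 2)%:E) mOmega).1.
  by apply: measurable_sqr_enorm; apply: measurable_funTS.
have Iu : \int[leb2]_z u z <= eB%:E.
  rewrite -integral_mkcond; apply: le_trans Jk.
  by apply: le_lower_integral => z _; rewrite lee_fin ?sqr_ge0// lerDl sqr_ge0.
have IU : \int[leb2]_z U z <= (2 * eB + 2 * fine Mg)%:E.
  rewrite -integral_mkcond.
  apply: (@le_trans _ _ (\int[leb2]_(z in Omega) (2%:E * (enorm (grad (v k) z - g z) ^+ 2)%:E + 2%:E * (enorm (g z) ^+ 2)%:E))).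
    apply: le_lower_integral => z _; rewrite lee_fin ?sqr_ge0// !enorm_sqr/=.
    set a := (grad (v k) z); have := sqr_sum2 (a.1 - (g z).1) (g z).1; have := sqr_sum2 (a.2 - (g z).2) (g z).2.
    by rewrite !subrK /a/=; lra.
  have md : measurable_fun Omega (fun z => (enorm (grad (v k) z - g z) ^+ 2)%:E).
    apply: measurable_sqr_enorm; apply: measurable_funB => //.
      exact: (measurable_funTS (mgv1 k)).
    exact: (measurable_funTS (mgv2 k)).
  rewrite (@ge0_integral_lincomb _ _ _ leb2 Omega (fun z => (enorm (grad (v k) z - g z) ^+ 2)%:E)
    (fun z => (enorm (g z) ^+ 2)%:E) 2 2)//; last 3 first.
  - by move=> z _; rewrite lee_fin sqr_ge0.
  - by move=> z _; rewrite lee_fin sqr_ge0.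
  - exact: measurable_sqr_enorm.
  rewrite [leRHS]EFinD; apply: leeD; last by rewrite EFinM -MgE.
  rewrite EFinM; apply: lee_wpmul2l; first by rewrite lee_fin.
  by apply: le_trans Jk; apply: le_lower_integral => z _; rewrite lee_fin ?sqr_ge0// lerDr sqr_ge0.
pose a (x : R * R) := ((v k x - h x) ^+ 2)%:E.
pose SU (x : R * R) := \int[mu]_s U (x - s *: rot90 e)%R.
pose Su (x : R * R) := \int[mu]_s u (x - s *: rot90 e)%R.
have mSU : measurable_fun setT SU.
  have hh := @measurable_fun_fubini_tonelli_F _ _ _ _ R mu _ (measurable_ray (rot90 e) mU) (fun=> U0 _); exact: hh.
have mSu : measurable_fun setT Su.
  have hh := @measurable_fun_fubini_tonelli_F _ _ _ _ R mu _ (measurable_ray (rot90 e) mu_) (fun=> u0 _); exact: hh.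
have SU0 x : 0 <= SU x by apply: integral_ge0.
have Su0 x : 0 <= Su x by apply: integral_ge0.
have ma : measurable_fun Gr a.
  apply/measurable_EFinP; apply: measurable_funX; apply: measurable_funB; first exact: measurable_funTS.
  by apply: measurable_funS mh => // x [].
have key x : Gr x -> ray_defect w h delta x <=
    (3 * delta)%:E * a x + 1%:E * ((3 * delta ^+ 2)%:E * SU x + 3%:E * Su x).
  move=> [Gx /= xr].
  pose c1 := 3%:E * a x + (3 * delta)%:E * SU x.
  have a0 : 0 <= a x by rewrite lee_fin sqr_ge0.
  have c10 : 0 <= c1.
    by apply: adde_ge0; apply: mule_ge0 => //; rewrite lee_fin ?mulr_ge0 ?ltW.
  have mus : measurable_fun (`]0%R, delta] : set R) (fun s => u (x - s *: rot90 e)%R).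
    apply: measurable_funTS; apply: (measurableT_comp mu_).
    exact: measurable_ray_pt.
  apply: (@le_trans _ _ (\int[mu]_(s in `]0%R, delta]) (c1 + 3%:E * u (x - s *: rot90 e)%R))).
    apply: le_lower_integral => s; first by rewrite lee_fin sqr_ge0.
    rewrite /= in_itv/= => /andP[s0 sd].
    have [_ yO] := chart_ray_exterior oO ch Gx xr s0 (le_trans sd dr).
    set y := (x - s *: rot90 e)%R in yO *.
    have -> : u y = ((v k y - w y) ^+ 2)%:E by rewrite /u patchT//; exact: mem_set.
    have -> : (h \_ G) x = h x by rewrite patchT//; exact: mem_set.
    have -> : (w \_ Omega) y = w y by rewrite patchT//; exact: mem_set.
    have inc : ((v k x - v k y) ^+ 2)%:E <= delta%:E * SU x.
      have := @C1_sqr_increment_le _ (v k) x (rot90 e) s delta (C1c_C1 (Cv k)).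
      rewrite enorm_rot90 e1 => /(_ erefl); rewrite (ltW s0) sd => /(_ isT) H.
      apply: le_trans H _; apply: lee_wpmul2l; first by rewrite lee_fin ltW.
      rewrite -integral_itv_obnd_cbnd; last first.
        have mray : measurable_fun setT (fun t : R => (enorm (grad (v k) (x - t *: rot90 e)%R) ^+ 2)%:E).
          apply: measurable_sqr_enorm; last first.
            exact: (measurableT_comp (mgv2 k) (measurable_ray_pt x (rot90 e))).
          exact: (measurableT_comp (mgv1 k) (measurable_ray_pt x (rot90 e))).
        exact: (measurable_funTS mray).
      apply: le_lower_integral_subset => // t; first by rewrite lee_fin sqr_ge0.
      rewrite /= in_itv/= => /andP[t0 td].
      have [_ zO] := chart_ray_exterior oO ch Gx xr t0 (le_trans td dr).
      by rewrite /U patchT//; exact: mem_set.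
    apply: (@le_trans _ _ ((3 * (v k x - h x) ^+ 2 + 3 * (v k y - w y) ^+ 2)%:E + 3%:E * ((v k x - v k y) ^+ 2)%:E)).
      rewrite -EFinM -EFinD lee_fin.
      have := sqr_sum3 (h x - v k x) (v k x - v k y) (v k y - w y).
      rewrite (_ : h x - v k x + (v k x - v k y) + (v k y - w y) = h x - w y)%R; last by ring.
      by rewrite -[((h x - v k x) ^+ 2)%R]sqrrN opprB; lra.
    have inc3 : 3%:E * ((v k x - v k y) ^+ 2)%:E <= (3 * delta)%:E * SU x.
      by rewrite [(3 * delta)%:E]EFinM -muleA; apply: lee_wpmul2l.
    rewrite /c1 /a EFinD -addeA [X in _ + X <= _]addeC addeA.
    by apply: leeD => //; apply: leeD.
  rewrite ge0_integralD//; last 2 first.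
  - by move=> s _; rewrite mule_ge0.
  - exact: measurable_funeM.
  rewrite integral_cst//= lebesgue_measure_itv/= lte_fin d0 sube0.
  rewrite ge0_integralZl//.
  rewrite mul1e muleC /c1; rewrite ge0_muleDr//; last 2 first.
  - by rewrite mule_ge0.
  - by rewrite mule_ge0// lee_fin mulr_ge0// ltW.
  rewrite !muleA -!EFinM -addeA; apply: leeD; first by rewrite [(delta * 3)%R]mulrC.
  apply: leeD; first by rewrite mulrCA -expr2.
  apply: lee_wpmul2l => //; apply: le_lower_integral_subset => //.
apply: (@le_trans _ _ (\int[hausdorff1]_(x in Gr)
   ((3 * delta)%:E * a x + 1%:E * ((3 * delta ^+ 2)%:E * SU x + 3%:E * Su x)))).
  apply: le_lower_integral => // x _; apply: integral_ge0 => s _; by rewrite lee_fin sqr_ge0.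
have d30 : (0 <= 3 * delta)%R by rewrite mulr_ge0// ltW.
have d320 : (0 <= 3 * delta ^+ 2)%R by rewrite mulr_ge0// sqr_ge0.
have mGSU : measurable_fun Gr SU by exact: measurable_funTS.
have mGSu : measurable_fun Gr Su by exact: measurable_funTS.
rewrite (@ge0_integral_lincomb _ _ _ hausdorff1 Gr a (fun x => (3 * delta ^+ 2)%:E * SU x + 3%:E * Su x))//; last 3 first.
- by move=> x _; rewrite lee_fin sqr_ge0.
- by move=> x _; apply: adde_ge0; apply: mule_ge0 => //; rewrite lee_fin.
- by apply: emeasurable_funD; exact: measurable_funeM.
rewrite (@ge0_integral_lincomb _ _ _ hausdorff1 Gr SU Su)// mul1e.
have Ia : \int[hausdorff1]_(x in Gr) a x <= eB%:E.
  apply: le_trans Ak; rewrite /L2_sqnorm; apply: le_lower_integral_subset => //.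
  - by move=> x [].
  - by move=> x _; rewrite lee_fin sqr_ge0.
  - by move=> x _; rewrite lee_fin sqr_ge0.
have ISU : \int[hausdorff1]_(x in Gr) SU x <= (L * (2 * eB + 2 * fine Mg))%:E.
  by apply: le_trans (strip _ mU U0) _; rewrite EFinM; apply: lee_wpmul2l => //; rewrite lee_fin ltW.
have ISu : \int[hausdorff1]_(x in Gr) Su x <= (L * eB)%:E.
  by apply: le_trans (strip _ mu_ u0) _; rewrite EFinM; apply: lee_wpmul2l => //; rewrite lee_fin ltW.
apply: (@le_trans _ _ ((3 * delta)%:E * eB%:E + ((3 * delta ^+ 2)%:E * (L * (2 * eB + 2 * fine Mg))%:E + 3%:E * (L * eB)%:E))).
  by apply: leeD; [|apply: leeD]; apply: lee_wpmul2l; rewrite ?lee_fin.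
rewrite -!EFinM -!EFinD lee_fin.
have -> : (eps = eB * B)%R by rewrite /eB divfK// gt_eqF.
by rewrite /B -subr_ge0 (_ : _ - _ = eB)%R ?ltW//; ring.
Qed.

End trace_ray.
End trace.

(** * Pointwise bounds on traces *)

Section trace_bound.
Context {R : realType}.
Local Open Scope ereal_scope.
Local Notation mu := (@lebesgue_measure R).

(** A bound on w near a boundary point passes to its trace h: where |h| > M,
    the translates of w along rays stay at distance |h| - M from h, which
    the defect estimate forbids. *)
Lemma trace_bound (O : set (R * R)) (x0 : R * R) (r : R) (e : R * R) (f : R -> R)
    (w h : R * R -> R * R) (M : R) :
  let G := topological_boundary O in let Omega := ~` closure O in
  open O -> graph_chart O x0 r e f -> (0 <= M)%R ->
  is_trace Omega G (fst \o w) (fst \o h) -> is_trace Omega G (snd \o w) (snd \o h) ->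
  {ae leb2, forall z, Omega z -> (enorm (z - x0) < r)%R -> (enorm (w z) <= M)%R} ->
  {ae hausdorff1, forall x, G x -> (enorm (x - x0) < r / 2)%R -> (enorm (h x) <= M)%R}.
Proof.
move=> G Omega oO ch M0 t1 t2 [N [mN N0 subN]].
have [r0 e1 _ _] := ch.
have r20 : (0 < r / 2)%R by rewrite divr_gt0.
have mGr : measurable (G `&` [set x | (enorm (x - x0) < r / 2)%R]) by exact: measurable_boundary_ball.
set Gr := G `&` _ in mGr.
have [K1 K10 HK1] := trace_ray oO ch t1.
have [K2 K20 HK2] := trace_ray oO ch t2.
have [Lh1 [_ [_ [[Lw1 _ _ _] _ _ _]]]] := t1.
have [Lh2 [_ [_ [[Lw2 _ _ _] _ _ _]]]] := t2.
pose hx x := (((fst \o h) \_ G) x, ((snd \o h) \_ G) x).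
pose D x := ((Num.max (enorm (hx x) - M) 0) ^+ 2)%R.
have mhx : measurable_fun setT hx.
  by apply: measurable_fun_pair; [exact: (L2_measurable_restrict Lh1)|exact: (L2_measurable_restrict Lh2)].
have mD : measurable_fun setT (EFin \o D).
  apply/measurable_EFinP; apply: measurable_funX; apply: measurable_maxr => //.
  apply: measurable_funB => //.
  exact: (measurableT_comp (continuous_measurable2 continuous_enorm) mhx).
have D0 x : (0 <= D x)%R by exact: sqr_ge0.
(* rays through almost every boundary point avoid the null set N *)
have aeN : {ae hausdorff1, forall x, Gr x -> {ae mu, forall s, ~ N (x - s *: rot90 e)%R}}.
  have chr : graph_chart O x0 (r / 2) e f by apply: graph_chart_shrink ch => //; lra.
  have [L L0 strip] := strip_comparison oO chr.
  have mI : measurable_fun setT (EFin \o (\1_N : R * R -> R)) by apply/measurable_EFinP.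
  have I0 z : 0 <= (EFin \o (\1_N : R * R -> R)) z by rewrite lee_fin.
  have IN : \int[leb2]_z (EFin \o (\1_N : R * R -> R)) z = 0.
    by rewrite integral_indic// setIT; exact: N0.
  have := strip _ mI I0; rewrite IN mule0 => le0.
  pose F (x : R * R) : \bar R := \int[mu]_s (EFin \o (\1_N : R * R -> R)) (x - s *: rot90 e)%R.
  have F0 x : 0 <= F x by exact: integral_ge0.
  have mF : measurable_fun setT F.
    have hh := @measurable_fun_fubini_tonelli_F _ _ _ _ R mu _ (measurable_ray (rot90 e) mI) (fun=> I0 _).
    exact: hh.
  have intF : \int[hausdorff1]_(x in Gr) `|F x| = 0.
    apply/eqP; rewrite eq_le integral_ge0// andbT.
    by under eq_integral do rewrite gee0_abs//.
  have mFG : measurable_fun Gr F by exact: measurable_funTS.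
  have := (ae_eq_integral_abs hausdorff1 mGr mFG).1 intF.
  apply: filterS => x Hx Gx; have {}Hx := Hx Gx.
  have mFx : measurable_fun setT (fun s : R => (EFin \o (\1_N : R * R -> R)) (x - s *: rot90 e)%R).
    exact: (measurableT_comp mI (measurable_ray_pt x (rot90 e))).
  have : \int[mu]_(s in setT) `|(EFin \o (\1_N : R * R -> R)) (x - s *: rot90 e)%R| = 0.
    by under eq_integral do rewrite gee0_abs//.
  move/(ae_eq_integral_abs mu measurableT mFx).1.
  apply: filterS => s /(_ I) /= h1 Ns; move: h1; rewrite indicE mem_set// => -[] /eqP.
  by rewrite oner_eq0.
have bound delta : (0 < delta)%R -> (delta <= r / 2)%R ->
    \int[hausdorff1]_(x in Gr) (D x)%:E <= ((K1 + K2) * delta)%:E.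
  move=> d0 dr.
  pose Q1 := ray_defect O e (fst \o w) (fst \o h) delta.
  pose Q2 := ray_defect O e (snd \o w) (snd \o h) delta.
  have mQ1 : measurable_fun setT Q1 by exact: measurable_ray_defect.
  have mQ2 : measurable_fun setT Q2 by exact: measurable_ray_defect.
  have Q10 x : 0 <= Q1 x by apply: integral_ge0 => s _; rewrite lee_fin sqr_ge0.
  have Q20 x : 0 <= Q2 x by apply: integral_ge0 => s _; rewrite lee_fin sqr_ge0.
  have : \int[hausdorff1]_(x in Gr) (delta%:E * (D x)%:E) <=
         \int[hausdorff1]_(x in Gr) (1%:E * Q1 x + 1%:E * Q2 x).
    apply: ae_le_lower_integral => //.
    - by apply: emeasurable_funD; apply: measurable_funeM; exact: measurable_funTS.
    - by move=> x _; rewrite -EFinM lee_fin mulr_ge0// ltW.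
    - by move=> x _; rewrite !mul1e adde_ge0.
    apply: filterS aeN => x HN Gx; rewrite !mul1e; have {}HN := HN Gx.
    have [GGx /= xr] := Gx.
    rewrite (_ : delta%:E * (D x)%:E = \int[mu]_(s in `]0%R, delta]) (cst (D x)%:E s)); last first.
      by rewrite integral_cst//= lebesgue_measure_itv/= lte_fin d0 sube0 muleC.
    have msr (v : R * R -> R) (c : R) : L2 leb2 Omega v ->
        measurable_fun (`]0%R, delta] : set R) (fun s => ((c - (v \_ Omega) (x - s *: rot90 e)) ^+ 2)%:E).
      move=> Lv; apply: measurable_funTS; apply/measurable_EFinP; apply: measurable_funX.
      apply: measurable_funB => //.
      exact: (measurableT_comp (L2_measurable_restrict Lv) (measurable_ray_pt x (rot90 e))).
    rewrite /Q1 /Q2 /ray_defect -ge0_integralD//; last 4 first.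
    - by move=> s _; rewrite lee_fin sqr_ge0.
    - exact: msr.
    - by move=> s _; rewrite lee_fin sqr_ge0.
    - exact: msr.
    apply: ae_le_lower_integral => //.
    - by apply: emeasurable_funD; exact: msr.
    - by move=> s _; rewrite lee_fin.
    - by move=> s _; apply: adde_ge0; rewrite lee_fin sqr_ge0.
    move: HN; apply: (@filterS _ _ (ae_filter_ringOfSetsType mu)) => s Ns /=; rewrite in_itv/= => /andP[s0 sd].
    have [yr yO] := chart_ray_exterior oO ch GGx xr s0 (le_trans sd dr).
    set y := (x - s *: rot90 e)%R in Ns yr yO *.
    have wM : (enorm (w y) <= M)%R.
      by apply: contrapT => wM; apply: Ns; apply: subN => /(_ yO yr).
    rewrite ![((_ \o w) \_ Omega) y]patchT; [|exact: mem_set|exact: mem_set].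
    rewrite -EFinD lee_fin /= /D.
    have -> : ((((fst \o h) \_ G) x - (w y).1) ^+ 2 + (((snd \o h) \_ G) x - (w y).2) ^+ 2 =
        enorm (hx x - w y) ^+ 2)%R by rewrite enorm_sqr.
    rewrite ler_pXn2r// ?nnegrE ?enorm_ge0// ?le_max ?lexx ?orbT//.
    rewrite ge_max enorm_ge0 andbT lerBlDr.
    rewrite -{1}[hx x](subrK (w y)); apply: le_trans (enormD_le _ _) _.
    by rewrite lerD2l.
  rewrite ge0_integralZl//; last 3 first.
  - exact: measurable_funTS.
  - by move=> x _; rewrite lee_fin.
  - by rewrite lee_fin ltW.
  rewrite ge0_integral_lincomb//; try exact: measurable_funTS.
  rewrite !mul1e => /le_trans H.
  have {}H := H _ (leeD (HK1 _ d0 dr) (HK2 _ d0 dr)).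
  move: H; rewrite -EFinD -lee_pdivlMl// => /le_trans; apply.
  rewrite -EFinM lee_fin -mulrDl le_eqVlt; apply/orP; left; apply/eqP; field.
  by rewrite gt_eqF.
have intD : \int[hausdorff1]_(x in Gr) `|(EFin \o D) x| = 0.
  apply/eqP; rewrite eq_le integral_ge0// andbT.
  under eq_integral do rewrite gee0_abs ?lee_fin//.
  apply/lee_addgt0Pr => eps eps0; rewrite add0e.
  pose delta := Num.min (r / 2)%R (eps / (K1 + K2 + 1))%R.
  have KK : (0 < K1 + K2 + 1)%R by rewrite ltr_wpDl// addr_ge0.
  have d0 : (0 < delta)%R by rewrite lt_min r20 divr_gt0.
  apply: le_trans (bound delta d0 _) _; first by rewrite ge_min lexx.
  rewrite lee_fin; apply: (@le_trans _ _ ((K1 + K2 + 1) * delta)%R).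
    by rewrite ler_wpM2r ?lerDl// ltW.
  by rewrite mulrC -ler_pdivlMr// ge_min lexx orbT.
have mDG : measurable_fun Gr (EFin \o D) by exact: measurable_funTS.
have := (ae_eq_integral_abs hausdorff1 mGr mDG).1 intD.
apply: filterS => x Hx Gx xr; have /= [] := Hx (conj Gx xr).
move/eqP; rewrite sqrf_eq0 => /eqP Dx.
have -> : h x = hx x by rewrite /hx !patchT ?mem_set//=; case: (h x).
by rewrite -subr_le0 -Dx le_max lexx.
Qed.

End trace_bound.

(** * Bump functions *)

Section partial_derivatives.
Context {R : realType}.
Implicit Types (v : R * R -> R) (x : R * R).

Lemma derivable_of_fst v x (l : R) : is_derive x.1 1 (fun t => v (t, x.2)) l ->
  derivable v x ((1, 0) : R * R) /\ 'D_((1, 0) : R * R) v x = l.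
Proof.
case: x => a1 a2 /= [dv vl].
by move: dv vl; rewrite /derivable /derive quotient_fst.
Qed.

Lemma derivable_of_snd v x (l : R) : is_derive x.2 1 (fun t => v (x.1, t)) l ->
  derivable v x ((0, 1) : R * R) /\ 'D_((0, 1) : R * R) v x = l.
Proof.
case: x => a1 a2 /= [dv vl].
by move: dv vl; rewrite /derivable /derive quotient_snd.
Qed.

Lemma C1c_of_partials v (dv : R * R -> R * R) (U K : set (R * R)) :
  (forall x, is_derive x.1 1 (fun t => v (t, x.2)) (dv x).1) ->
  (forall x, is_derive x.2 1 (fun t => v (x.1, t)) (dv x).2) ->
  continuous (fun x => (dv x).1) -> continuous (fun x => (dv x).2) ->
  compact K -> K `<=` U -> (forall x, ~ K x -> v x = 0) ->
  C1c U v /\ grad v = dv.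
Proof.
move=> d1 d2 c1 c2 cK KU vK.
have gv : grad v = dv.
  apply/funext => x; rewrite /grad (derivable_of_fst (d1 x)).2 (derivable_of_snd (d2 x)).2.
  by case: (dv x).
split => //; split.
- by move=> x; split; [exact: (derivable_of_fst (d1 x)).1|exact: (derivable_of_snd (d2 x)).1].
- rewrite gv => x.
  have c12 := cvg_pair (c1 x) (c2 x).
  rewrite (_ : dv = fun x => ((dv x).1, (dv x).2)); last by apply/funext => z; case: (dv z).
  exact: c12.
- by exists K.
Qed.

End partial_derivatives.

Lemma is_derive_mulr (R : realType) (f : R -> R) (t df c : R) : is_derive t 1 f df ->
  is_derive t 1 (fun s => f s * c) (df * c).
Proof.
move=> h; have h0 : is_derive t (1 : R) (cst c : R -> R) 0 by exact: is_derive_cst.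
have := is_deriveM h h0; rewrite /= scaler0 add0r [c *: df]mulrC.
exact.
Qed.

Lemma is_derive_mull (R : realType) (f : R -> R) (t df c : R) : is_derive t 1 f df ->
  is_derive t 1 (fun s => c * f s) (c * df).
Proof.
move=> /(is_derive_mulr c); rewrite mulrC.
by rewrite (_ : (fun s => f s * c) = (fun s => c * f s))//; apply/funext => s; rewrite mulrC.
Qed.

Section bumps.
Context {R : realType}.

Definition sqpos (y : R) : R := Num.max y 0 ^+ 2.

Lemma is_derive_sqpos (y : R) : is_derive y 1 sqpos (2 * Num.max y 0).
Proof.
apply: is_derive_lim => e e0; exists e => // h h0 he.
apply: (@le_trans _ _ (`|h| * `|h|)); last by rewrite ler_wpM2r// ltW.
rewrite -expr2 real_normK ?num_real// /sqpos ler_norml.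
case: (leP (y + h) 0) => h1; case: (leP y 0) => h2; apply/andP; split; nra.
Qed.

Lemma continuous_max0 : continuous (fun y : R => Num.max y 0).
Proof. by move=> y; apply: continuous_max; [exact: cvg_id|exact: cvg_cst]. Qed.

Lemma continuous_is_derive (f df : R -> R) : (forall t : R, is_derive t 1 f (df t)) ->
  continuous f.
Proof.
by move=> dp s; apply: differentiable_continuous; apply/derivable1_diffP; exact: ex_derive.
Qed.

Section bump_def.
Variables (a b : R) (n : nat).

Definition bump_base (t : R) : R := sqpos ((t - a) * (b - t)).

(** As n grows, these functions, which vanish outside of ]a, b[, increase to its
    indicator; the square in sqpos makes them C^1 at the end points. *)
Definition itv_bump (t : R) : R := 1 - (1 + n%:R * bump_base t)^-1.

Definition ditv_bump (t : R) : R :=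
  (1 + n%:R * bump_base t) ^- 2 *
  (n%:R * (2 * Num.max ((t - a) * (b - t)) 0 * (a + b - 2 * t))).

Let base_ge0 t : 0 <= bump_base t. Proof. exact: sqr_ge0. Qed.

Let den_gt0 t : 0 < 1 + n%:R * bump_base t.
Proof. by rewrite ltr_pwDl// mulr_ge0. Qed.

Lemma is_derive_itv_bump (t : R) : is_derive t 1 itv_bump (ditv_bump t).
Proof.
have d1 : is_derive t 1 (fun t => (t - a) * (b - t)) (a + b - 2 * t).
  rewrite (_ : a + b - 2 * t = (t - a) *: (0 - 1) + (b - t) *: (1 - 0)); last first.
    by rewrite /GRing.scale/=; ring.
  exact: is_deriveM.
have d2 : is_derive t 1 bump_base (2 * Num.max ((t - a) * (b - t)) 0 * (a + b - 2 * t)).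
  exact: (is_derive1_comp (is_derive_sqpos _) d1).
have d3 : is_derive t 1 (fun t => 1 + n%:R * bump_base t)
    (0 + n%:R *: (2 * Num.max ((t - a) * (b - t)) 0 * (a + b - 2 * t))).
  by apply: is_deriveD; apply: is_deriveZ.
have d0 := lt0r_neq0 (den_gt0 t).
have d4 := @is_deriveV _ (fun t => 1 + n%:R * bump_base t) t _ 1 d0 d3.
rewrite (_ : ditv_bump t = 0 - (- (1 + n%:R * bump_base t) ^- 2 *:
  (0 + n%:R *: (2 * Num.max ((t - a) * (b - t)) 0 * (a + b - 2 * t))))).
  exact: is_deriveB.
by rewrite /ditv_bump sub0r add0r scaleNr opprK.
Qed.

Lemma continuous_ditv_bump : continuous ditv_bump.
Proof.
have c1 : continuous (fun t : R => (t - a) * (b - t)).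
  by move=> t; apply: cvgM; apply: cvgB; try exact: cvg_cst; exact: cvg_id.
have c2 : continuous (fun t => 1 + n%:R * bump_base t).
  move=> t; apply: cvgD; first exact: cvg_cst.
  apply: cvgM; first exact: cvg_cst.
  apply: (continuous_comp (f := fun t : R => (t - a) * (b - t)) (g := sqpos)); first exact: c1.
  exact: (continuous_is_derive is_derive_sqpos).
move=> t; apply: cvgM.
  apply: cvgV; first by rewrite expf_neq0// lt0r_neq0.
  apply: (continuous_comp (f := fun t => 1 + n%:R * bump_base t) (g := fun z : R => z ^+ 2)); first exact: c2.
  exact: exprn_continuous.
apply: cvgM; first exact: cvg_cst.
apply: cvgM.
  apply: cvgM; first exact: cvg_cst.
  by apply: (continuous_comp (f := fun t : R => (t - a) * (b - t)) (g := fun y => Num.max y 0));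
    [exact: c1|exact: continuous_max0].
by apply: cvgB; [exact: cvg_cst|apply: cvgM; [exact: cvg_cst|exact: cvg_id]].
Qed.

Lemma itv_bump_out (t : R) : a <= b -> ~ (a < t < b) -> itv_bump t = 0.
Proof.
move=> ab tab; suff b0 : bump_base t = 0 by rewrite /itv_bump b0 mulr0 addr0 invr1 subrr.
rewrite /bump_base /sqpos.
have h : (t - a) * (b - t) <= 0.
  have [at_|ta] := ltP a t; last by nra.
  have [tb|bt] := ltP t b; last by nra.
  by exfalso; apply: tab; rewrite at_.
by move/max_idPr: h => ->; rewrite expr0n.
Qed.

Lemma itv_bump_ge0_le1 (t : R) : 0 <= itv_bump t <= 1.
Proof.
rewrite /itv_bump; apply/andP; split; last by rewrite gerBl invr_ge0 ltW.
by rewrite subr_ge0 invf_le1// lerDl mulr_ge0.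
Qed.

End bump_def.

Lemma itv_bump_cvg (a b t : R) : a < t < b -> itv_bump a b n t @[n --> \oo] --> (1 : R).
Proof.
move=> /andP[at_ tb].
have b0 : 0 < bump_base a b t.
  by rewrite /bump_base /sqpos exprn_gt0// lt_max mulr_gt0 ?subr_gt0.
rewrite -[X in _ --> X](subr0 1); apply: cvgB; first exact: cvg_cst.
apply/cvgrPdist_le => e e0; near=> n.
rewrite sub0r normrN ger0_norm ?invr_ge0; last by rewrite addr_ge0// mulr_ge0// ltW.
rewrite invf_ple ?posrE//; last by rewrite ltr_pwDl// mulr_ge0// ltW.
apply: (@le_trans _ _ (n%:R * bump_base a b t)); last by rewrite lerDr.
rewrite -ler_pdivrMr//; near: n; exact: nbhs_infty_ger.
Unshelve. all: by end_near. Qed.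

End bumps.

(** * The fundamental lemma of the calculus of variations *)

Section fundamental_lemma.
Context {R : realType}.
Local Open Scope ereal_scope.
Implicit Types (U Omega : set (R * R)) (w : R * R -> R).

Definition obox (a b c d : R) : set (R * R) := (`]a, b[ `*` `]c, d[)%classic.
Definition cbox (a b c d : R) : set (R * R) := (`[a, b] `*` `[c, d])%classic.

Lemma measurable_obox a b c d : measurable (obox a b c d).
Proof. exact: measurableX. Qed.

Lemma measurable_cbox a b c d : measurable (cbox a b c d).
Proof. exact: measurableX. Qed.

Lemma obox_sub_cbox a b c d : obox a b c d `<=` cbox a b c d.
Proof.
by move=> [s t] [/= h1 h2]; split => /=; [move: h1|move: h2];
  rewrite !in_itv/= => /andP[/ltW-> /ltW->].
Qed.

Lemma obox_setI a b c d a' b' c' d' : obox a b c d `&` obox a' b' c' d' =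
  obox (Num.max a a') (Num.min b b') (Num.max c c') (Num.min d d').
Proof.
apply/seteqP; split=> -[s t]; rewrite /obox /= !in_itv/= !gt_max !lt_min.
  by move=> [[/andP[-> ->] /andP[-> ->]] [/andP[-> ->] /andP[-> ->]]].
by move=> [/andP[/andP[-> ->] /andP[-> ->]] /andP[/andP[-> ->] /andP[-> ->]]].
Qed.

Lemma cbox_sub a b c d a' b' c' d' :
  cbox (Num.max a' a) (Num.min b' b) (Num.max c' c) (Num.min d' d) `<=` cbox a b c d.
Proof.
move=> [s t]; rewrite /cbox /= !in_itv/= !ge_max !le_min.
by move=> [/andP[/andP[_ ->] /andP[_ ->]] /andP[/andP[_ ->] /andP[_ ->]]].
Qed.

Lemma bump_box_C1c (a b c d : R) (n : nat) U : (a <= b)%R -> (c <= d)%R -> cbox a b c d `<=` U ->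
  C1c U (fun x => itv_bump a b n x.1 * itv_bump c d n x.2)%R.
Proof.
move=> ab cd bU.
have cb (s t : R) : continuous (itv_bump s t n).
  exact: (continuous_is_derive (is_derive_itv_bump s t n)).
have cd1 (s t : R) := @continuous_ditv_bump R s t n.
have fst_c (g : R -> R) : continuous g -> continuous (fun x : R * R => g x.1).
  by move=> cg x; apply: (continuous_comp (f := fst) (g := g)); [exact: continuous2_fst|exact: cg].
have snd_c (g : R -> R) : continuous g -> continuous (fun x : R * R => g x.2).
  by move=> cg x; apply: (continuous_comp (f := snd) (g := g)); [exact: continuous2_snd|exact: cg].
apply: (proj1 (@C1c_of_partials R (fun x => itv_bump a b n x.1 * itv_bump c d n x.2)%R
  (fun x => (ditv_bump a b n x.1 * itv_bump c d n x.2, itv_bump a b n x.1 * ditv_bump c d n x.2))%R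
  U (cbox a b c d) _ _ _ _ _ bU _)).
- by move=> [s t] /=; apply: is_derive_mulr; exact: is_derive_itv_bump.
- by move=> [s t] /=; apply: is_derive_mull; exact: is_derive_itv_bump.
- by move=> x /=; apply: cvgM; [exact: fst_c|exact: snd_c].
- by move=> x /=; apply: cvgM; [exact: fst_c|exact: snd_c].
- by apply: compact_setX; exact: segment_compact.
- move=> [s t] /= nst.
  have [sab|nsab] := pselect (a < s < b)%R; last by rewrite itv_bump_out// mul0r.
  have [tcd|ntcd] := pselect (c < t < d)%R; last by rewrite [X in (_ * X)%R]itv_bump_out// mulr0.
  exfalso; apply: nst; apply: obox_sub_cbox; split => /=; by rewrite in_itv.
Qed.

Lemma measurable_obox_generated : @measurable _ (R * R)%type =
  <<s [set A | exists a b c d, A = obox a b c d] >>.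
Proof.
set G := [set A | _].
rewrite eqEsubset; split; last first.
  apply: smallest_sub; first exact: sigma_algebra_measurable.
  by move=> _ [a [b [c [d ->]]]]; exact: measurable_obox.
pose gT := g_sigma_algebraType G.
have m1 : measurable_fun (setT : set gT) (fst : gT -> R).
  apply: (measurability _ (RGenOpens.measurableE R)) => _ [_ [a [b ->]] <-].
  rewrite setTI (_ : _ @^-1` _ = \bigcup_n obox a b (- n%:R) n%:R).
    by apply: bigcup_measurable => n _; apply: sub_sigma_algebra; exists a, b, (- n%:R)%R, n%:R.
  apply/seteqP; split=> [[s t] /= sab|[s t] [n _ []]//].
  exists (Num.truncn `|t|).+1 => //; split => //=.
  by rewrite in_itv/= -ltr_norml truncnS_gt.
have m2 : measurable_fun (setT : set gT) (snd : gT -> R).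
  apply: (measurability _ (RGenOpens.measurableE R)) => _ [_ [a [b ->]] <-].
  rewrite setTI (_ : _ @^-1` _ = \bigcup_n obox (- n%:R) n%:R a b).
    by apply: bigcup_measurable => n _; apply: sub_sigma_algebra; exists (- n%:R)%R, n%:R, a, b.
  apply/seteqP; split=> [[s t] /= sab|[s t] [n _ []]//].
  exists (Num.truncn `|s|).+1 => //; split => //=.
  by rewrite in_itv/= -ltr_norml truncnS_gt.
have mid : measurable_fun (setT : set gT) (id : gT -> R * R).
  by apply/measurable_fun_pairP; split.
by move=> A mA; have := mid measurableT A mA; rewrite setTI preimage_id.
Qed.

(** The sets S on which the integral vanishes form a Dynkin system, because the
    integral over all of B vanishes; this system contains the boxes. *)
Lemma integral_box_zero (B : set (R * R)) (f : R * R -> \bar R) :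
  measurable B -> leb2.-integrable B f ->
  \int[leb2]_(x in B) f x = 0 ->
  (forall a b c d, \int[leb2]_(x in obox a b c d `&` B) f x = 0) ->
  forall S, measurable S -> \int[leb2]_(x in S `&` B) f x = 0.
Proof.
move=> mB iB B0 H.
have hh := @dynkin_induction _ _ _ (fun S => \int[leb2]_(x in S `&` B) f x = 0)
  measurable_obox_generated.
move=> S mS; have {}mS : <<s [set A | exists a b c d, A = obox a b c d] >> S.
  by rewrite -measurable_obox_generated.
move: S mS; apply: hh.
- move=> _ _ [a [b [c [d ->]]]] [a' [b' [c' [d' ->]]]].
  by rewrite obox_setI; do 4 eexists.
- by rewrite setTI.
- by move=> _ [a [b [c [d ->]]]]; exact: H.
- move=> S mS S0.
  have := @integral_setU _ _ _ leb2 (S `&` B) (~` S `&` B) f.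
  rewrite -setIUl setUCr setTI B0 S0 add0e => <- //.
  + exact: measurableI.
  + by apply: measurableI => //; exact: measurableC.
  + exact: measurable_int iB.
  + by apply/disj_setPS => x [[Sx _] [nSx _]].
- move=> F mF tF F0; rewrite setI_bigcupl integral_bigcup.
  + by rewrite eseries0.
  + apply/trivIsetP => i j _ _ ij; rewrite setIACA.
    by move/trivIsetP : tF => /(_ i j Logic.I Logic.I ij) ->; rewrite set0I.
  + by move=> k; exact: (measurableI _ _ (mF k) mB).
  + rewrite -setI_bigcupl; apply: integrableS iB.
    * exact: mB.
    * exact: (measurableI _ _ (bigcup_measurable (fun k _ => mF k)) mB).
    * exact: subIsetr.
Qed.

(** The products of interval bumps converge to the indicator of the box,
    dominated by 1. *)
Lemma integral_obox_zero Omega w a b c d :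
  (forall eta, C1c Omega eta -> (\int[leb2]_(x in Omega) (w x * eta x) = 0)%R) ->
  leb2.-integrable (cbox a b c d) (EFin \o w) ->
  cbox a b c d `<=` Omega ->
  \int[leb2]_(x in obox a b c d) (w x)%:E = 0.
Proof.
move=> wt iw bO.
have [ab|ba] := ltP a b; last first.
  rewrite (_ : obox a b c d = set0) ?integral_set0//.
  by apply/seteqP; split=> [[s t] [/=]|//]; rewrite in_itv/= => /andP[/lt_trans h /h]; rewrite ltNge ba.
have [cd|dc] := ltP c d; last first.
  rewrite (_ : obox a b c d = set0) ?integral_set0//.
  by apply/seteqP; split=> [[s t] [/= _]|//]; rewrite in_itv/= => /andP[/lt_trans h /h]; rewrite ltNge dc.
pose eta n (x : R * R) := (itv_bump a b n x.1 * itv_bump c d n x.2)%R.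
have mo : measurable (obox a b c d) := measurable_obox a b c d.
have iwo : leb2.-integrable (obox a b c d) (EFin \o w).
  by apply: integrableS iw; [exact: measurable_cbox|exact: mo|exact: obox_sub_cbox].
have mw : measurable_fun (obox a b c d) (EFin \o w) := measurable_int _ iwo.
have mwr : measurable_fun (obox a b c d) w by apply/measurable_EFinP.
have meta n : measurable_fun setT (eta n).
  have := bump_box_C1c n (ltW ab) (ltW cd) (@subset_refl _ (cbox a b c d)).
  by move/C1c_C1/C1_continuous/continuous_measurable2.
have eta01 n x : (`|eta n x| <= 1)%R.
  have /andP[b0 b1] := itv_bump_ge0_le1 a b n x.1.
  have /andP[d0 d1] := itv_bump_ge0_le1 c d n x.2.
  by rewrite /eta ger0_norm ?mulr_ge0// mulr_ile1.
pose f_ n x := (w x * eta n x)%:E.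
have mf_ n : measurable_fun (obox a b c d) (f_ n).
  by apply/measurable_EFinP; apply: measurable_funM => //; exact: measurable_funTS.
have f_w n x : `|f_ n x| <= `|(w x)%:E|.
  by rewrite /f_ !abse_EFin lee_fin normrM ler_piMr.
have if_ n : leb2.-integrable (obox a b c d) (f_ n).
  by apply: le_integrable iwo => //; exact: mf_.
have f0 n : \int[leb2]_(x in obox a b c d) f_ n x = 0.
  have := wt _ (bump_box_C1c n (ltW ab) (ltW cd) bO).
  rewrite /Rintegral (_ : \int[leb2]_(x in Omega) _ = \int[leb2]_(x in obox a b c d) f_ n x).
    move=> h; rewrite -[LHS]fineK ?h//.
    exact: (integrable_fin_num _ (if_ n)).
  rewrite [LHS]integral_mkcond [RHS]integral_mkcond; apply: eq_integral => x _.
  rewrite /patch; case: ifPn => xO; case: ifPn => xb //.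
    have : ~ obox a b c d x by move=> h; move/negP: xb; apply; exact: mem_set.
    case: x {xO xb} => s t h; rewrite /=.
    have [sab|nsab] := pselect (a < s < b)%R; last by rewrite itv_bump_out ?mul0r ?mulr0// ltW.
    have [tcd|ntcd] := pselect (c < t < d)%R; last by rewrite [X in (_ * (_ * X))%R]itv_bump_out ?mulr0// ltW.
    by exfalso; apply: h; split; rewrite /= in_itv.
  by move/negP: xO; case; apply/mem_set/bO/obox_sub_cbox/set_mem.
have [] := @dominated_convergence _ _ _ leb2 (obox a b c d) mo f_ (EFin \o w) (abse \o (EFin \o w)).
- exact: mf_.
- exact: mw.
- apply: aeW => -[s t] [/=]; rewrite !in_itv/= => sab tcd.
  apply: cvg_EFin; first by apply: nearW.
  rewrite -[X in _ --> X]mulr1; apply: cvgM; first exact: cvg_cst.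
  by rewrite -[X in _ --> X]mulr1; apply: cvgM; exact: itv_bump_cvg.
- exact: integrable_abse.
- by apply: aeW => x n _; exact: f_w.
move=> _ _; rewrite (_ : [sequence _]_n = cst 0); last by apply/funext => n; exact: f0.
by move=> h; rewrite -(cvg_lim _ h)// lim_cst.
Qed.

(** Testing with bumps shows that w has integral zero on all boxes, hence on all
    Borel subsets of a box, hence that w vanishes almost everywhere on it. *)
Lemma fundamental_lemma Omega w : open Omega ->
  (forall a b c d, cbox a b c d `<=` Omega -> leb2.-integrable (cbox a b c d) (EFin \o w)) ->
  (forall eta, C1c Omega eta -> (\int[leb2]_(x in Omega) (w x * eta x) = 0)%R) ->
  {ae leb2, forall x, Omega x -> w x = 0%R}.
Proof.
move=> oO iw wt; apply: (@ae_local _ _ _ leb2 (fun z => z) Omega (fun z => w z = 0%R)) => x Ox.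
have [q [qx qO]] := nbhs_rat_box (open_nbhs_nbhs (conj oO Ox)).
set a : R := ratr q.1.1 in qx qO; set b : R := ratr q.1.2 in qx qO.
set c : R := ratr q.2.1 in qx qO; set d : R := ratr q.2.2 in qx qO.
pose B := obox a b c d.
have cO : cbox a b c d `<=` Omega by exact: qO.
have mB : measurable B := measurable_obox a b c d.
exists B.
  have : open B.
    rewrite (_ : B = fst @^-1` `]a, b[ `&` snd @^-1` `]c, d[)//.
    by apply: openI; apply: open_comp => [z _|]; [exact: continuous2_fst|exact: interval_open|exact: continuous2_snd|exact: interval_open].
  by move=> oB; apply: open_nbhs_nbhs; split.
have iB : leb2.-integrable B (EFin \o w).
  by apply: integrableS (iw _ _ _ _ cO); [exact: measurable_cbox|exact: mB|exact: obox_sub_cbox].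
have Z := @integral_box_zero B (EFin \o w) mB iB (integral_obox_zero wt (iw _ _ _ _ cO) cO).
have : ae_eq leb2 B (EFin \o w) (cst 0).
  apply: integral_ae_eq => //.
  move=> E EB mE; rewrite integral0 -(setIidl EB); apply: Z => //.
  move=> a' b' c' d'; rewrite obox_setI; apply: (integral_obox_zero wt).
    by apply: integrableS (iw _ _ _ _ cO); [exact: measurable_cbox|exact: measurable_cbox|exact: cbox_sub].
  by apply: subset_trans cO; exact: cbox_sub.
apply: filterS => y Hy Oy By; have := Hy By; by case.
Qed.

End fundamental_lemma.

(** * Fubini for convolutions and kernels *)

Section Rfubini.
Context d1 d2 (T1 : measurableType d1) (T2 : measurableType d2) (R : realType).
Variables (m1 : {sigma_finite_measure set T1 -> \bar R}) (m2 : {sigma_finite_measure set T2 -> \bar R}).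
Variable F : T1 * T2 -> R.
Hypothesis iF : (m1 \x m2)%E.-integrable setT (EFin \o F).
Hypothesis iF1 : forall x, m2.-integrable setT (fun y => (F (x, y))%:E).
Hypothesis iF2 : forall y, m1.-integrable setT (fun x => (F (x, y))%:E).

Let E1 : (fun x => (\int[m2]_y F (x, y))%:E) = fubini_F m2 (EFin \o F).
Proof. by apply/funext => x; rewrite /Rintegral fineK// integrable_fin_num. Qed.

Let E2 : (fun y => (\int[m1]_x F (x, y))%:E) = fubini_G m1 (EFin \o F).
Proof. by apply/funext => y; rewrite /Rintegral fineK// integrable_fin_num. Qed.

Lemma Rfubini_integrable1 : m1.-integrable setT (fun x => (\int[m2]_y F (x, y))%:E).
Proof. by rewrite E1; exact: integrable_fubini_F. Qed.

Lemma Rfubini : \int[m1]_x \int[m2]_y F (x, y) = \int[m2]_y \int[m1]_x F (x, y).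
Proof. by rewrite [LHS]/Rintegral E1 [RHS]/Rintegral E2 (integral12_prod_meas1 iF) (integral21_prod_meas1 iF). Qed.

End Rfubini.

(** A name for the area, to which a structure of sigma-finite measure can be
    attached; Fubini on products of planes relies on it. *)
Definition area {R : realType} :
  set (measurableTypeR R * measurableTypeR R)%type -> \bar R := leb2.

Section area.
Context {R : realType}.

HB.instance Definition _ := Measure.on (@area R).

Let area_sigma_finite : sigma_finite setT (@area R).
Proof.
exists (fun n => (`[- n%:R, n%:R] `*` `[- n%:R, n%:R])%classic : set (measurableTypeR R * measurableTypeR R)%type).
  apply/seteqP; split=> [[s t] _|//].
  pose n := maxn (Num.truncn `|s|).+1 (Num.truncn `|t|).+1.
  exists n => //; split => /=; rewrite in_itv/= -ler_norml.
    by apply: (le_trans (ltW (truncnS_gt _))); rewrite ler_nat leq_maxl.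
  by apply: (le_trans (ltW (truncnS_gt _))); rewrite ler_nat leq_maxr.
move=> n; split; first exact: measurableX.
have H : lebesgue_measure (`[- n%:R, n%:R]%classic : set R) \is a fin_num.
  by rewrite lebesgue_measure_itv/=; case: ifP.
have /fin_numPlt/andP[_] := fin_numM H H; apply: le_lt_trans.
by rewrite -product_measure1E.
Qed.

HB.instance Definition _ := Measure_isSigmaFinite.Build _ _ _ (@area R) area_sigma_finite.

End area.

Section convolution.
Context {R : realType}.
Local Notation mu := (@lebesgue_measure R).
Implicit Types (f G zeta : R * R -> R).

Lemma measurable_addpair : measurable_fun setT (fun z : (R * R) * (R * R) => z.1 + z.2).
Proof.
by apply: measurable_fun_pair => /=; apply: measurable_funD;
  [exact: (measurableT_comp measurable_fst)|exact: (measurableT_comp measurable_fst)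
  |exact: (measurableT_comp measurable_snd)|exact: (measurableT_comp measurable_snd)].
Qed.

Lemma measurable_addr (c : R * R) : measurable_fun setT (fun z : R * R => z + c).
Proof. by apply: measurable_fun_pair => /=; exact: measurable_funD. Qed.

Lemma measurable_addl (c : R * R) : measurable_fun setT (fun z : R * R => c + z).
Proof. by apply: measurable_fun_pair => /=; exact: measurable_funD. Qed.

Lemma integrable_of_bound (f : R * R -> R) (g : R * R -> \bar R) : measurable_fun setT f ->
  (forall x, (`|f x|%:E <= g x)%E) -> (\int[leb2]_x g x < +oo)%E ->
  leb2.-integrable setT (EFin \o f).
Proof.
move=> mf fg gl; apply/integrableP; split; first exact/measurable_EFinP.
apply: le_lt_trans gl; apply: le_lower_integral => x _ //=.
Qed.

Lemma normM_le_sqr (a b : R) : `|a * b| <= a ^+ 2 + b ^+ 2.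
Proof.
rewrite normrM -[a ^+ 2]real_normK ?num_real// -[b ^+ 2]real_normK ?num_real//.
have := normr_ge0 a; have := normr_ge0 b; nra.
Qed.

Section conv.
Variables (G f zeta : R * R -> R) (M : R).
Hypotheses (mG : measurable_fun setT G) (mf : measurable_fun setT f).
Hypothesis (mz : measurable_fun setT zeta).
Hypotheses (G0 : forall z, 0 <= G z) (GM : forall z, G z <= M).
Hypothesis iG : (\int[leb2]_z (G z)%:E < +oo)%E.
Hypothesis f2 : (\int[leb2]_z (f z ^+ 2)%:E < +oo)%E.
Hypothesis z2 : (\int[leb2]_z (zeta z ^+ 2)%:E < +oo)%E.

Let mf2 : measurable_fun setT (fun z => (f z ^+ 2)%:E).
Proof. by apply/measurable_EFinP; exact: measurable_funX. Qed.

Let f2_translate x : (\int[leb2]_z (f (x + z) ^+ 2)%:E = \int[leb2]_z (f z ^+ 2)%:E)%E.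
Proof.
rewrite -[RHS](@leb2_translate _ _ x)//; last by move=> z; rewrite lee_fin sqr_ge0.
by apply: eq_integral => z _; rewrite addrC.
Qed.

(** Both factors being square integrable, the convolution converges at every
    point, not only almost everywhere. *)
Lemma conv_integrable x : leb2.-integrable setT (fun z => (G z * f (x + z))%:E).
Proof.
apply: (@integrable_of_bound (fun z => G z * f (x + z)) (fun z => M%:E * (G z)%:E + 1%:E * (f (x + z) ^+ 2)%:E)%E).
- by apply: measurable_funM => //; exact: (measurableT_comp mf (measurable_addl x)).
- move=> z; apply: (@le_trans _ _ ((G z ^+ 2 + f (x + z) ^+ 2)%:E)); first by rewrite lee_fin normM_le_sqr.
  by rewrite mul1e EFinD leeD2r// -EFinM lee_fin expr2 ler_wpM2r.
- have M0 : 0 <= M by apply: le_trans (GM 0); exact: G0.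
  rewrite (@ge0_integral_lincomb _ _ _ leb2 setT (EFin \o G) (fun z => (f (x + z) ^+ 2)%:E))//.
  + rewrite mul1e f2_translate lte_add_pinfty// lte_mul_pinfty//.
  + by move=> z _; rewrite lee_fin.
  + by move=> z _; rewrite lee_fin sqr_ge0.
  + exact/measurable_EFinP.
  + exact: (measurableT_comp mf2 (measurable_addl x)).
Qed.

Let F (w : (R * R) * (R * R)) := G w.2 * f (w.1 + w.2) * zeta w.1.

Let mF : measurable_fun setT F.
Proof.
apply: measurable_funM; last exact: (measurableT_comp mz measurable_fst).
apply: measurable_funM; first exact: (measurableT_comp mG measurable_snd).
exact: (measurableT_comp mf measurable_addpair).
Qed.

Lemma translate_mul_integrable z : leb2.-integrable setT (fun x => (f (x + z) * zeta x)%:E).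
Proof.
apply: (@integrable_of_bound (fun x => f (x + z) * zeta x) (fun x => 1%:E * (f (x + z) ^+ 2)%:E + 1%:E * (zeta x ^+ 2)%:E)%E).
- by apply: measurable_funM => //; exact: (measurableT_comp mf (measurable_addr z)).
- by move=> x; rewrite !mul1e -EFinD lee_fin normM_le_sqr.
- rewrite (@ge0_integral_lincomb _ _ _ leb2 setT (fun x => (f (x + z) ^+ 2)%:E) (fun z => (zeta z ^+ 2)%:E))//.
  + rewrite !mul1e (leb2_translate z mf2) => [|?]; last by rewrite lee_fin sqr_ge0.
    by apply: lte_add_pinfty; [exact: f2|exact: z2].
  + by move=> x _; rewrite lee_fin sqr_ge0.
  + by move=> x _; rewrite lee_fin sqr_ge0.
  + exact: (measurableT_comp mf2 (measurable_addr z)).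
  + by apply/measurable_EFinP; exact: measurable_funX.
Qed.

Let iF : (@area R \x @area R)%E.-integrable setT (EFin \o F).
Proof.
apply: (proj2 (@integrable21ltyP _ _ _ _ _ (@area R) (@area R) _ _)); first by apply/measurable_EFinP; exact: mF.
pose I := (\int[leb2]_z (f z ^+ 2)%:E + \int[leb2]_z (zeta z ^+ 2)%:E)%E.
have I0 : (0 <= I)%E by apply: adde_ge0; apply: integral_ge0 => z _; rewrite lee_fin sqr_ge0.
have bound (z : R * R) : (\int[leb2]_x `|(F (x, z))%:E| <= (G z)%:E * I)%E.
  pose ff (x : R * R) := (1%:E * (f (x + z) ^+ 2)%:E + 1%:E * (zeta x ^+ 2)%:E)%E.
  apply: (@le_trans _ _ (\int[leb2]_x ((G z)%:E * ff x))%E).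
    apply: le_lower_integral => x _ //=; rewrite /ff !mul1e -EFinD -EFinM lee_fin /F/=.
    by rewrite -mulrA normrM (ger0_norm (G0 z)) ler_wpM2l// normM_le_sqr.
  have mff : measurable_fun setT ff.
    apply: emeasurable_funD; apply: measurable_funeM.
      exact: (measurableT_comp mf2 (measurable_addr z)).
    by apply/measurable_EFinP; exact: measurable_funX.
  rewrite ge0_integralZl//; [|by move=> x _; rewrite /ff !mul1e -EFinD lee_fin addr_ge0// sqr_ge0|by rewrite lee_fin].
  apply: lee_wpmul2l; first by rewrite lee_fin.
  rewrite (@ge0_integral_lincomb _ _ _ leb2 setT (fun x => (f (x + z) ^+ 2)%:E) (fun z => (zeta z ^+ 2)%:E))//.
  + by rewrite !mul1e (leb2_translate z mf2)// => ?; rewrite lee_fin sqr_ge0.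
  + by move=> x _; rewrite lee_fin sqr_ge0.
  + by move=> x _; rewrite lee_fin sqr_ge0.
  + exact: (measurableT_comp mf2 (measurable_addr z)).
  + by apply/measurable_EFinP; exact: measurable_funX.
apply: (@le_lt_trans _ _ (\int[leb2]_z ((G z)%:E * I))%E).
  by apply: le_lower_integral => z _; [exact: integral_ge0|exact: bound].
rewrite ge0_integralZr//; last by move=> z _; rewrite lee_fin.
  rewrite lte_mul_pinfty//.
  - by apply: integral_ge0 => z _; rewrite lee_fin.
  - by rewrite ge0_fin_numE//; apply: integral_ge0 => z _; rewrite lee_fin.
  - by rewrite lte_add_pinfty.
exact/measurable_EFinP.
Qed.

Let iF1 x : leb2.-integrable setT (fun z => (F (x, z))%:E).
Proof.
rewrite (_ : (fun z => _) = (fun z => (zeta x)%:E * (G z * f (x + z))%:E)%E).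
  by apply: integrableZl => //; exact: conv_integrable.
by apply/funext => z; rewrite -EFinM /F/= mulrC.
Qed.

Let iF2 z : leb2.-integrable setT (fun x => (F (x, z))%:E).
Proof.
rewrite (_ : (fun x => _) = (fun x => (G z)%:E * (f (x + z) * zeta x)%:E)%E).
  by apply: integrableZl => //; exact: translate_mul_integrable.
by apply/funext => x; rewrite -EFinM /F/= mulrA.
Qed.

Let convE x : \int[leb2]_z F (x, z) = (\int[leb2]_z (G z * f (x + z))) * zeta x.
Proof. by rewrite -RintegralZr//; exact: conv_integrable. Qed.

Lemma conv_mul_integrable :
  leb2.-integrable setT (fun x => ((\int[leb2]_z (G z * f (x + z))) * zeta x)%:E).
Proof.
have := Rfubini_integrable1 iF iF1.
by under eq_fun do rewrite convE.
Qed.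

(** The point of this exchange is that the inner integral on the right is a
    pairing of f with a translate of zeta, in which f may be integrated by parts
    when zeta is a derivative. *)
Lemma conv_fubini :
  \int[leb2]_x ((\int[leb2]_z (G z * f (x + z))) * zeta x) =
  \int[leb2]_z (G z * \int[leb2]_x (f (x + z) * zeta x)).
Proof.
under eq_Rintegral do rewrite -convE.
rewrite (Rfubini iF iF1 iF2); apply: eq_Rintegral => z _.
rewrite -RintegralZl//; last exact: translate_mul_integrable.
by apply: eq_Rintegral => x _; rewrite /F/= mulrA.
Qed.

End conv.

Section kernel.
Variables (k : (R * R) * R -> R) (phi : R -> R) (zeta : R * R -> R) (C : R).
Hypotheses (mk : measurable_fun setT k).
Hypothesis iphi : mu.-integrable setT (EFin \o phi).
Hypothesis izeta : leb2.-integrable setT (EFin \o zeta).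
Hypothesis kC : forall x s, zeta x != 0 -> phi s != 0 -> `|k (x, s)| <= C.

Let mphi : measurable_fun setT phi.
Proof. by apply/measurable_EFinP; exact: measurable_int iphi. Qed.

Let mzeta : measurable_fun setT zeta.
Proof. by apply/measurable_EFinP; exact: measurable_int izeta. Qed.

Let F (w : (R * R) * R) := k w * phi w.2 * zeta w.1.

Let mF : measurable_fun setT F.
Proof.
apply: measurable_funM; last exact: (measurableT_comp mzeta measurable_fst).
apply: measurable_funM => //; exact: (measurableT_comp mphi measurable_snd).
Qed.

Let C' := `|C|.

Let F_le x s : `|F (x, s)| <= C' * `|phi s| * `|zeta x|.
Proof.
rewrite /F/= !normrM.
have [->|z0] := eqVneq (zeta x) 0; first by rewrite normr0 !mulr0.
have [->|p0] := eqVneq (phi s) 0; first by rewrite normr0 !mulr0 !mul0r.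
by rewrite !ler_wpM2r//; apply: le_trans (kC z0 p0) _; exact: ler_norm.
Qed.

Lemma kernel_integrable x : zeta x != 0 ->
  mu.-integrable setT (fun s => (k (x, s) * phi s)%:E).
Proof.
move=> z0; have ip : mu.-integrable setT (fun s => C'%:E * (EFin \o phi) s)%E by exact: integrableZl.
apply: le_integrable ip => //.
  apply/measurable_EFinP; apply: measurable_funM => //.
  by apply: (measurableT_comp mk); exact: measurable_fun_pair.
move=> s _ /=; rewrite lee_fin !normrM.
have [->|p0] := eqVneq (phi s) 0; first by rewrite normr0 !mulr0.
rewrite ler_wpM2r//; apply: le_trans (kC z0 p0) _.
by rewrite /C' normr_id ler_norm.
Qed.

Let iF1 x : mu.-integrable setT (fun s => (F (x, s))%:E).
Proof.
have [z0|z0] := eqVneq (zeta x) 0.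
  rewrite (_ : (fun s => _) = cst 0%E); first exact: integrable0.
  by apply/funext => s; rewrite /F/= z0 mulr0.
rewrite (_ : (fun z => _) = (fun s => (zeta x)%:E * (k (x, s) * phi s)%:E)%E).
  by apply: integrableZl => //; exact: kernel_integrable.
by apply/funext => s; rewrite -EFinM /F/= mulrC.
Qed.

Let iF2 s : leb2.-integrable setT (fun x => (F (x, s))%:E).
Proof.
have iz : leb2.-integrable setT (fun x => (C' * `|phi s|)%:E * (EFin \o zeta) x)%E by exact: integrableZl.
apply: le_integrable iz => //.
  apply/measurable_EFinP; apply: (measurableT_comp mF).
  exact: measurable_fun_pair.
move=> x _ /=; rewrite lee_fin; apply: le_trans (F_le x s) _.
by rewrite normrM ler_wpM2r// ler_norm.
Qed.

Let iF : (@area R \x mu)%E.-integrable setT (EFin \o F).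
Proof.
apply: (proj2 (@integrable12ltyP _ _ _ _ _ (@area R) mu _ _)); first by apply/measurable_EFinP; exact: mF.
pose I := (\int[mu]_s `|(EFin \o phi) s|)%E.
have I0 : (0 <= I)%E by exact: integral_ge0.
have Ifin : (I < +oo)%E by case/integrableP : iphi.
apply: (@le_lt_trans _ _ (\int[leb2]_x ((C'%:E * I) * `|(EFin \o zeta) x|))%E).
  apply: le_lower_integral => x _; first exact: integral_ge0.
  apply: (@le_trans _ _ (\int[mu]_s ((C'%:E * `|(EFin \o zeta) x|) * `|(EFin \o phi) s|))%E).
    apply: le_lower_integral => s _ //=; rewrite lee_fin.
    by apply: le_trans (F_le x s) _; rewrite mulrAC.
  rewrite ge0_integralZl//; last 2 first.
  - by apply: measurableT_comp => //; exact/measurable_EFinP.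
  - by apply: mule_ge0 => //; rewrite lee_fin normr_ge0.
  by rewrite muleAC.
rewrite ge0_integralZl//; last 2 first.
- by apply: measurableT_comp => //; exact: measurable_int izeta.
- by apply: mule_ge0 => //; rewrite lee_fin normr_ge0.
have iz : (\int[leb2]_x `|(EFin \o zeta) x| < +oo)%E by case/integrableP : izeta.
rewrite lte_mul_pinfty//; first by apply: mule_ge0 => //; rewrite lee_fin normr_ge0.
by rewrite fin_numM// ge0_fin_numE.
Qed.

Let kerE x : \int[mu]_s F (x, s) = (\int[mu]_s (k (x, s) * phi s)) * zeta x.
Proof.
have [z0|z0] := eqVneq (zeta x) 0.
  rewrite z0 mulr0 /Rintegral (_ : (fun s => _) = cst 0%E) ?integral0//.
  by apply/funext => s; rewrite /F/= z0 mulr0.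
by rewrite -RintegralZr//; exact: kernel_integrable.
Qed.

Lemma kernel_mul_integrable :
  leb2.-integrable setT (fun x => ((\int[mu]_s (k (x, s) * phi s)) * zeta x)%:E).
Proof.
have := Rfubini_integrable1 iF iF1.
by under eq_fun do rewrite kerE.
Qed.

(** The bound on k is only asked on the supports of zeta and phi, so k may be
    singular elsewhere. *)
Lemma kernel_fubini :
  \int[leb2]_x ((\int[mu]_s (k (x, s) * phi s)) * zeta x) =
  \int[mu]_s (\int[leb2]_x (k (x, s) * phi s * zeta x)).
Proof.
under eq_Rintegral do rewrite -kerE.
by rewrite (Rfubini iF iF1 iF2).
Qed.

End kernel.
End convolution.

(** * Integration by parts *)

Section compactly_supported.
Context {R : realType}.
Local Notation mu := (@lebesgue_measure R).
Implicit Types (U K : set (R * R)) (f v eta : R * R -> R).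

Lemma compact_in_square K : compact K ->
  exists2 M : R, 0 < M & forall x, K x -> `|x.1| < M /\ `|x.2| < M.
Proof.
move=> /compact_bounded [B [_ HB]].
exists (Num.max B 0 + 1 + 1); first by rewrite !ltr_wpDl// ?addr_ge0// le_max lexx orbT.
move=> x Kx.
have h : `|x| <= Num.max B 0 + 1.
  by apply: HB => //; rewrite (@le_lt_trans _ _ (Num.max B 0))// ?le_max ?lexx// ltrDl.
have := h; rewrite prod_normE ge_max => /andP[h1 h2].
by split; apply: le_lt_trans; [exact: h1| |exact: h2|]; rewrite ltrDl.
Qed.

Lemma compact_continuous_bound K f : compact K -> continuous f ->
  exists2 B : R, 0 <= B & forall x, K x -> `|f x| <= B.
Proof.
move=> cK cf.
have : compact (f @` K) by apply: continuous_compact => //; exact: continuous_subspaceT.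
move=> /compact_bounded [B [_ HB]].
exists (Num.max B 0 + 1); first by rewrite addr_ge0// le_max lexx orbT.
move=> x Kx; apply: (HB (Num.max B 0 + 1)); last by exists x.
by rewrite (@le_lt_trans _ _ (Num.max B 0))// ?le_max ?lexx// ltrDl.
Qed.

Lemma cc_integrable K f : compact K -> continuous f -> (forall x, ~ K x -> f x = 0) ->
  leb2.-integrable setT (EFin \o f).
Proof.
move=> cK cf f0.
have [M M0 KM] := compact_in_square cK.
have [B B0 fB] := compact_continuous_bound cK cf.
pose S : set (R * R) := (`[- M, M] `*` `[- M, M])%classic.
have mS : measurable S by exact: measurableX.
apply: (@integrable_of_bound _ f (fun x => B%:E * (\1_S x)%:E)%E).
- exact: continuous_measurable2.
- move=> x; rewrite -EFinM lee_fin.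
  have [Kx|nKx] := pselect (K x); last by rewrite f0// normr0 mulr_ge0.
  rewrite indicE mem_set ?mulr1; first exact: fB.
  by have [/ltW h1 /ltW h2] := KM _ Kx; split; rewrite /= in_itv/= -ler_norml.
- rewrite ge0_integralZl//; last by apply/measurable_EFinP; apply: measurable_indic; exact: mS.
  rewrite integral_indic// setIT lte_mul_pinfty// ?lee_fin//.
  rewrite [X in (X < _)%E](_ : _ = mu `[(- M)%R, M] * mu `[(- M)%R, M])%E; last exact: product_measure1E.
  by rewrite lebesgue_measure_itv/=; case: ifP => _; rewrite ?mul0e// -EFinB -EFinM ltry.
Qed.

(** Off the closed set K, v vanishes in a neighbourhood of each point. *)
Lemma C1c_grad_out U v : C1c U v -> exists K, [/\ compact K, K `<=` U, forall x, ~ K x -> v x = 0 &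
  forall x, ~ K x -> grad v x = 0].
Proof.
move=> [dv cv [K [cK KU v0]]]; exists K; split => // x nKx.
have oK : open (~` K).
  by apply: closed_openC; apply: compact_closed => //; exact: norm_hausdorff.
have nv : \forall y \near x, v y = cst 0 y.
  by apply: filterS (open_nbhs_nbhs (conj oK nKx)) => y; exact: v0.
rewrite /grad; congr (_, _).
  rewrite (near_eq_derive _ nv) ?derive_cst//.
by rewrite (near_eq_derive _ nv) ?derive_cst//.
Qed.

Lemma Rintegral_translate f (c : R * R) : measurable_fun setT f ->
  \int[leb2]_x f (x + c) = \int[leb2]_x f x.
Proof.
move=> mf; rewrite /Rintegral; congr fine.
have mEf : measurable_fun setT (EFin \o f) by exact/measurable_EFinP.
have mp : measurable_fun setT (EFin \o f)^\+%E by exact: measurable_funepos.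
have mn : measurable_fun setT (EFin \o f)^\-%E by exact: measurable_funeneg.
rewrite [LHS]integralE [RHS]integralE; congr (_ - _)%E.
  have h := leb2_translate c mp.
  etransitivity; last by apply: (etrans (h _)) => [z|]; [exact: funepos_ge0|apply: eq_integral].
  by apply: eq_integral => z _; rewrite !funeposE.
have h := leb2_translate c mn.
etransitivity; last by apply: (etrans (h _)) => [z|]; [exact: funeneg_ge0|apply: eq_integral].
by apply: eq_integral => z _; rewrite !funenegE.
Qed.

Lemma is_derive_translate v (c u x : R * R) :
  (derivable v (x - c) u -> derivable (fun y => v (y - c)) x u) /\ 'D_u (fun y => v (y - c)) x = 'D_u v (x - c).
Proof.
have E : (fun h : R => h^-1 *: (((fun y => v (y - c)) \o shift x) (h *: u) - v (x - c))) =
  (fun h : R => h^-1 *: ((v \o shift (x - c)) (h *: u) - v (x - c))).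
  by apply/funext => h /=; rewrite addrA.
by rewrite /derivable /derive E.
Qed.

Lemma C1c_translate U v (c : R * R) : C1c U v ->
  C1c setT (fun y => v (y - c)) /\ grad (fun y => v (y - c)) = (fun y => grad v (y - c)).
Proof.
move=> [dv cv [K [cK KU v0]]].
have gE : grad (fun y => v (y - c)) = (fun y => grad v (y - c)).
  by apply/funext => y; rewrite /grad !(is_derive_translate _ _ _ _).2.
have cs : continuous (fun y : R * R => y - c) by move=> y; apply: cvgB; [exact: cvg_id|exact: cvg_cst].
split => //; split.
- by move=> y; split; apply: (is_derive_translate _ _ _ _).1; [exact: (dv _).1|exact: (dv _).2].
- by rewrite gE => y; apply: (@continuous_comp _ _ _ (fun y : R * R => y - c) (grad v)); [exact: cs|exact: cv].
- exists ((fun y => y + c) @` K); split => //.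
    apply: continuous_compact => //; apply: continuous_subspaceT => y.
    by apply: cvgD; [exact: cvg_id|exact: cvg_cst].
  by move=> y ny; apply: v0 => Ky; apply: ny; exists (y - c) => //; rewrite subrK.
Qed.

Lemma continuous_pairl (y : R) : continuous (fun t : R => (t, y)).
Proof.
have c1 : continuous (fun t : R => t) by move=> t; exact: cvg_id.
have c2 : continuous (fun _ : R => y) by move=> t; exact: cvg_cst.
by move=> t; exact: (cvg_pair (c1 t) (c2 t)).
Qed.

Lemma continuous_pairr (x : R) : continuous (fun t : R => (x, t)).
Proof.
have c1 : continuous (fun t : R => t) by move=> t; exact: cvg_id.
have c2 : continuous (fun _ : R => x) by move=> t; exact: cvg_cst.
by move=> t; exact: (cvg_pair (c2 t) (c1 t)).
Qed.

(** The integral of a partial derivative vanishes line by line. *)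
Lemma integral_grad_eq0 U v : C1c U v ->
  \int[leb2]_x (grad v x).1 = 0 /\ \int[leb2]_x (grad v x).2 = 0.
Proof.
move=> Cv; have [K [cK _ v0 gv0]] := C1c_grad_out Cv; have [dv cg _] := Cv.
have [M M0 KM] := compact_in_square cK.
have c1 : continuous (fun x => (grad v x).1).
  by move=> x; apply: (continuous_comp (f := grad v) (g := fst)); [exact: cg|exact: continuous2_fst].
have c2 : continuous (fun x => (grad v x).2).
  by move=> x; apply: (continuous_comp (f := grad v) (g := snd)); [exact: cg|exact: continuous2_snd].
have i1 : leb2.-integrable setT (EFin \o (fun x => (grad v x).1)).
  by apply: (cc_integrable cK c1) => x /gv0 ->.
have i2 : leb2.-integrable setT (EFin \o (fun x => (grad v x).2)).
  by apply: (cc_integrable cK c2) => x /gv0 ->.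
have line (phi dphi : R -> R) : (forall t : R, is_derive t 1 phi (dphi t)) -> continuous dphi ->
    (forall t, M <= `|t| -> phi t = 0) -> (forall t, M <= `|t| -> dphi t = 0) ->
    (\int[mu]_t (dphi t)%:E = 0)%E.
  move=> dp cdp p0 dp0.
  have cp := continuous_is_derive dp.
  rewrite (_ : (\int[mu]_t (dphi t)%:E = \int[mu]_(t in `[(- M)%R, M]) (dphi t)%:E)%E); last first.
    rewrite [RHS]integral_mkcond; apply: eq_integral => t _; rewrite /patch.
    case: ifPn => // /negP nt; rewrite dp0// leNgt; apply/negP => tM; apply: nt.
    by apply/mem_set; rewrite /= in_itv/= -ler_norml ltW.
  rewrite (@continuous_FTC2 _ dphi phi)//.
  - by rewrite !p0 ?normrN ?gtr0_norm// subee.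
  - lra.
  - exact: continuous_subspaceT.
  - split; first by move=> t _; (have dpt := dp t; exact: ex_derive).
      by apply: cvg_at_right_filter; exact: cp.
    by apply: cvg_at_left_filter; exact: cp.
  - by move=> t _; rewrite derive1E; (have dpt := dp t; exact: derive_val).
have far1 (s t : R) : M <= `|s| -> ~ K (s, t) by move=> Ms /KM[/=]; rewrite ltNge Ms.
have far2 (s t : R) : M <= `|t| -> ~ K (s, t) by move=> Mt /KM[/= _]; rewrite ltNge Mt.
split; rewrite /Rintegral.
  rewrite (_ : (\int[leb2]_x _ = \int[mu]_y \int[mu]_x ((grad v (x, y)).1)%:E)%E); last first.
    by rewrite (integral21_prod_meas1 i1).
  rewrite integral0_eq// => y _; apply: (line (fun t => v (t, y)) (fun t => (grad v (t, y)).1)).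
  - by move=> t; exact: (is_derive_fst (dv (t, y)).1).
  - move=> t; apply: (continuous_comp (f := fun t : R => (t, y)) (g := fun x => (grad v x).1)); last exact: c1.
    exact: continuous_pairl.
  - by move=> t Mt; apply: v0; exact: far1.
  - by move=> t Mt; rewrite gv0//; exact: far1.
rewrite (_ : (\int[leb2]_x _ = \int[mu]_x \int[mu]_y ((grad v (x, y)).2)%:E)%E); last first.
  by rewrite (integral12_prod_meas1 i2).
rewrite integral0_eq// => x _; apply: (line (fun t => v (x, t)) (fun t => (grad v (x, t)).2)).
- by move=> t; exact: (is_derive_snd (dv (x, t)).2).
- move=> t; apply: (continuous_comp (f := fun t : R => (x, t)) (g := fun x => (grad v x).2)); last exact: c2.
  exact: continuous_pairr.
- by move=> t Mt; apply: v0; exact: far2.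
- by move=> t Mt; rewrite gv0//; exact: far2.
Qed.

(** The product v eta has compact support, so its gradient has integral zero. *)
Lemma C1_integration_by_parts U v eta : C1 v -> C1c U eta ->
  (\int[leb2]_x (v x * (grad eta x).1) = - (\int[leb2]_x ((grad v x).1 * eta x))) /\
  (\int[leb2]_x (v x * (grad eta x).2) = - (\int[leb2]_x ((grad v x).2 * eta x))).
Proof.
move=> [dv cg] Ce; have [K [cK KU e0 ge0]] := C1c_grad_out Ce; have [de cge _] := Ce.
have cv := C1_continuous (conj dv cg).
have ce := C1_continuous (C1c_C1 Ce).
have cf (w : R * R -> R * R) : continuous w -> continuous (fun x => (w x).1).
  by move=> cw x; apply: (continuous_comp (f := w) (g := fst)); [exact: cw|exact: continuous2_fst].
have cs (w : R * R -> R * R) : continuous w -> continuous (fun x => (w x).2).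
  by move=> cw x; apply: (continuous_comp (f := w) (g := snd)); [exact: cw|exact: continuous2_snd].
pose D x := ((grad v x).1 * eta x + v x * (grad eta x).1, (grad v x).2 * eta x + v x * (grad eta x).2).
have cM (f g : R * R -> R) : continuous f -> continuous g -> continuous (fun x => f x * g x).
  by move=> h1 h2 x; apply: cvgM; [exact: h1|exact: h2].
have cA (f g : R * R -> R) : continuous f -> continuous g -> continuous (fun x => f x + g x).
  by move=> h1 h2 x; apply: cvgD; [exact: h1|exact: h2].
have [|||||Cp gp] := @C1c_of_partials R (fun x => v x * eta x) D U K _ _ _ _ cK KU.
- move=> [s t] /=.
  have d1 := is_derive_fst (dv (s, t)).1; have d2 := is_derive_fst (de (s, t)).1.
  have := is_deriveM d1 d2; rewrite /D /GRing.scale/= addrC [eta _ * _]mulrC; exact.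
- move=> [s t] /=.
  have d1 := is_derive_snd (dv (s, t)).2; have d2 := is_derive_snd (de (s, t)).2.
  have := is_deriveM d1 d2; rewrite /D /GRing.scale/= addrC [eta _ * _]mulrC; exact.
- by apply: cA; apply: cM => //; exact: cf.
- by apply: cA; apply: cM => //; exact: cs.
- by move=> x /e0 ->; rewrite mulr0.
have [I1 I2] := integral_grad_eq0 Cp.
have i1 : leb2.-integrable setT (EFin \o (fun x => (grad v x).1 * eta x)).
  by apply: (cc_integrable cK) => [|x /e0 ->]; [apply: cM => //; exact: cf|rewrite mulr0].
have i2 : leb2.-integrable setT (EFin \o (fun x => (grad v x).2 * eta x)).
  by apply: (cc_integrable cK) => [|x /e0 ->]; [apply: cM => //; exact: cs|rewrite mulr0].
have j1 : leb2.-integrable setT (EFin \o (fun x => v x * (grad eta x).1)).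
  by apply: (cc_integrable cK) => [|x /ge0 ->]; [apply: cM => //; exact: cf|rewrite mulr0].
have j2 : leb2.-integrable setT (EFin \o (fun x => v x * (grad eta x).2)).
  by apply: (cc_integrable cK) => [|x /ge0 ->]; [apply: cM => //; exact: cs|rewrite mulr0].
have E (f g : R * R -> R) : leb2.-integrable setT (EFin \o f) -> leb2.-integrable setT (EFin \o g) ->
    \int[leb2]_x (f x + g x) = 0 -> \int[leb2]_x g x = - (\int[leb2]_x f x).
  move=> fi gi /eqP; rewrite (RintegralD measurableT fi gi) addrC addr_eq0 => /eqP; exact.
by rewrite gp in I1 I2; split; [exact: (E _ _ i1 j1 I1)|exact: (E _ _ i2 j2 I2)].
Qed.

End compactly_supported.

(** * The heat kernel *)

Section heat_kernel.
Context {R : realType}.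
Local Notation mu := (@lebesgue_measure R).
Implicit Types (d t tau : R) (x y : R * R).

Lemma enorm_gt0 x : x != 0 -> 0 < enorm x.
Proof.
case: x => a b ab; rewrite sqrtr_gt0/= lt0r addr_ge0 ?sqr_ge0// andbT paddr_eq0 ?sqr_ge0// !sqrf_eq0.
by apply: contra ab => /andP[/eqP -> /eqP ->].
Qed.

Lemma enorm_neq0 x : 0 < enorm x -> x != 0.
Proof. by apply: contraTneq => ->; rewrite /enorm/= expr0n addr0 sqrtr0 ltxx. Qed.

Lemma greenE d t x : green d t x = (4 * pi * d * t)^-1 * expR (- ((x.1 ^+ 2 + x.2 ^+ 2) / (4 * d * t))).
Proof. by rewrite /green enorm_sqr. Qed.

Lemma greenN d t x : green d t (- x) = green d t x.
Proof. by rewrite /green enormN. Qed.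

Lemma green_ge0 d t x : 0 < d -> 0 <= t -> 0 <= green d t x.
Proof. by move=> d0 t0; rewrite mulr_ge0 ?expR_ge0// invr_ge0 !mulr_ge0 ?pi_ge0// ltW. Qed.

Lemma continuous_green d t : continuous (green d t).
Proof.
move=> x; apply: cvgM; first exact: cvg_cst.
apply: (continuous_comp (f := fun x => - (enorm x ^+ 2 / (4 * d * t))) (g := expR)); last exact: continuous_expR.
apply: cvgN; apply: cvgM; last exact: cvg_cst.
by rewrite expr2; apply: cvgM; exact: continuous_enorm.
Qed.

Lemma measurable_green d t : measurable_fun setT (green d t).
Proof. exact: continuous_measurable2 (@continuous_green d t). Qed.

Lemma is_derive_gauss (a b c s : R) :
  is_derive s 1 (fun s : R => c * expR (- ((s ^+ 2 + b) / a))) (- (2 * s / a) * (c * expR (- ((s ^+ 2 + b) / a)))).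
Proof.
rewrite mulrCA; apply: is_derive_mull.
have h1 : is_derive s 1 (fun s : R => - ((s ^+ 2 + b) / a)) (- (2 * s / a)).
  have h : is_derive s 1 (fun s : R => s ^+ 2 + b) (2 * s).
    by apply: is_derive_eq; rewrite addr0 /GRing.scale/= mulr1 mulr_natl; ring.
  have h' := is_derive_mulr (a^-1) h.
  have := is_deriveN h'; exact.
have := is_derive1_comp (is_derive_expR _) h1.
by rewrite /= mulrC; apply.
Qed.

Lemma is_derive_green_fst d t x :
  is_derive x.1 1 (fun s => green d t (s, x.2)) (- (2 * x.1 / (4 * d * t)) * green d t x).
Proof. by rewrite greenE; under eq_fun do rewrite greenE/=; exact: is_derive_gauss. Qed.

Lemma is_derive_green_snd d t x :
  is_derive x.2 1 (fun s => green d t (x.1, s)) (- (2 * x.2 / (4 * d * t)) * green d t x).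
Proof.
by rewrite greenE addrC; under eq_fun do rewrite greenE/= addrC; exact: is_derive_gauss.
Qed.

(** The formula also holds for t = 0, where both sides vanish. *)
Lemma grad_green d t x : grad (green d t) x =
  (- (2 * x.1 / (4 * d * t)) * green d t x, - (2 * x.2 / (4 * d * t)) * green d t x).
Proof.
rewrite /grad; congr (_, _).
  exact: (derivable_of_fst (is_derive_green_fst d t x)).2.
exact: (derivable_of_snd (is_derive_green_snd d t x)).2.
Qed.

Lemma C1_green d t : C1 (green d t).
Proof.
split=> x.
  split; first exact: (derivable_of_fst (is_derive_green_fst d t x)).1.
  exact: (derivable_of_snd (is_derive_green_snd d t x)).1.
rewrite (_ : grad _ = fun x => (- (2 * x.1 / (4 * d * t)) * green d t x, - (2 * x.2 / (4 * d * t)) * green d t x)); last first.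
  by apply/funext => y; rewrite grad_green.
have c1 : continuous (fun x : R * R => - (2 * x.1 / (4 * d * t)) * green d t x).
  move=> y; apply: cvgM; last exact: continuous_green.
  by apply: cvgN; apply: cvgM; [apply: cvgM; [exact: cvg_cst|exact: continuous2_fst]|exact: cvg_cst].
have c2 : continuous (fun x : R * R => - (2 * x.2 / (4 * d * t)) * green d t x).
  move=> y; apply: cvgM; last exact: continuous_green.
  by apply: cvgN; apply: cvgM; [apply: cvgM; [exact: cvg_cst|exact: continuous2_snd]|exact: cvg_cst].
have c12 := cvg_pair (c1 x) (c2 x); exact: c12.
Qed.

Lemma measurable_inv : measurable_fun setT (fun t : R => t^-1).
Proof.
rewrite (_ : (fun t => _) = (fun t : R => t * (t ^+ 2) `^ (-1))); last first.
  apply/funext => t; rewrite powR_inv1 ?sqr_ge0//.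
  have [->|t0] := eqVneq t 0; first by rewrite invr0 mul0r.
  by rewrite expr2 invfM mulrA divff// mul1r.
apply: measurable_funM => //.
by apply: (measurableT_comp (measurable_powR _)); exact: measurable_funX.
Qed.

Lemma measurable_green_joint d t :
  measurable_fun setT (fun w : (R * R) * R => green d (t - w.2) w.1).
Proof.
have mt : measurable_fun setT (fun w : (R * R) * R => t - w.2) by apply: measurable_funB => //; exact: measurable_cst.
have mi (c : R) : measurable_fun setT (fun w : (R * R) * R => (c * (t - w.2))^-1).
  apply: (measurableT_comp measurable_inv); apply: measurable_funM => //; exact: measurable_cst.
apply: measurable_funM; first exact: mi.
apply: (measurableT_comp (@measurable_expR R)).
apply: measurableT_comp => //; apply: measurable_funM; last exact: mi.
apply: measurable_funX; apply: (measurableT_comp _ measurable_fst).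
exact: continuous_measurable2 continuous_enorm.
Qed.

Lemma measurable_grad_green_joint d t :
  measurable_fun setT (fun w : (R * R) * R => (grad (green d (t - w.2)) w.1).1) /\
  measurable_fun setT (fun w : (R * R) * R => (grad (green d (t - w.2)) w.1).2).
Proof.
have mt : measurable_fun setT (fun w : (R * R) * R => t - w.2) by apply: measurable_funB => //; exact: measurable_cst.
have mi (c : R) : measurable_fun setT (fun w : (R * R) * R => (c * (t - w.2))^-1).
  apply: (measurableT_comp measurable_inv); apply: measurable_funM => //; exact: measurable_cst.
have mg := @measurable_green_joint d t.
split; under eq_fun do rewrite grad_green/=.
  apply: measurable_funM => //; apply: measurableT_comp => //; apply: measurable_funM; last exact: mi.
  apply: measurable_funM; first exact: measurable_cst.
  exact: (measurableT_comp measurable_fst measurable_fst).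
apply: measurable_funM => //; apply: measurableT_comp => //; apply: measurable_funM; last exact: mi.
apply: measurable_funM; first exact: measurable_cst.
exact: (measurableT_comp measurable_snd measurable_fst).
Qed.

Lemma green_le d t x : 0 < d -> 0 <= t -> green d t x <= (4 * pi * d * t)^-1.
Proof.
move=> d0 t0; rewrite ler_piMr//; first by rewrite invr_ge0 !mulr_ge0 ?pi_ge0// ltW.
rewrite -[leRHS]expR0 ler_expR oppr_le0 mulr_ge0 ?sqr_ge0// invr_ge0 !mulr_ge0//; exact: ltW.
Qed.

(** This is u exp(- u) <= 1, with u = |x|^2 / (4 d t). *)
Lemma green_le_inv_sqr d t x : 0 < d -> 0 <= t -> x != 0 -> green d t x <= (pi * enorm x ^+ 2)^-1.
Proof.
move=> d0 t0 x0; have r0 := enorm_gt0 x0; have pi0 := @pi_gt0 R.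
rewrite /green; move: (@pi R) pi0 => P pi0; have [->|tn0] := eqVneq t 0.
  by rewrite mulr0 invr0 mul0r invr_ge0 mulr_ge0 ?sqr_ge0// ltW.
have a0 : 0 < 4 * d * t by rewrite !mulr_gt0// lt0r tn0.
rewrite (_ : 4 * P * d * t = P * (4 * d * t)); last by ring.
set a := 4 * d * t in a0 *; set r := enorm x in r0 *.
have u0 : 0 < r ^+ 2 / a by rewrite divr_gt0// exprn_gt0.
rewrite (_ : (P * a)^-1 * _ = (P * r ^+ 2)^-1 * (r ^+ 2 / a * expR (- (r ^+ 2 / a)))); last first.
  by field; rewrite !lt0r_neq0.
rewrite ler_piMr//; first by rewrite invr_ge0 mulr_ge0 ?sqr_ge0// ltW.
rewrite (expRN (r ^+ 2 / a)) ler_pdivrMr ?expR_gt0// mul1r.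
by apply/ltW/(lt_le_trans _ (expR_ge1Dx _)); rewrite ltrDr.
Qed.

(** The supremum over t > 0 of the length of the gradient of the heat kernel at x;
    it does not depend on d, as a change of d only rescales time. *)
Definition green_slope x : R := 8 * expR (-2) / (pi * enorm x ^+ 3).

Lemma enorm_grad_green d t x : 0 < d -> 0 < t ->
  enorm (grad (green d t) x) =
  2 * enorm x / (pi * (4 * d * t) ^+ 2) * expR (- (enorm x ^+ 2 / (4 * d * t))).
Proof.
move=> d0 t0; have pi0 := @pi_gt0 R.
rewrite (_ : grad _ _ = (- (2 / (4 * d * t) * green d t x)) *: x); last first.
  by rewrite grad_green; case: x => a b /=; congr (_, _); rewrite /GRing.scale/=; ring.
have g0 : 0 <= 2 / (4 * d * t) * green d t x.
  apply: mulr_ge0; last by apply: green_ge0 => //; exact: ltW.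
  by rewrite divr_ge0// !mulr_ge0//; exact: ltW.
rewrite enormZ normrN ger0_norm// /green; move: (@pi R) pi0 => P pi0; field.
by rewrite !lt0r_neq0.
Qed.

Lemma enorm_grad_green0 d x : enorm (grad (green d 0) x) = 0.
Proof.
rewrite grad_green /green !(mulr0, invr0, mul0r).
by rewrite /enorm /= expr0n addr0 sqrtr0.
Qed.

(** The slope is a multiple, depending on x only, of u^2 exp(- u) with
    u = |x|^2 / (4 d t), and u^2 exp(- u) is maximal for u = 2. *)
Lemma enorm_grad_green_le d t x : 0 < d -> 0 <= t -> x != 0 ->
  enorm (grad (green d t) x) <= green_slope x.
Proof.
move=> d0; have pi0 := @pi_gt0 R.
rewrite le_eqVlt => /orP[/eqP <- x0|t0 x0].
  rewrite enorm_grad_green0 /green_slope divr_ge0// ?mulr_ge0 ?expR_ge0 ?exprn_ge0 ?enorm_ge0//.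
  exact: ltW.
rewrite enorm_grad_green// /green_slope; move: (@pi R) pi0 => P pi0.
have a0 : 0 < 4 * d * t by rewrite !mulr_gt0.
have r0 := enorm_gt0 x0.
set a := 4 * d * t in a0 *; set r := enorm x in r0 *.
pose u := r ^+ 2 / a; have u0 : 0 < u by rewrite divr_gt0// exprn_gt0.
rewrite -/u (_ : 2 * r / (P * a ^+ 2) * expR (- u) = (2 / (P * r ^+ 3)) * (u ^+ 2 * expR (- u))); last first.
  by rewrite /u; field; rewrite !lt0r_neq0.
rewrite (_ : 8 * expR (-2) / (P * r ^+ 3) = (2 / (P * r ^+ 3)) * (4 * expR (-2))); last first.
  by field; rewrite !lt0r_neq0.
rewrite ler_pM2l; last by rewrite divr_gt0// mulr_gt0// exprn_gt0.
rewrite expRN ler_pdivrMr ?expR_gt0// -mulrA -expRD.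
have h := expR_ge1Dx (u / 2 - 1).
have h2 : u / 2 <= expR (u / 2 - 1) by apply: le_trans h; lra.
have : (u / 2) ^+ 2 <= expR (u / 2 - 1) ^+ 2 by rewrite lerXn2r// ?nnegrE ?expR_ge0// divr_ge0// ltW.
rewrite -expRM_natl (_ : 2%:R * (u / 2 - 1) = - 2 + u); last by field.
by rewrite expr_div_n ler_pdivrMr// [_ * 2 ^+ 2]mulrC (_ : 2 ^+ 2 = 4%:R)// -natrX.
Qed.

Lemma sup_enorm_grad_green d x : 0 < d -> x != 0 ->
  ereal_sup [set (enorm (grad (green d tau) x))%:E | tau in [set tau : R | 0 < tau]] =
  (green_slope x)%:E.
Proof.
move=> d0 x0; have pi0 := @pi_gt0 R; have r0 := enorm_gt0 x0.
apply/eqP; rewrite eq_le; apply/andP; split.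
  apply: ge_ereal_sup => _ [t /= t0 <-]; rewrite lee_fin.
  by apply: enorm_grad_green_le => //; exact: ltW.
apply: ereal_sup_ubound; exists (enorm x ^+ 2 / (8 * d)) => /=.
  by rewrite divr_gt0 ?exprn_gt0// mulr_gt0.
rewrite enorm_grad_green//; last by rewrite divr_gt0 ?exprn_gt0// mulr_gt0.
congr EFin; rewrite /green_slope; move: (@pi R) pi0 => P pi0.
rewrite (_ : 4 * d * (enorm x ^+ 2 / (8 * d)) = enorm x ^+ 2 / 2); last by field; rewrite lt0r_neq0.
rewrite (_ : enorm x ^+ 2 / (enorm x ^+ 2 / 2) = 2); last by field; rewrite lt0r_neq0.
by field; rewrite !lt0r_neq0.
Qed.

Lemma green_slope_gt0 x : x != 0 -> 0 < green_slope x.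
Proof.
by move=> /enorm_gt0 r0; rewrite divr_gt0 ?mulr_gt0 ?expR_gt0 ?exprn_gt0 ?pi_gt0.
Qed.

Lemma continuous_green_slope x : x != 0 -> {for x, continuous green_slope}.
Proof.
move=> x0; have r0 := enorm_gt0 x0; have pi0 := @pi_gt0 R.
apply: cvgM; first exact: cvg_cst.
apply: cvgV; first by rewrite lt0r_neq0// mulr_gt0// exprn_gt0.
apply: cvgM; first exact: cvg_cst.
rewrite (_ : (fun y : R * R => enorm y ^+ 3) = (fun y => enorm y * (enorm y * enorm y))).
  rewrite exprS expr2; apply: cvgM; first exact: continuous_enorm.
  by apply: cvgM; exact: continuous_enorm.
by apply/funext => y; rewrite exprS expr2.
Qed.

Lemma measurable_green_slope : measurable_fun setT green_slope.
Proof.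
apply: measurable_funM; first exact: measurable_cst.
apply: (measurableT_comp measurable_inv); apply: measurable_funM; first exact: measurable_cst.
by apply: measurable_funX; exact: continuous_measurable2 continuous_enorm.
Qed.

(** The heat kernel of the plane is a product of two centred normal densities
    of variance 2 d t. *)
Lemma integral_green d t : 0 < d -> 0 < t -> (\int[leb2]_x (green d t x)%:E = 1)%E.
Proof.
move=> d0 t0; have pi0 := @pi_gt0 R.
pose s := Num.sqrt (2 * d * t).
have s2 : s ^+ 2 = 2 * d * t by rewrite sqr_sqrtr// !mulr_ge0// ltW.
have s0 : s != 0.
  by rewrite lt0r_neq0// sqrtr_gt0 !mulr_gt0.
have E x : green d t x = normal_pdf 0 s x.1 * normal_pdf 0 s x.2.
  rewrite greenE normal_pdfE// /normal_peak /normal_fun !subr0 s2.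
  rewrite mulrACA -expRD -invfM -expr2 sqr_sqrtr; last first.
    by rewrite mulrn_wge0// !mulr_ge0// ltW.
  congr (_^-1 * expR _); first by move: (@pi R) => P; ring.
  by field; rewrite !lt0r_neq0.
have mN : measurable_fun setT (normal_pdf (0 : R) s) by exact: measurable_normal_pdf.
rewrite (@leb2_int12 _ (fun x => (green d t x)%:E)); last 2 first.
- by apply/measurable_EFinP; exact: measurable_green.
- by move=> z; rewrite lee_fin green_ge0// ltW.
under eq_integral => x _.
  under eq_integral => y _ do rewrite E/= EFinM.
  rewrite ge0_integralZl//; last 3 first.
  - exact/measurable_EFinP.
  - by move=> y _; rewrite lee_fin normal_pdf_ge0.
  - by rewrite lee_fin normal_pdf_ge0.
  rewrite integral_normal_pdf mule1.
  over.
exact: integral_normal_pdf.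
Qed.

End heat_kernel.

(** * The weak gradient of the mild solution *)

Section mild_gradient.
Context {R : realType}.
Local Notation mu := (@lebesgue_measure R).
Variables (d tau delta : R) (u0 : R * R -> R) (g0 : R * R -> R * R) (phibar : R -> R).
Variable Om : set (R * R).
Hypotheses (d0 : 0 < d) (tau0 : 0 < tau) (delta0 : 0 < delta).
Hypothesis oOm : open Om.
Hypothesis Om_far : forall x, Om x -> delta <= enorm x.
Hypothesis Su0 : sobolev1 setT u0 g0.
Hypothesis iphi : mu.-integrable `[0, tau] (EFin \o phibar).

Definition coordinate (c : bool) (x : R * R) : R := if c then x.1 else x.2.

(** The two terms of the gradient of the mild solution. The derivative is left on
    the initial data in the first one, which is the convolution of the heat kernel
    with the weak gradient, and is put on the kernel in the second one. *)
Definition initial_part c x : R := \int[leb2]_z (green d tau z * coordinate c (g0 (x + z))).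

Definition source_part c x : R :=
  \int[mu]_(s in `[0, tau]) (coordinate c (grad (green d (tau - s)) x) * phibar s).

Local Notation phi := (phibar \_ `[0, tau]).

Let iphiT : mu.-integrable setT (EFin \o phi).
Proof.
rewrite -restrict_EFin; apply/(integrable_mkcond _ _).1 => //.
Qed.

Let phi_neq0 s : phi s != 0 -> 0 <= tau - s.
Proof.
rewrite patchE; case: ifPn => [|_]; last by rewrite eqxx.
by rewrite inE/= in_itv/= => /andP[_ st] _; rewrite subr_ge0.
Qed.

Let sourceE c x :
  source_part c x = \int[mu]_s (coordinate c (grad (green d (tau - s)) x) * phi s).
Proof.
rewrite /source_part Rintegral_mkcond; apply: eq_Rintegral => s _.
by rewrite !patchE; case: ifP => _ //; rewrite mulr0.
Qed.

Let mu0 : measurable_fun setT u0.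
Proof. by case: Su0 => h _ _ _; exact: (@L2_measurable _ _ _ leb2 _ _ measurableT h). Qed.

Let mg0 c : measurable_fun setT (fun x => coordinate c (g0 x)).
Proof.
by case: Su0 => _ h1 h2 _; case: c; [exact: (@L2_measurable _ _ _ leb2 _ _ measurableT h1)
  |exact: (@L2_measurable _ _ _ leb2 _ _ measurableT h2)].
Qed.

Let u02 : (\int[leb2]_x (u0 x ^+ 2)%:E < +oo)%E.
Proof. by case: Su0 => h _ _ _; exact: (L2_sqr_lty h). Qed.

Let g02 c : (\int[leb2]_x (coordinate c (g0 x) ^+ 2)%:E < +oo)%E.
Proof. by case: Su0 => _ h1 h2 _; case: c; [exact: (L2_sqr_lty h1)|exact: (L2_sqr_lty h2)]. Qed.

Let mildE x : mild_solution d u0 phibar tau x =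
  \int[leb2]_z (green d tau z * u0 (x + z)) + \int[mu]_s (green d (tau - s) x * phi s).
Proof.
congr (_ + _).
  rewrite -(@Rintegral_translate _ (fun y => green d tau (x - y) * u0 y) x).
    by apply: eq_Rintegral => z _; rewrite opprD addrCA subrr addr0 greenN addrC.
  apply: measurable_funM => //.
  rewrite (_ : (fun y => _) = green d tau \o (fun y => y - x)); last first.
    by apply/funext => y /=; rewrite -greenN opprB.
  exact: (measurableT_comp (@measurable_green _ d tau) (measurable_addr (- x))).
rewrite Rintegral_mkcond; apply: eq_Rintegral => s _.
by rewrite !patchE; case: ifP => _ //; rewrite mulr0.
Qed.


(** The functions against which the mild solution and its gradient get
    integrated: they stay away from the singularity at the origin. *)
Let admissible (zeta : R * R -> R) := [/\ leb2.-integrable setT (EFin \o zeta),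
  (\int[leb2]_x (zeta x ^+ 2)%:E < +oo)%E & forall x, zeta x != 0 -> delta <= enorm x].

Let admissible_measurable zeta : admissible zeta -> measurable_fun setT zeta.
Proof. by case=> iz _ _; apply/measurable_EFinP; exact: measurable_int iz. Qed.

Let admissibleN zeta : admissible zeta -> admissible (fun x => - zeta x).
Proof.
case=> iz z2 zd; split => [||x].
- exact: (integrableN iz).
- by under eq_integral do rewrite sqrrN.
- by rewrite oppr_eq0; exact: zd.
Qed.

Let admissible_cc K zeta : compact K -> K `<=` Om -> continuous zeta ->
  (forall x, ~ K x -> zeta x = 0) -> admissible zeta.
Proof.
move=> cK KO cz z0; split.
- exact: (cc_integrable cK).
- have /integrableP[_] : leb2.-integrable setT (EFin \o (fun x => zeta x ^+ 2)).
    apply: (cc_integrable cK) => [x|x /z0 ->]; last by rewrite expr0n.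
    by under eq_fun do rewrite expr2; apply: cvgM; exact: cz.
  apply: le_lt_trans; apply: le_lower_integral => x _ /=; first by rewrite lee_fin sqr_ge0.
  by rewrite lee_fin ler_norm.
- move=> x zx; apply: Om_far; apply: KO; apply: contrapT => /z0 h; move: zx; by rewrite h eqxx.
Qed.

Let admissible_box a b c e : cbox a b c e `<=` Om -> admissible (\1_(cbox a b c e)).
Proof.
move=> SO.
have mS := measurable_cbox a b c e.
have iS : leb2.-integrable setT (EFin \o (\1_(cbox a b c e) : R * R -> R)).
  apply: (@integrable_of_bound _ _ (EFin \o (\1_(cbox a b c e) : R * R -> R))).
  - by apply: measurable_indic; exact: mS.
  - by move=> x; rewrite /= ger0_norm// indicE.
  - rewrite integral_indic// setIT.
    rewrite [X in (X < _)%E](_ : _ = mu `[a, b] * mu `[c, e])%E; last exact: product_measure1E.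
    by rewrite !lebesgue_measure_itv/=; do 2 case: ifP => _; rewrite ?mul0e ?mule0// -!EFinB -EFinM ltry.
split => // [|x].
  have /integrableP[_] := iS.
  apply: le_lt_trans; apply: le_lower_integral => x _ /=; first by rewrite lee_fin sqr_ge0.
  by rewrite lee_fin indicE; case: (_ \in _); rewrite ?expr1n ?expr0n/= ?normr1 ?normr0.
rewrite indicE; case: (boolP (x \in _)) => [|_]; last by rewrite eqxx.
by rewrite inE => /SO/Om_far.
Qed.

Let green_dom s x zx : zx != 0 :> R -> (zx != 0 -> delta <= enorm x) -> phi s != 0 ->
  `|green d (tau - s) x| <= (pi * delta ^+ 2)^-1.
Proof.
move=> z0 /(_ z0) dx /phi_neq0 ts; rewrite ger0_norm ?green_ge0//.
have x0 := enorm_neq0 (lt_le_trans delta0 dx).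
apply: le_trans (green_le_inv_sqr d0 ts x0) _.
by rewrite lef_pV2 ?posrE ?mulr_gt0 ?exprn_gt0 ?pi_gt0 ?enorm_gt0// ler_pM2l ?pi_gt0// lerXn2r// ?nnegrE ?enorm_ge0// ltW.
Qed.

Lemma coordinate_le c (x : R * R) : `|coordinate c x| <= enorm x.
Proof.
rewrite -sqrtr_sqr /enorm ler_wsqrtr//.
by case: c => /=; rewrite ?lerDl ?lerDr sqr_ge0.
Qed.

Let grad_green_dom c s x zx : zx != 0 :> R -> (zx != 0 -> delta <= enorm x) -> phi s != 0 ->
  `|coordinate c (grad (green d (tau - s)) x)| <= 8 * expR (-2) / (pi * delta ^+ 3).
Proof.
move=> z0 /(_ z0) dx /phi_neq0 ts; apply: le_trans (coordinate_le _ _) _.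
have x0 := enorm_neq0 (lt_le_trans delta0 dx).
apply: le_trans (enorm_grad_green_le d0 ts x0) _.
rewrite ler_pM2l ?mulr_gt0 ?expR_gt0//.
by rewrite lef_pV2 ?posrE ?mulr_gt0 ?exprn_gt0 ?pi_gt0 ?enorm_gt0// ler_pM2l ?pi_gt0// lerXn2r// ?nnegrE ?enorm_ge0// ltW.
Qed.

Let G0 z : 0 <= green d tau z. Proof. by apply: green_ge0 => //; exact: ltW. Qed.
Let GM z : green d tau z <= (4 * pi * d * tau)^-1. Proof. by apply: green_le => //; exact: ltW. Qed.
Let iG : (\int[leb2]_z (green d tau z)%:E < +oo)%E. Proof. by rewrite integral_green// ltry. Qed.

Let mgreen_grad c : measurable_fun setT (fun w : (R * R) * R => coordinate c (grad (green d (tau - w.2)) w.1)).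
Proof.
have [h1 h2] := @measurable_grad_green_joint R d tau.
by case: c; [exact: h1|exact: h2].
Qed.

Let initial_integrable c zeta : admissible zeta ->
  leb2.-integrable setT (fun x => (initial_part c x * zeta x)%:E).
Proof.
move=> tz; have [_ z2 _] := tz.
exact: (conv_mul_integrable (@measurable_green _ d tau) (mg0 c) (admissible_measurable tz) G0 GM iG (g02 c) z2).
Qed.

Let source_integrable c zeta : admissible zeta ->
  leb2.-integrable setT (fun x => (source_part c x * zeta x)%:E).
Proof.
move=> [iz _ zd]; under eq_fun do rewrite sourceE.
apply: (kernel_mul_integrable (mgreen_grad c) iphiT iz) => x s zx.
exact: (grad_green_dom c zx (zd x)).
Qed.


Let continuous_coordinate c (w : R * R -> R * R) : continuous w -> continuous (fun x => coordinate c (w x)).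
Proof.
by case: c => cw x; [apply: (continuous_comp (f := w) (g := fst)); [exact: cw|exact: continuous2_fst]
  |apply: (continuous_comp (f := w) (g := snd)); [exact: cw|exact: continuous2_snd]].
Qed.

Let coordinate0 c : coordinate c 0 = 0 :> R. Proof. by case: c. Qed.

Let admissible_eta eta : C1c Om eta -> admissible eta.
Proof.
move=> Ce; have [_ _ [K [cK KO e0]]] := Ce.
exact: (admissible_cc cK KO (C1_continuous (C1c_C1 Ce)) e0).
Qed.

Let admissible_grad c eta : C1c Om eta -> admissible (fun x => coordinate c (grad eta x)).
Proof.
move=> Ce; have [_ cg _] := Ce; have [K [cK KO _ ge0]] := C1c_grad_out Ce.
apply: (admissible_cc cK KO) => [|x /ge0 ->//]; exact: continuous_coordinate.
Qed.

Let ibp c v eta U : C1 v -> C1c U eta ->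
  \int[leb2]_x (v x * coordinate c (grad eta x)) = - (\int[leb2]_x (coordinate c (grad v x) * eta x)).
Proof.
move=> Cv Ce; have [h1 h2] := C1_integration_by_parts Cv Ce.
by case: c; [exact: h1|exact: h2].
Qed.

Let sobolev_ibp c U u g eta : sobolev1 U u g -> C1c U eta ->
  \int[leb2]_(x in U) (u x * coordinate c (grad eta x)) = - (\int[leb2]_(x in U) (coordinate c (g x) * eta x)).
Proof. by move=> [_ _ _ h] /h[h1 h2]; case: c; [exact: h1|exact: h2]. Qed.

Let int_eq0 (f g : R * R -> R) : f =1 g -> \int[leb2]_x f x = \int[leb2]_x g x.
Proof. by move=> fg; apply: eq_Rintegral => x _. Qed.

Let initial_ibp c eta : C1c Om eta ->
  \int[leb2]_x ((\int[leb2]_z (green d tau z * u0 (x + z))) * coordinate c (grad eta x)) =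
  \int[leb2]_x (initial_part c x * - eta x).
Proof.
move=> Ce.
have te := admissibleN (admissible_eta Ce); have tg := admissible_grad c Ce.
have [_ e2 _] := te; have [_ ge2 _] := tg.
have mg := @measurable_green R d tau.
rewrite (conv_fubini mg mu0 (admissible_measurable tg) G0 GM iG u02 ge2).
rewrite (conv_fubini mg (mg0 c) (admissible_measurable te) G0 GM iG (g02 c) e2).
apply: eq_Rintegral => z _; congr (_ * _).
have [Cez gez] := C1c_translate z Ce.
have h := sobolev_ibp c Su0 Cez; rewrite gez in h.
have mz (f : R * R -> R) : measurable_fun setT f -> measurable_fun setT (fun y : R * R => f (y - z)).
  by move=> mf; exact: (measurableT_comp mf (measurable_addr (- z))).
rewrite -(@Rintegral_translate _ (fun y => u0 y * coordinate c (grad eta (y - z))) z) in h; last first.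
  by apply: measurable_funM => //; apply: (mz (fun x => coordinate c (grad eta x))); exact: admissible_measurable.
rewrite -(@Rintegral_translate _ (fun y => coordinate c (g0 y) * eta (y - z)) z) in h; last first.
  by apply: measurable_funM => //; apply: mz; exact: (admissible_measurable (admissible_eta Ce)).
rewrite (@int_eq0 _ (fun x => u0 (x + z) * coordinate c (grad eta (x + z - z)))); last by move=> x; rewrite addrK.
rewrite h -mulN1r -RintegralZl//; last first.
  rewrite (_ : EFin \o _ = (fun x : R * R => (coordinate c (g0 (x + z)) * eta x)%:E)); last first.
    by apply/funext => x /=; rewrite addrK.
  apply: (translate_mul_integrable (mg0 c) (admissible_measurable (admissible_eta Ce)) (g02 c)).
  by have [] := admissible_eta Ce.
by apply: eq_Rintegral => x _; rewrite addrK mulN1r mulrN.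
Qed.

Let source_ibp c eta : C1c Om eta ->
  \int[leb2]_x ((\int[mu]_s (green d (tau - s) x * phi s)) * coordinate c (grad eta x)) =
  \int[leb2]_x (source_part c x * - eta x).
Proof.
move=> Ce.
have te := admissibleN (admissible_eta Ce); have tg := admissible_grad c Ce.
have [ie _ ed] := te; have [ig _ gd] := tg.
under [RHS]eq_Rintegral do rewrite sourceE.
rewrite (kernel_fubini (@measurable_green_joint R d tau) iphiT ig (fun x s zx => green_dom zx (gd x))).
rewrite (kernel_fubini (mgreen_grad c) iphiT ie (fun x s zx => grad_green_dom c zx (ed x))).
apply: eq_Rintegral => s _.
have Cg := @C1_green R d (tau - s).
have [K [cK _ e0 ge0]] := C1c_grad_out Ce.
have cg := @continuous_coordinate c _ (C1c_C1 Ce).2.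
have cgr := @continuous_coordinate c _ Cg.2.
have ce := C1_continuous (C1c_C1 Ce).
rewrite (@int_eq0 _ (fun x => phi s * (green d (tau - s) x * coordinate c (grad eta x)))); last first.
  by move=> x; rewrite mulrCA mulrA.
rewrite RintegralZl//; last first.
  apply: (cc_integrable cK) => [x|x /ge0 ->]; last by rewrite coordinate0 mulr0.
  by apply: cvgM; [exact: continuous_green|exact: cg].
rewrite (ibp c Cg Ce).
rewrite mulrN -mulNr -RintegralZl//; last first.
  apply: (cc_integrable cK) => [x|x /e0 ->]; last by rewrite mulr0.
  by apply: cvgM; [exact: cgr|exact: ce].
by apply: eq_Rintegral => x _; ring.
Qed.

(** Both terms are paired with the derivative of a test function. In the
    initial term Fubini leaves a pairing of u0 with a translated test function,
    to which the weak gradient of u0 applies; in the source term it leaves the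
    kernel at a fixed time, which is C^1. The weak gradient being unique, it is
    the sum of the two results. *)
Lemma mild_solution_gradient g : sobolev1 Om (mild_solution d u0 phibar tau) g -> forall c,
  {ae leb2, forall x, Om x -> coordinate c (g x) = initial_part c x + source_part c x}.
Proof.
move=> Sg c.
pose w x := coordinate c (g x) - (initial_part c x + source_part c x).
have mOm := open_measurable2 oOm.
have g2 : (\int[leb2]_(x in Om) (coordinate c (g x) ^+ 2)%:E < +oo)%E.
  case: Sg => _ h1 h2 _; case: c w => w; [have h := L2_sqr_lty h1|have h := L2_sqr_lty h2].
    exact: h.
  exact: h.
pose gr x := coordinate c ((g \_ Om) x).
have mgr : measurable_fun setT gr.
  have -> : gr = (fun x => coordinate c (g x)) \_ Om.
    by apply/funext => x; rewrite /gr !patchE; case: ifP => // _; rewrite coordinate0.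
  case: Sg => _ h1 h2 _; have k1 := L2_measurable_restrict h1; have k2 := L2_measurable_restrict h2.
  by case: (c); [exact: k1|exact: k2].
have gr2 : (\int[leb2]_x (gr x ^+ 2)%:E < +oo)%E.
  apply: le_lt_trans g2; rewrite [leRHS]integral_mkcond; apply: le_lower_integral => x _.
    by rewrite lee_fin sqr_ge0.
  by rewrite /gr !patchE; case: ifP => _//; rewrite coordinate0 expr0n.
have admissible_out zeta x : (forall y, zeta y != 0 -> Om y) -> coordinate c (g x) * zeta x = gr x * zeta x.
  move=> zO; have [->|/zO Ox] := eqVneq (zeta x) 0; first by rewrite !mulr0.
  by rewrite /gr patchE mem_set.
have iw zeta : admissible zeta -> (forall y, zeta y != 0 -> Om y) ->
    leb2.-integrable setT (fun x => (coordinate c (g x) * zeta x)%:E).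
  move=> tz zO; have [_ z2 _] := tz.
  have mz := admissible_measurable tz.
  rewrite (_ : (fun x => _) = EFin \o (fun x => gr x * zeta x)); last first.
    by apply/funext => x /=; rewrite admissible_out.
  apply: (@integrable_of_bound _ _ (fun x => 1%:E * (gr x ^+ 2)%:E + 1%:E * (zeta x ^+ 2)%:E)%E).
  - exact: measurable_funM.
  - by move=> x; rewrite !mul1e -EFinD lee_fin normM_le_sqr.
  rewrite (@ge0_integral_lincomb _ _ _ leb2 setT (fun x => (gr x ^+ 2)%:E) (fun x => (zeta x ^+ 2)%:E))//.
  + by rewrite !mul1e lte_add_pinfty.
  + by move=> x _; rewrite lee_fin sqr_ge0.
  + by move=> x _; rewrite lee_fin sqr_ge0.
  + by apply/measurable_EFinP; exact: measurable_funX.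
  + by apply/measurable_EFinP; exact: measurable_funX.
suff : {ae leb2, forall x, Om x -> w x = 0}.
  apply: (@filterS _ _ (ae_filter_ringOfSetsType leb2)) => x h Ox; have /eqP := h Ox; rewrite subr_eq0 => /eqP; exact.
have wE zeta x : w x * zeta x =
    coordinate c (g x) * zeta x - (initial_part c x * zeta x + source_part c x * zeta x).
  by rewrite /w; ring.
have int_Om (f zeta : R * R -> R) : (forall y, zeta y != 0 -> Om y) ->
    \int[leb2]_(x in Om) (f x * zeta x) = \int[leb2]_x (f x * zeta x).
  move=> zO; rewrite Rintegral_mkcond; apply: int_eq0 => x; rewrite patchE; case: ifPn => // /negP nx.
  have [->|/zO Ox] := eqVneq (zeta x) 0; first by rewrite mulr0.
  by case: nx; rewrite inE.
apply: fundamental_lemma => // [a b c' e SO|eta Ce].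
  have tS := admissible_box SO.
  have SOm y : (\1_(cbox a b c' e) y : R) != 0 -> Om y.
    by rewrite indicE; case: (boolP (y \in _)) => [|_]; rewrite ?eqxx// inE => /SO.
  have iS := integrableB measurableT (iw _ tS SOm)
    (integrableD measurableT (initial_integrable c tS) (source_integrable c tS)).
  have mS := measurable_cbox a b c' e.
  have := proj2 (@integrable_mkcond _ _ _ leb2 _ (EFin \o w) mS); apply.
  move: iS; apply: eq_integrable; first exact: measurableT.
  move=> x _; rewrite !patchE indicE; case: (boolP (x \in _)) => xS.
    by rewrite !mulr1 /=.
  by rewrite !mulr0 adde0 sube0.
have [K [cK KO e0 ge0]] := C1c_grad_out Ce.
have eO y : eta y != 0 -> Om y.
  by move=> ey; apply: KO; apply: contrapT => /e0 h; move: ey; rewrite h eqxx.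
have geO y : coordinate c (grad eta y) != 0 -> Om y.
  by move=> ey; apply: KO; apply: contrapT => /ge0 h; move: ey; rewrite h coordinate0 eqxx.
have te := admissible_eta Ce; have tg := admissible_grad c Ce.
have teN := admissibleN te.
rewrite int_Om// (int_eq0 (wE eta)).
have ii := integrableD measurableT (initial_integrable c te) (source_integrable c te).
rewrite (RintegralB measurableT (iw _ te eO) ii).
rewrite (RintegralD measurableT (initial_integrable c te) (source_integrable c te)).
have := sobolev_ibp c Sg Ce; rewrite !int_Om//.
rewrite (@int_eq0 _ (fun x => (\int[leb2]_z (green d tau z * u0 (x + z))) * coordinate c (grad eta x) +
  (\int[mu]_s (green d (tau - s) x * phi s)) * coordinate c (grad eta x))); last first.
  by move=> x; rewrite mildE mulrDl.
have [ig ge2 gd] := tg.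
have i1 := conv_mul_integrable (@measurable_green R d tau) mu0 (admissible_measurable tg) G0 GM iG u02 ge2.
have i2 := kernel_mul_integrable (@measurable_green_joint R d tau) iphiT ig (fun x s zx => green_dom zx (gd x)).
rewrite (RintegralD measurableT i1 i2) initial_ibp// source_ibp//.
have intN (f : R * R -> R) : leb2.-integrable setT (EFin \o (fun x => f x * eta x)) ->
    \int[leb2]_x (f x * - eta x) = - (\int[leb2]_x (f x * eta x)).
  move=> fi; rewrite -mulN1r -RintegralZl//; apply: int_eq0 => x; ring.
rewrite (intN _ (initial_integrable c te)) (intN _ (source_integrable c te)) => h.
by apply/eqP; rewrite subr_eq0 -eqr_opp -h opprD.
Qed.

End mild_gradient.

(** * The contribution of the initial data *)

Section heat_norms.
Context {R : realType}.
Implicit Types (d t q : R) (x : R * R).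

(** Cauchy-Schwarz against the vector of the integrals themselves. *)
Lemma enorm_Rintegral_le dd (X : measurableType dd) (m : {measure set X -> \bar R})
    (D : set X) (f1 f2 : X -> R) (h : X -> \bar R) : measurable D ->
  m.-integrable D (EFin \o f1) -> m.-integrable D (EFin \o f2) ->
  measurable_fun D h -> (forall y, D y -> ((enorm (f1 y, f2 y))%:E <= h y)%E) ->
  ((enorm (\int[m]_(y in D) f1 y, \int[m]_(y in D) f2 y))%:E <= \int[m]_(y in D) h y)%E.
Proof.
move=> mD i1 i2 mh fh.
set e := (_, _); set N := enorm e.
have h0 y : D y -> (0 <= h y)%E.
  by move=> Dy; apply: le_trans (fh y Dy); rewrite lee_fin enorm_ge0.
have [N0|N0] := eqVneq N 0; first by rewrite N0; exact: integral_ge0.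
have Np : 0 < N by rewrite lt0r N0 enorm_ge0.
have j1 : m.-integrable D (EFin \o (fun y => e.1 * f1 y)) by exact: (integrableZl mD e.1 i1).
have j2 : m.-integrable D (EFin \o (fun y => e.2 * f2 y)) by exact: (integrableZl mD e.2 i2).
have : ((N * N)%:E <= N%:E * \int[m]_(y in D) h y)%E.
  rewrite -ge0_integralZl//; last by rewrite lee_fin ltW.
  have -> : N * N = \int[m]_(y in D) (e.1 * f1 y + e.2 * f2 y).
    by rewrite RintegralD// !RintegralZl// -expr2 enorm_sqr !expr2.
  have j := integrableD mD j1 j2.
  rewrite /Rintegral fineK; last exact: integrable_fin_num.
  apply: (le_trans (lee_abs _)); apply: (le_trans (le_abse_integral _ _ _)) => //.
    exact: measurable_int j.
  apply: le_lower_integral => y Dy //.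
  apply: (@le_trans _ _ (N * enorm (f1 y, f2 y))%:E); last first.
    by rewrite EFinM lee_pmul2l ?lte_fin// fh.
  have hd : `|dot e (f1 y, f2 y)| <= N * enorm (f1 y, f2 y).
    rewrite ler_norml dot_le_enorm andbT lerNl.
    have := @dot_le_enorm _ (- e) (f1 y, f2 y); rewrite enormN; apply: le_trans.
    by rewrite /dot/= opprD !mulNr.
  by rewrite lee_fin; exact: hd.
by rewrite EFinM lee_pmul2l// lte_fin.
Qed.

(** The norm of the heat kernel in L^q of the plane. *)
Definition heat_norm d q t : R := ((4 * pi * d * t) `^ (1 - q) / q) `^ (q^-1).

Lemma green_powR d q t x : 0 < d -> 0 < q -> 0 < t ->
  green d t x `^ q = (4 * pi * d * t) `^ (1 - q) / q * green d (t / q) x.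
Proof.
move=> d0 q0 t0; rewrite /green.
have a0 : 0 < 4 * pi * d * t by rewrite !mulr_gt0// pi_gt0.
rewrite (_ : 4 * pi * d * (t / q) = (4 * pi * d * t) / q); last by rewrite mulrA.
move: (4 * pi * d * t) a0 => a a0.
set w := - (enorm x ^+ 2 / (4 * d * t)).
rewrite (_ : - (enorm x ^+ 2 / (4 * d * (t / q))) = q * w); last by rewrite /w; field; rewrite !lt0r_neq0.
rewrite /powR !gt_eqF ?mulr_gt0 ?invr_gt0 ?expR_gt0//.
rewrite lnM ?posrE ?invr_gt0 ?expR_gt0// lnV ?posrE// expRK.
rewrite mulrDr expRD mulrBl mul1r expRD lnK ?posrE// mulrN.
by field; rewrite !lt0r_neq0.
Qed.

Lemma Lnorm_green d q t x : 0 < d -> 0 < q -> 0 < t ->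
  ('N[leb2]_q%:E[EFin \o (fun y => green d t (y - x)%R)] = (heat_norm d q t)%:E)%E.
Proof.
move=> d0 q0 t0; rewrite Lnorm.unlock /heat_norm -poweR_EFin; congr (poweR _ _).
have tq : 0 < t / q by rewrite divr_gt0.
have K0 : 0 <= (4 * pi * d * t) `^ (1 - q) / q by rewrite divr_ge0 ?powR_ge0// ltW.
under eq_integral => y _.
  rewrite /= ger0_norm; last by apply: green_ge0 => //; exact: ltW.
  rewrite green_powR// EFinM; over.
rewrite ge0_integralZl//; last 2 first.
- by apply/measurable_EFinP; exact: (measurableT_comp (@measurable_green _ d (t / q)) (measurable_addr (- x))).
- by move=> y _; rewrite lee_fin green_ge0// ltW.
have mG : measurable_fun setT (fun y => (green d (t / q) y)%:E).
  by apply/measurable_EFinP; exact: measurable_green.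
have G0 y : (0 <= (green d (t / q) y)%:E)%E by rewrite lee_fin green_ge0// ltW.
have h := etrans (leb2_translate (- x) mG G0) (integral_green d0 tq).
exact: etrans (congr1 (fun z => (_ * z)%E) h) (mule1 _).
Qed.

Lemma heat_norm_ge0 d q t : 0 <= heat_norm d q t.
Proof. exact: powR_ge0. Qed.

Lemma heat_norm_sqr d q t : 0 < d -> 0 < q -> 0 < t ->
  heat_norm d q t ^+ 2 = heat_norm d q 1 ^+ 2 * t `^ (2 / q - 2).
Proof.
move=> d0 q0 t0; have p0 := @pi_gt0 R.
rewrite /heat_norm mulr1; move: (@pi R) p0 => P p0.
have a0 : 0 < 4 * P * d by rewrite !mulr_gt0.
move: (4 * P * d) a0 => a a0; have A0 : 0 <= a `^ (1 - q) / q by rewrite divr_ge0 ?powR_ge0// ltW.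
rewrite (powRM _ (ltW a0) (ltW t0)) mulrAC (powRM _ A0 (powR_ge0 _ _)) exprMn; congr (_ * _).
rewrite -powRrM -(@powR_mulrn _ (t `^ _)) ?powR_ge0// -powRrM; congr (_ `^ _).
by field; rewrite lt0r_neq0.
Qed.

Lemma hoelder_conjugate_bounds (p : \bar R) : (2%:E < p)%E ->
  1 <= fine (hoelder_conjugate p) < 2.
Proof.
case: p => [p| |]//=; last by move=> _; rewrite lexx /= ltr1n.
rewrite lte_fin /hoelder_conjugate/= => p2.
rewrite eqe gt_eqF; last exact: lt_trans p2.
rewrite -EFinB inver subr_eq0 gt_eqF; last by apply: lt_trans p2; rewrite ltr1n.
rewrite /= ler_pdivlMr ?ltr_pdivrMr ?subr_gt0; try lra.
Qed.

End heat_norms.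

Section initial_part_bound.
Context {R : realType}.
Variables (d tau : R) (u0 : R * R -> R) (g0 : R * R -> R * R).
Hypotheses (d0 : 0 < d) (tau0 : 0 < tau).
Hypothesis Sg : sobolev1 setT u0 g0.

Let m1 : measurable_fun setT (fun x => (g0 x).1).
Proof. by case: Sg => _ h1 h2 _; exact: (@L2_measurable _ _ _ leb2 _ _ measurableT h1). Qed.
Let m2 : measurable_fun setT (fun x => (g0 x).2).
Proof. by case: Sg => _ h1 h2 _; exact: (@L2_measurable _ _ _ leb2 _ _ measurableT h2). Qed.

Let me : measurable_fun setT (enorm \o g0).
Proof.
apply: (measurableT_comp (continuous_measurable2 continuous_enorm)).
rewrite (_ : g0 = (fun x => ((g0 x).1, (g0 x).2))); last by apply/funext => x; case: (g0 x).
exact: measurable_fun_pair.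
Qed.

(** The norm of the weighted mean is at most the weighted mean of the norm, to
    which Hoelder's inequality applies with the heat kernel in L^q. For p = +oo
    the heat kernel has mass 1 and the essential supremum comes out. *)
Lemma initial_part_le p x (q := fine (hoelder_conjugate p)) : (2%:E < p)%E ->
  ((enorm (initial_part d tau g0 true x, initial_part d tau g0 false x))%:E <=
   (heat_norm d q tau)%:E * 'N[leb2]_p[EFin \o (enorm \o g0)])%E.
Proof.
move=> p2; have /andP[q1 q2] := hoelder_conjugate_bounds p2; rewrite -/q in q1 q2.
have q0 : 0 < q by apply: lt_le_trans q1.
have mg := @measurable_green R d tau.
have G0 z : 0 <= green d tau z by apply: green_ge0 => //; exact: ltW.
have GM z : green d tau z <= (4 * pi * d * tau)^-1 by apply: green_le => //; exact: ltW.
have iG : (\int[leb2]_z (green d tau z)%:E < +oo)%E by rewrite integral_green// ltry.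
have i1 := @conv_integrable R (green d tau) (fun x => (g0 x).1) _ mg m1 G0 GM iG (L2_sqr_lty (let: And4 _ h _ _ := Sg in h)) x.
have i2 := @conv_integrable R (green d tau) (fun x => (g0 x).2) _ mg m2 G0 GM iG (L2_sqr_lty (let: And4 _ _ h _ := Sg in h)) x.
pose F y := (green d tau (y - x) * enorm (g0 y))%:E.
have mgx : measurable_fun setT (fun y : R * R => green d tau (y - x)).
  exact: (measurableT_comp mg (measurable_addr (- x))).
have mF : measurable_fun setT F by apply/measurable_EFinP; exact: measurable_funM.
have F0 y : (0 <= F y)%E by rewrite lee_fin mulr_ge0// enorm_ge0.
apply: (@le_trans _ _ (\int[leb2]_y F y)%E).
  rewrite -(leb2_translate x mF F0).
  apply: (enorm_Rintegral_le _ i1 i2) => //.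
    exact: (measurableT_comp mF (measurable_addr x)).
  move=> z _; rewrite /F lee_fin addrK addrC.
  rewrite (_ : (_, _) = green d tau z *: g0 (z + x)); last first.
    by rewrite addrC; case: (g0 _).
  by rewrite enormZ ger0_norm.
have N1 : (\int[leb2]_y F y = 'N[leb2]_1[EFin \o ((fun y => green d tau (y - x)%R) \* (enorm \o g0))%R])%E.
  rewrite Lnorm1; apply: eq_integral => y _ /=.
  by rewrite ger0_norm// mulr_ge0// enorm_ge0.
case: p p2 @q q1 q2 q0 => [p| |]// p2 q q1 q2 q0.
  have p2r : 2 < p by rewrite -lte_fin.
  have p0 : 0 < p by apply: lt_trans p2r.
  have pq : q^-1 + p^-1 = 1.
    rewrite /q /hoelder_conjugate/= eqe gt_eqF// -EFinB inver subr_eq0 gt_eqF ?(lt_trans _ p2r) ?ltr1n//=.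
    have p1 : p - 1 != 0 by rewrite subr_eq0 gt_eqF// (lt_trans _ p2r)// ltr1n.
    by field; rewrite p1 lt0r_neq0.
  rewrite N1 -(@Lnorm_green R d q tau x)//.
  exact: hoelder.
have q1E : q = 1 by [].
have T0 : (0 < leb2 [set: R * R])%E.
  rewrite lt0e measure_ge0 andbT; apply/eqP => T0.
  have := @integral_green R d tau d0 tau0.
  rewrite null_set_integral//; last exact/measurable_EFinP.
  by move=> /eqP; rewrite eqe eq_sym oner_eq0.
set N := Lnorm _ _ _.
have N0 : (0 <= N)%E by exact: Lnorm_ge0.
have aeN : {ae leb2, forall y, setT y -> (F y <= (green d tau (y - x))%:E * N)%E}.
  have := ess_sup_ge leb2 (abse \o (EFin \o (enorm \o g0))).
  rewrite (_ : ess_sup _ _ = N); last by rewrite /N Lnorm.unlock /= T0.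
  apply: (@filterS _ _ (ae_filter_ringOfSetsType leb2)) => y /= h _.
  rewrite /F EFinM lee_wpmul2l ?lee_fin//; apply: le_trans h.
  by rewrite lee_fin ler_norm.
apply: (@le_trans _ _ (\int[leb2]_y ((green d tau (y - x))%:E * N))%E).
  apply: ae_le_lower_integral => //.
  - by apply: emeasurable_funM => //; exact/measurable_EFinP.
  - by move=> y _; rewrite mule_ge0// lee_fin.
rewrite ge0_integralZr//; last 2 first.
- exact/measurable_EFinP.
- by move=> y _; rewrite lee_fin.
rewrite lee_pmul//.
  by apply: integral_ge0 => y _; rewrite lee_fin.
have := Lnorm_green x d0 q0 tau0; rewrite q1E Lnorm1 => <-.
by apply: le_lower_integral => y _ /=; rewrite ?lee_fin// ger0_norm.
Qed.

End initial_part_bound.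

(** * The flux at a fixed time *)

Section flux_bound.
Context {R : realType}.
Local Notation mu := (@lebesgue_measure R).
Implicit Types (x : R * R).

(** The slope of the kernel is bounded uniformly in time, which leaves the L^1
    norm of phibar. *)
Lemma source_part_le (d tau : R) (phibar : R -> R) x : 0 < d -> x != 0 ->
  mu.-integrable `[0, tau] (EFin \o phibar) ->
  ((enorm (source_part d tau phibar true x, source_part d tau phibar false x))%:E <=
   (green_slope x)%:E * \int[mu]_(s in `[0%R, tau]) `|phibar s|%:E)%E.
Proof.
move=> d0 x0 ip; have S0 := ltW (green_slope_gt0 x0).
have mp : measurable_fun `[0, tau]%classic phibar.
  by apply/measurable_EFinP; exact: measurable_int ip.
have mI : measurable (`[0, tau]%classic : set (measurableTypeR R)) by exact: measurable_itv.
have ian : mu.-integrable `[0, tau] (fun s => ((green_slope x)%:E * `|phibar s|%:E)%E).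
  have := integrableZl mI (green_slope x) (integrable_abse ip).
  by apply: eq_integrable => // s _; rewrite /= abse_EFin.
have [mg1 mg2] := @measurable_grad_green_joint R d tau.
have slope s : `[0, tau]%classic s -> enorm (grad (green d (tau - s)) x) <= green_slope x.
  by rewrite /= in_itv/= => /andP[_ st]; apply: enorm_grad_green_le => //; rewrite subr_ge0.
have i c : mu.-integrable `[0, tau] (EFin \o (fun s => coordinate c (grad (green d (tau - s)) x) * phibar s)).
  apply: (le_integrable mI _ _ ian).
    apply/measurable_EFinP; apply: measurable_funM => //; apply: measurable_funTS.
    have mp2 : measurable_fun setT (fun s : R => (x, s)) by exact: measurable_fun_pair.
    by case: c; [exact: (measurableT_comp mg1 mp2)|exact: (measurableT_comp mg2 mp2)].
  move=> s Is /=; rewrite lee_fin normrM [leRHS]ger0_norm; last exact: mulr_ge0 S0 (normr_ge0 _).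
  by rewrite ler_wpM2r//; exact: le_trans (coordinate_le _ _) (slope s Is).
have ma : measurable_fun `[0, tau]%classic (fun s => `|phibar s|%:E).
  by apply/measurable_EFinP; exact: measurableT_comp.
have E := ge0_integralZl mu mI ma (fun s _ => normr_ge0 (phibar s) : (0 <= `|phibar s|%:E)%E) (S0 : (0 <= (green_slope x)%:E)%E).
have mS : measurable_fun `[0, tau]%classic (fun s => (green_slope x)%:E * `|phibar s|%:E)%E.
  by case/integrableP : ian.
rewrite -E; apply: (enorm_Rintegral_le mI (i true) (i false) mS).
move=> s Is; rewrite -EFinM lee_fin.
have vec (v : R * R) (r : R) : (coordinate true v * r, coordinate false v * r) = r *: v.
  by case: v => a b; congr (_, _); exact: mulrC.
rewrite vec enormZ mulrC; apply: ler_wpM2r => //; exact: slope.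
Qed.

Lemma outward_unit_normal_enorm U x nu : outward_unit_normal U x nu -> enorm nu = 1.
Proof.
move=> [r [e [f [[r0 e1 _ _] ->]]]] /=.
set c := derive1 f _; clearbody c.
have c0 : 0 < 1 + c ^+ 2 by rewrite ltr_wpDr// sqr_ge0.
have E : enorm (c *: e - rot90 e) = Num.sqrt (1 + c ^+ 2).
  rewrite /enorm; congr Num.sqrt.
  have := enorm1_sqr e1; case: e e1 => a b _ /= ab; rewrite /GRing.scale/=.
  by transitivity ((a ^+ 2 + b ^+ 2) * (1 + c ^+ 2)); [ring|rewrite ab mul1r].
rewrite enormZ E ger0_norm ?invr_ge0 ?sqrtr_ge0// mulVf//.
by rewrite lt0r_neq0// sqrtr_gt0.
Qed.

Lemma boundary_neq0 (O : set (R * R)) x : open O -> O 0 -> topological_boundary O x -> x != 0.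
Proof. by move=> oO O0 [_ niO]; apply: contra_notN niO => /eqP ->; rewrite (interior_id O).1. Qed.

Section fixed_time.
Variables (d tau : R) (u0 : R * R -> R) (g0 : R * R -> R * R) (phibar : R -> R).
Variables (O : set (R * R)) (n : R * R -> R * R) (psi : R * R -> R) (A B : R).
Let G := topological_boundary O.
Let Om := ~` closure O.
Hypotheses (d0 : 0 < d) (tau0 : 0 < tau).
Hypotheses (oO : open O) (O0 : O 0) (C2O : C2_boundary O).
Hypothesis nG : forall x, G x -> outward_unit_normal Om x (n x).
Hypothesis Su0 : sobolev1 setT u0 g0.
Hypothesis iphi : mu.-integrable `[0, tau] (EFin \o phibar).
Hypotheses (A0 : 0 <= A) (B0 : 0 <= B).
Hypothesis HA : forall x, enorm (initial_part d tau g0 true x, initial_part d tau g0 false x) <= A.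
Hypothesis HB : (\int[mu]_(s in `[0%R, tau]) `|phibar s|%:E <= B%:E)%E.

Let O_ball : exists2 delta, 0 < delta & forall x, enorm x < delta -> O x.
Proof.
have /nbhs_ballP[r /= r0 rO] := open_nbhs_nbhs (conj oO O0).
exists r => // x xr; apply: rO; rewrite -ball_normE /= sub0r normrN prod_normE gt_max.
have h1 := coordinate_le true x; have h2 := coordinate_le false x.
by rewrite (le_lt_trans h1)//= (le_lt_trans h2).
Qed.

Let Gn0 x : G x -> x != 0 := boundary_neq0 oO O0.

Let gradient_le (g : R * R -> R * R) : sobolev1 Om (mild_solution d u0 phibar tau) g ->
  {ae leb2, forall x, Om x -> enorm (g x) <= A + green_slope x * B}.
Proof.
move=> Sg; have [delta dl0 dO] := O_ball.
have oOm : open Om by apply: closed_openC; exact: closed_closure.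
have Om_far x : Om x -> delta <= enorm x.
  by move=> Ox; rewrite leNgt; apply/negP => /dO/subset_closure.
have ag := mild_solution_gradient d0 tau0 dl0 oOm Om_far Su0 iphi Sg.
have ag1 := ag true; have ag2 := ag false.
move: ag1 ag2; apply: (@filterS2 _ _ (ae_filter_ringOfSetsType leb2)) => x h1 h2 Ox.
have x0 := enorm_neq0 (lt_le_trans dl0 (Om_far x Ox)).
rewrite (_ : g x = (initial_part d tau g0 true x, initial_part d tau g0 false x) +
   (source_part d tau phibar true x, source_part d tau phibar false x)); last first.
  by move: (h1 Ox) (h2 Ox); rewrite /coordinate; case: (g x) => a b /= -> ->.
apply: le_trans (enormD_le _ _) _; apply: lerD; first exact: HA.
rewrite -lee_fin EFinM; apply: le_trans (source_part_le d0 x0 iphi) _.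
by rewrite lee_pmul2l// lte_fin green_slope_gt0.
Qed.

(** The bound on the gradient is continuous in x near the boundary, which stays
    away from the origin. So near each boundary point the gradient is bounded by
    a constant that exceeds the claimed bound by an arbitrarily small amount,
    and such a constant bound passes to the trace. *)
Lemma flux_le : is_normal_flux d Om G n (mild_solution d u0 phibar tau) psi ->
  {ae hausdorff1, forall x, G x ->
    psi x ^+ 2 <= d ^+ 2 * (2 * A ^+ 2 + 2 * (green_slope x ^+ 2 * B ^+ 2))}.
Proof.
move=> [g [h [Sg t1 t2 psiE]]].
have gle := gradient_le Sg.
have key (k : nat) : {ae hausdorff1, forall x, G x ->
    enorm (h x) <= A + (green_slope x + k.+1%:R^-1) * B}.
  pose P x := enorm (h x) <= A + (green_slope x + k.+1%:R^-1) * B.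
  apply: (@ae_local _ _ _ hausdorff1 (fun z => z) G P) => x0 Gx0.
  have x00 := Gn0 Gx0.
  pose eps : R := k.+1%:R^-1 / 2; have eps0 : 0 < eps by rewrite divr_gt0// invr_gt0.
  (* eps is used twice: from x to x0, then from x0 to the points of the ball *)
  have cS : nbhs x0 [set y | `|green_slope x0 - green_slope y| < eps].
    by have /cvgrPdist_lt := @continuous_green_slope R x0 x00; apply.
  have [r [e [f ch]]] := C2O Gx0.
  have [r' r'0 r'S] : exists2 r', 0 < r' & forall y, enorm (y - x0) < r' -> `|green_slope x0 - green_slope y| < eps.
    have /nbhs_ballP[r' /= r'0 rO] := cS.
    exists r' => // y yr; apply: rO; rewrite -ball_normE /= -normrN opprB prod_normE gt_max.
    have h1 := coordinate_le true (y - x0); have h2 := coordinate_le false (y - x0).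
    by rewrite (le_lt_trans h1)//= (le_lt_trans h2).
  have [r0 _ _ _] := ch.
  pose rr := Num.min r r'.
  have rr0 : 0 < rr by rewrite lt_min r0.
  have rrr : rr <= r by rewrite ge_min lexx.
  have chr := graph_chart_shrink rr0 rrr ch.
  pose M := A + (green_slope x0 + eps) * B.
  have M0 : 0 <= M by rewrite addr_ge0// mulr_ge0// addr_ge0 ?ltW// green_slope_gt0.
  have gM : {ae leb2, forall z, Om z -> enorm (z - x0) < rr -> enorm (g z) <= M}.
    apply: (@filterS _ _ (ae_filter_ringOfSetsType leb2)) gle => z gz Oz.
    rewrite lt_min => /andP[_ /r'S zS]; apply: le_trans (gz Oz) _.
    rewrite lerD2l ler_wpM2r//; move: zS; rewrite ltr_norml => /andP[h1 h2]; lra.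
  have hM := trace_bound oO chr M0 t1 t2 gM.
  exists [set y | enorm (y - x0) < rr / 2].
    have rr20 : 0 < rr / 2 by rewrite divr_gt0.
    have /cvgrPdist_lt/(_ _ rr20) := @continuous_enormB R x0 x0; apply: filterS => y /=.
    by rewrite subrr {1}/enorm/= expr0n addr0 sqrtr0 sub0r normrN ger0_norm ?enorm_ge0.
  apply: filterS hM => y hy Gy yr; rewrite /P; apply: le_trans (hy Gy yr) _.
  have : enorm (y - x0) < r'.
    have : rr <= r' by rewrite ge_min lexx orbT.
    by move: yr => /=; lra.
  move=> /r'S; rewrite ltr_norml => /andP[h1 h2].
  rewrite lerD2l ler_wpM2r//; move: h1 h2; rewrite /eps; move: (k.+1%:R^-1) (green_slope _) (green_slope _) => a b c; lra.
have := ae_foralln key; apply: filterS => x hk Gx.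
have hx : enorm (h x) <= A + green_slope x * B.
  apply/ler_addgt0Pr => e e0.
  have eB : 0 < e / (B + 1) by rewrite divr_gt0// ltr_wpDl.
  have [k _ /(_ k (leqnn k)) /= kP] := near_infty_natSinv_lt (PosNum eB).
  apply: le_trans (hk k Gx) _; rewrite -addrA lerD2l mulrDl lerD2l.
  apply: (@le_trans _ _ (e / (B + 1) * B)); first by rewrite ler_wpM2r// ltW.
  by rewrite mulrAC ler_pdivrMr ?ltr_wpDl// ler_pM2l// lerDl.
have S0 := ltW (green_slope_gt0 (Gn0 Gx)).
rewrite psiE// exprMn ler_wpM2l ?sqr_ge0//.
apply: le_trans (dot_sqr_le _ _) _; rewrite (outward_unit_normal_enorm (nG Gx)) expr1n mulr1.
apply: (@le_trans _ _ ((A + green_slope x * B) ^+ 2)).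
  by rewrite lerXn2r// nnegrE ?enorm_ge0// addr_ge0// mulr_ge0.
rewrite -[X in _ + 2 * X]exprMn; move: (green_slope x * B) => b.
by rewrite -subr_ge0 (_ : _ - _ = (A - b) ^+ 2) ?sqr_ge0//; ring.
Qed.

End fixed_time.
End flux_bound.

(** * Integration in time *)

Section time_integrals.
Context {R : realType}.
Local Notation mu := (@lebesgue_measure R).

(** The exponent a - 1 may be negative, so the fundamental theorem of calculus is
    applied on [t / n, t] before n tends to infinity. *)
Lemma integral_powR_le (a t : R) : 0 < a -> 0 < t ->
  (\int[mu]_(s in `[0%R, t]) (s `^ (a - 1))%:E <= (t `^ a / a)%:E)%E.
Proof.
move=> a0 t0.
have mp : measurable_fun setT (fun s : R => (s `^ (a - 1))%:E).
  by apply/measurable_EFinP; exact: measurable_powR.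
rewrite -integral_itv_obnd_cbnd; last exact: measurable_funTS.
pose F n := `[t / n.+2%:R, t]%classic : set R.
have UF : `]0, t]%classic = \bigcup_n F n.
  apply/seteqP; split=> s /=.
    rewrite in_itv/= => /andP[s0 st].
    have st0 : 0 < s / t by rewrite divr_gt0.
    have [k _ /(_ k (leqnn k)) /= kP] := near_infty_natSinv_lt (PosNum st0).
    exists k => //=; rewrite /F/= in_itv/= st andbT.
    apply: (@le_trans _ _ (t / k.+1%:R)); first by rewrite ler_pM2l// lef_pV2 ?posrE// ler_nat.
    by rewrite mulrC -ler_pdivlMr// ltW.
  move=> [k _]; rewrite /F/= !in_itv/= => /andP[ks ->]; rewrite andbT.
  by apply: lt_le_trans ks; rewrite divr_gt0.
rewrite UF.
have ndF : {homo F : n m / (n <= m)%N >-> (n <= m)%O}.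
  move=> n m nm; apply/subsetPset => s; rewrite /F/= !in_itv/= => /andP[h ->]; rewrite andbT.
  by apply: le_trans h; rewrite ler_pM2l// lef_pV2 ?posrE// ler_nat.
have cF : (\int[mu]_(s in F i) (s `^ (a - 1))%:E)%E @[i --> \oo] -->
    (\int[mu]_(s in \bigcup_i F i) (s `^ (a - 1))%:E)%E.
  apply: ge0_nondecreasing_set_cvg_integral => //.
  - by move=> i; exact: measurable_itv.
  - by move=> i; exact: measurable_funTS.
  - by move=> i s _; rewrite lee_fin powR_ge0.
rewrite -(cvg_lim _ cF)//.
apply: lime_le; first by apply/cvg_ex; eexists; exact: cF.
apply: nearW => n.
have tn0 : 0 < t / n.+2%:R by rewrite divr_gt0.
have tnt : t / n.+2%:R < t by rewrite ltr_pdivrMr// ltr_pMr// ltr1n.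
have dP (s : R) : 0 < s -> is_derive s (1 : R) (fun s : R => s `^ a / a) (s `^ (a - 1)).
  move=> s0.
  have sI : s \in `]0, +oo[ by rewrite in_itv/= s0.
  have h : is_derive s (1 : R) (fun s : R => s `^ a) (a * s `^ (a - 1)).
    split; first exact: derivable_powR.
    by rewrite -derive1E powR_derive1.
  have := is_derive_mulr a^-1 h; rewrite mulrAC divff ?mul1r ?lt0r_neq0//.
have cP (s b : R) : 0 < s -> {for s, continuous (fun s : R => s `^ b)}.
  move=> s0; apply: differentiable_continuous; apply/derivable1_diffP; apply: derivable_powR.
  by rewrite in_itv/= s0.
have cF' (s : R) : 0 < s -> {for s, continuous (fun s : R => s `^ a / a)}.
  by move=> s0; apply: cvgM; [exact: cP|exact: cvg_cst].
rewrite (@continuous_FTC2 _ (fun s => s `^ (a - 1)) (fun s => s `^ a / a))//.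
- by rewrite -EFinB lee_fin lerBlDr lerDl divr_ge0 ?powR_ge0// ltW.
- apply: continuous_in_subspaceT => s; rewrite inE/= in_itv/= => /andP[s0 _].
  by apply: cP; exact: lt_le_trans s0.
- split.
  + move=> s; rewrite in_itv/= => /andP[s0 _].
    by have h := dP s (lt_trans tn0 s0); exact: ex_derive.
  + by apply: cvg_at_right_filter; exact: cF'.
  + by apply: cvg_at_left_filter; exact: cF'.
- move=> s; rewrite in_itv/= => /andP[s0 _]; rewrite derive1E.
  by have h := dP s (lt_trans tn0 s0); exact: derive_val.
Qed.

(** |f| <= 1 + f^2 on an interval of finite length. *)
Lemma L2_integrable (T : R) (f : R -> R) : L2 mu (`[0, T]%classic) f ->
  mu.-integrable `[0, T] (EFin \o f).
Proof.
move=> Lf.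
have mI : measurable (`[0, T]%classic : set (measurableTypeR R)) by exact: measurable_itv.
have mf := L2_measurable mI Lf.
have mf2 : measurable_fun `[0, T]%classic (fun s => (f s ^+ 2)%:E).
  by apply/measurable_EFinP; exact: measurable_funX.
apply/integrableP; split; first exact/measurable_EFinP.
apply: (@le_lt_trans _ _ (\int[mu]_(s in `[0%R, T]) (1%:E * (cst 1 s) + 1%:E * (f s ^+ 2)%:E))%E).
  apply: le_lower_integral => s _ //=; rewrite !mul1e -EFinD lee_fin.
  have := sqr_ge0 (`|f s| - 1); rewrite sqrrB1 real_normK ?num_real//.
  have := normr_ge0 (f s); move: (`|f s|) (f s ^+ 2) => a b; lra.
rewrite (@ge0_integral_lincomb _ _ _ mu _ (cst 1%E) (fun s => (f s ^+ 2)%:E))//; last by move=> s _; rewrite lee_fin sqr_ge0.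
rewrite !mul1e lte_add_pinfty//; last exact: L2_sqr_lty.
rewrite integral_cst// mul1e.
have h : (mu `[0%R, T] < +oo)%E.
  by rewrite lebesgue_measure_itv/=; case: ifP => _; rewrite -?EFinB ltry.
exact: h.
Qed.

End time_integrals.

Section sections.
Context {R : realType}.
Variables (T : R) (G : set (R * R)) (phi : R -> R * R -> R).
Hypotheses (mG : measurable G) (fG : (hausdorff1 G < +oo)%E).
Hypothesis mphi : measurable_fun (`[0, T] `*` G) (fun z : R * (R * R) => phi z.1 z.2).

Lemma measurable_section (tau : R) : `[0, T]%classic tau -> measurable_fun G (phi tau).
Proof.
move=> tI.
have mX : measurable ((`[0, T]%classic : set R) `*` G) by exact: measurableX.
apply: (@measurable_comp _ _ _ _ _ _ (`[0, T] `*` G) (fun z : R * (R * R) => phi z.1 z.2) G (fun x => (tau, x))) => //.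
  by move=> _ [x Gx <-].
by apply: measurable_funTS; exact: measurable_fun_pair.
Qed.

(** Tonelli's theorem, for the restriction of length to G, a finite measure. *)
Lemma measurable_L2_sqnorm :
  measurable_fun `[0, T]%classic (fun tau => L2_sqnorm G (phi tau)).
Proof.
have mX : measurable ((`[0, T]%classic : set R) `*` G) by exact: measurableX.
pose F := (fun z : R * (R * R) => (phi z.1 z.2 ^+ 2)%:E) \_ (`[0, T] `*` G).
have mF : measurable_fun setT F.
  apply: ((measurable_restrictT _ mX).1 _); apply/measurable_EFinP; exact: measurable_funX.
have F0 z : (0 <= F z)%E by rewrite /F patchE; case: ifP => // _; rewrite lee_fin sqr_ge0.
pose m2 : {finite_measure set _ -> \bar R} := mfrestr mG fG.
have h := @measurable_fun_fubini_tonelli_F _ _ _ _ R m2 F mF F0.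
apply: (eq_measurable_fun (fubini_F m2 F)); last exact: measurable_funTS h.
move=> tau tI; rewrite /fubini_F.
have E := @ge0_integral_mrestr _ _ _ hausdorff1 _ mG (fun x => F (tau, x)) (fun x => F0 _).
etransitivity; first apply: E.
  by apply: (measurableT_comp mF); exact: measurable_fun_pair.
apply: eq_integral => x Gx; rewrite /F patchE ifT//.
by apply/mem_set; split => /=; exact: set_mem.
Qed.

End sections.

(** * The defect estimate *)

Section defect.
Context {R : realType}.
Local Notation mu := (@lebesgue_measure R).

Lemma C_Gamma_slope (d : R) (G : set (R * R)) : 0 < d -> (forall x, G x -> x != 0) ->
  (C_Gamma d G = \int[hausdorff1]_(x in G) (green_slope x ^+ 2)%:E)%E.
Proof.
move=> d0 G0; apply: eq_integral => x /set_mem Gx.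
by rewrite (sup_enorm_grad_green d0 (G0 _ Gx)) -EFin_expe.
Qed.

(** (a - b)^2 <= 2 a^2 + 2 b^2 yields the constant 2 in front of phi, and a second
    factor 2 from the splitting of the bound on psi yields the 4. *)
Lemma L2_sqnorm_defect_le (d A B : R) (G : set (R * R)) (phi psi : R * R -> R) :
  0 < d -> measurable G -> (forall x, G x -> x != 0) -> measurable_fun G phi ->
  {ae hausdorff1, forall x, G x ->
    psi x ^+ 2 <= d ^+ 2 * (2 * A ^+ 2 + 2 * (green_slope x ^+ 2 * B ^+ 2))} ->
  (L2_sqnorm G (fun x => (phi x - psi x)%R) <=
    2%:E * L2_sqnorm G phi + (4 * d ^+ 2 * A ^+ 2)%:E * hausdorff1 G +
    (4 * d ^+ 2 * B ^+ 2)%:E * C_Gamma d G)%E.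
Proof.
move=> d0 mG G0 mphi psi_le; rewrite C_Gamma_slope//.
have mS : measurable_fun G (fun x => (green_slope x ^+ 2)%:E).
  by apply/measurable_EFinP; apply: measurable_funX; apply: measurable_funTS; exact: measurable_green_slope.
have mp : measurable_fun G (fun x => (phi x ^+ 2)%:E).
  by apply/measurable_EFinP; exact: measurable_funX.
have S0 x : (0 <= (green_slope x ^+ 2)%:E)%E by rewrite lee_fin sqr_ge0.
have p0 x : (0 <= (phi x ^+ 2)%:E)%E by rewrite lee_fin sqr_ge0.
have d20 : 0 <= 4 * d ^+ 2 by apply: mulr_ge0 => //; exact: sqr_ge0.
have c20 : 0 <= 4 * d ^+ 2 * A ^+ 2 by apply: mulr_ge0 => //; exact: sqr_ge0.
have c30 : 0 <= 4 * d ^+ 2 * B ^+ 2 by apply: mulr_ge0 => //; exact: sqr_ge0.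
pose g x := ((4 * d ^+ 2 * A ^+ 2)%:E * cst 1%E x + (4 * d ^+ 2 * B ^+ 2)%:E * (green_slope x ^+ 2)%:E)%E.
have mg : measurable_fun G g.
  by apply: emeasurable_funD; apply: emeasurable_funM.
have g0 x : (0 <= g x)%E by rewrite adde_ge0// mule_ge0// lee_fin.
apply: (@le_trans _ _ (\int[hausdorff1]_(x in G) (2%:E * (phi x ^+ 2)%:E + 1%:E * g x))%E).
  apply: ae_le_lower_integral => //.
  - by apply: emeasurable_funD; apply: emeasurable_funM.
  - by move=> x _; rewrite lee_fin sqr_ge0.
  - by move=> x _; rewrite adde_ge0// mule_ge0.
  apply: filterS psi_le => x h Gx; rewrite mul1e /g /= mule1 -!EFinM -!EFinD lee_fin.
  have := h Gx; move: (phi x) (psi x) (green_slope x) => a b s hb.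
  apply: (@le_trans _ _ (2 * a ^+ 2 + 2 * b ^+ 2)).
    by rewrite -subr_ge0 (_ : _ - _ = (a + b) ^+ 2) ?sqr_ge0//; ring.
  rewrite lerD2l; apply: (@le_trans _ _ (2 * (d ^+ 2 * (2 * A ^+ 2 + 2 * (s ^+ 2 * B ^+ 2))))).
    by rewrite ler_pM2l.
  by rewrite le_eqVlt; apply/orP; left; apply/eqP; ring.
rewrite (@ge0_integral_lincomb _ _ _ hausdorff1 G (fun x => (phi x ^+ 2)%:E) g)//.
rewrite mul1e (@ge0_integral_lincomb _ _ _ hausdorff1 G (cst 1%E) (fun x => (green_slope x ^+ 2)%:E))//.
by rewrite integral_cst// mul1e addeA.
Qed.

End defect.

Theorem theorem6p5 (R : realType) (d : R) (p : \bar R)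
    (d_gt0 : 0 < d) (p_gt2 : (2%:E < p)%E) :
  let q : R := fine (hoelder_conjugate p) in
  exists C : R,
    forall (T : R) (OmegaO : set (R * R)) (n : R * R -> R * R)
      (u0 uhat0 : R * R -> R) (grad_uhat0 : R * R -> R * R)
      (phi : R -> R * R -> R) (phibar : R -> R) (psi : R -> R * R -> R),
    let Gamma := topological_boundary OmegaO in
    let Omega := ~` closure OmegaO in
    let uhat := mild_solution d uhat0 phibar in
    0 < T ->
    open OmegaO -> connected OmegaO -> bounded_set OmegaO -> OmegaO 0 ->
    C2_boundary OmegaO ->
    (hausdorff1 Gamma < +oo)%E ->
    (forall x, Gamma x -> outward_unit_normal Omega x (n x)) ->
    (exists grad_u0, sobolev1 Omega u0 grad_u0) ->
    {ae leb2, forall x, Omega x -> 0 <= u0 x} ->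
    H1_L2 T Gamma phi -> L2_H1 T Gamma n phi ->
    sobolev1_time T phibar ->
    sobolev1 setT uhat0 grad_uhat0 ->
    {ae leb2, forall x, 0 <= uhat0 x} ->
    {ae leb2, forall x, Omega x -> uhat0 x = u0 x} ->
    ('N[leb2]_p[EFin \o (enorm \o grad_uhat0)] < +oo)%E ->
    {ae lebesgue_measure, forall tau, `]0, T]%classic tau ->
      is_normal_flux d Omega Gamma n (uhat tau) (psi tau)} ->
    forall t : R, 0 < t -> t <= T ->
    (flux_defect Gamma phi psi t <=
       2%:E * \int[lebesgue_measure]_(tau in `[0%R, t])
                L2_sqnorm Gamma (phi tau) +
       (2 * d ^+ 2)%:E * hausdorff1 Gamma * (C * t `^ (2 / q - 1))%:E *
         'N[leb2]_p[EFin \o (enorm \o grad_uhat0)] ^+ 2 +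
       (4 * d ^+ 2)%:E * C_Gamma d Gamma *
         \int[lebesgue_measure]_(tau in `[0%R, t])
           (\int[lebesgue_measure]_(s in `[0%R, tau]) `|phibar s|%:E) ^+ 2)%E.
Proof.
move=> q; have /andP[q1 q2] := hoelder_conjugate_bounds p_gt2; rewrite -/q in q1 q2.
have q0 : 0 < q by apply: lt_le_trans q1.
have a0 : 0 < 2 / q - 1 by rewrite subr_gt0 ltr_pdivlMr// mul1r.
(* heat_norm d q tau ^+ 2 is a multiple of tau `^ (2 / q - 2), whose integral over
   [0, t] is t `^ (2 / q - 1) / (2 / q - 1) *)
exists (2 * heat_norm d q 1 ^+ 2 / (2 / q - 1)).
move=> T O n u0 uhat0 g0 phi phibar psi G Om uhat T0 oO _ _ O0 C2O fG nG _ _ [[mphi _] _] _ [Lphibar _] Su0 _ _ fN flux t t0 tT.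
have mG : measurable G by apply: closed_measurable2; exact: topological_boundary_closed.
have Gn0 x : G x -> x != 0 := boundary_neq0 oO O0.
have iphibar := L2_integrable Lphibar.
set N := Lnorm _ _ _ in fN *.
have N0 : (0 <= N)%E by exact: Lnorm_ge0.
have NE : N = (fine N)%:E by rewrite fineK// ge0_fin_numE.
have GE : hausdorff1 G = (fine (hausdorff1 G))%:E by rewrite fineK// ge0_fin_numE// measure_ge0.
have Nr0 : 0 <= fine N by exact: fine_ge0.
have Gr0 : 0 <= fine (hausdorff1 G) by apply: fine_ge0; exact: measure_ge0.
(* the truncation at T makes B finite and nondecreasing on the whole line *)
pose B tau := (\int[lebesgue_measure]_(s in `[0%R, Num.min tau T]) `|phibar s|%:E)%E.
have iB tau : lebesgue_measure.-integrable `[0, Num.min tau T] (EFin \o phibar).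
  have h := @integrableS _ _ R lebesgue_measure `[0, T]%classic `[0, Num.min tau T]%classic.
  apply: h iphibar => //.
  by apply: subset_itvl; rewrite bnd_simp ge_min lexx orbT.
have B0 tau : (0 <= B tau)%E by apply: integral_ge0 => s _; rewrite lee_fin.
have Bfin tau : B tau = (fine (B tau))%:E.
  rewrite fineK// ge0_fin_numE//.
  by have /integrableP[_] := iB tau.
have BE tau : tau <= T -> (\int[lebesgue_measure]_(s in `[0%R, tau]) `|phibar s|%:E)%E = (fine (B tau))%:E.
  by move=> tT'; rewrite -Bfin /B min_l.
have mB : measurable_fun setT (fun tau => fine (B tau)).
  apply: nondecreasing_measurable => // s r sr; rewrite -lee_fin -!Bfin.
  apply: le_lower_integral_subset => [|x _|x _|x _]; rewrite ?lee_fin//.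
  by apply: subset_itvl; rewrite bnd_simp le_min !ge_min sr lexx orbT.
pose K := 4 * d ^+ 2 * (heat_norm d q 1 ^+ 2 * fine N ^+ 2) * fine (hausdorff1 G).
have d20 : 0 <= 4 * d ^+ 2 by apply: mulr_ge0 => //; exact: sqr_ge0.
have K0 : 0 <= K.
  by apply: mulr_ge0 => //; apply: mulr_ge0 => //; apply: mulr_ge0; exact: sqr_ge0.
have CG0 : (0 <= C_Gamma d G)%E.
  by rewrite C_Gamma_slope//; apply: integral_ge0 => x _; rewrite lee_fin sqr_ge0.
pose c3 := ((4 * d ^+ 2)%:E * C_Gamma d G)%E.
have c30 : (0 <= c3)%E by rewrite mule_ge0.
pose F tau := (2%:E * L2_sqnorm G (phi tau) + K%:E * (tau `^ (2 / q - 1 - 1))%:E + c3 * (fine (B tau) ^+ 2)%:E)%E.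
have L20 f : (0 <= L2_sqnorm G f)%E by apply: integral_ge0 => x _; rewrite lee_fin sqr_ge0.
have tsub : `[0, t]%classic `<=` `[0, T]%classic by apply: subset_itvl; rewrite bnd_simp.
have mI : measurable (`[0, t]%classic : set (measurableTypeR R)) by exact: measurable_itv.
have mL : measurable_fun `[0, t]%classic (fun tau => L2_sqnorm G (phi tau)).
  by apply: (measurable_funS _ tsub (measurable_L2_sqnorm mG fG mphi)); exact: measurable_itv.
have mP : measurable_fun `[0, t]%classic (fun tau : R => (tau `^ (2 / q - 1 - 1))%:E).
  by apply/measurable_EFinP; apply: measurable_funTS; exact: measurable_powR.
have mB2 : measurable_fun `[0, t]%classic (fun tau => (fine (B tau) ^+ 2)%:E).
  by apply/measurable_EFinP; apply: measurable_funX; exact: measurable_funTS.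
have F10 tau : (0 <= 2%:E * L2_sqnorm G (phi tau))%E by rewrite mule_ge0.
have F20 tau : (0 <= K%:E * (tau `^ (2 / q - 1 - 1))%:E)%E by rewrite mule_ge0 ?lee_fin ?powR_ge0.
have F30 tau : (0 <= c3 * (fine (B tau) ^+ 2)%:E)%E by rewrite mule_ge0 ?lee_fin ?sqr_ge0.
have mF1 : measurable_fun `[0, t]%classic (fun tau => 2%:E * L2_sqnorm G (phi tau))%E.
  by apply: emeasurable_funM.
have mF2 : measurable_fun `[0, t]%classic (fun tau => K%:E * (tau `^ (2 / q - 1 - 1))%:E)%E.
  by apply: emeasurable_funM.
have mF3 : measurable_fun `[0, t]%classic (fun tau => c3 * (fine (B tau) ^+ 2)%:E)%E.
  by apply: emeasurable_funM.
have key tau : `]0, t]%classic tau -> is_normal_flux d Om G n (uhat tau) (psi tau) ->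
    (L2_sqnorm G (fun x => (phi tau x - psi tau x)%R) <= F tau)%E.
  rewrite /= in_itv/= => /andP[tau0 taut] fl.
  have tauT := le_trans taut tT.
  have iphi : lebesgue_measure.-integrable `[0, tau] (EFin \o phibar).
    by have := iB tau; rewrite min_l.
  pose A := heat_norm d q tau * fine N.
  have A0 : 0 <= A by rewrite mulr_ge0// heat_norm_ge0.
  have HA x : enorm (initial_part d tau g0 true x, initial_part d tau g0 false x) <= A.
    by rewrite -lee_fin /A EFinM -NE; exact: (initial_part_le d_gt0 tau0 Su0 x p_gt2).
  have HB : (\int[lebesgue_measure]_(s in `[0%R, tau]) `|phibar s|%:E <= (fine (B tau))%:E)%E by rewrite BE.
  have Bt0 : 0 <= fine (B tau) by exact: fine_ge0.
  have psi_le := flux_le d_gt0 tau0 oO O0 C2O nG Su0 iphi A0 Bt0 HA HB fl.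
  have mphi_tau : measurable_fun G (phi tau).
    by apply: (measurable_section mG mphi); rewrite /= in_itv/= (ltW tau0).
  apply: le_trans (L2_sqnorm_defect_le d_gt0 mG Gn0 mphi_tau psi_le) _.
  rewrite /F le_eqVlt; apply/orP; left; apply/eqP; congr (_ + _ + _)%E.
    rewrite GE -!EFinM; congr EFin; rewrite /A exprMn heat_norm_sqr// /K.
    by rewrite (_ : 2 / q - 1 - 1 = 2 / q - 2); [ring|ring].
  by rewrite EFinM muleAC.
apply: (@le_trans _ _ (\int[lebesgue_measure]_(tau in `[0%R, t]) F tau)%E).
  apply: ae_le_lower_integral => //.
  - by apply: emeasurable_funD => //; apply: emeasurable_funD.
  - by move=> tau _; rewrite /F !adde_ge0.
  have n0 : {ae lebesgue_measure, forall tau : R, tau != 0}.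
    exists [set 0]; split => //; first exact: lebesgue_measure_set1.
    by move=> tau /= /negP; rewrite negbK => /eqP.
  move: flux n0; apply: (@filterS2 _ _ (ae_filter_ringOfSetsType lebesgue_measure)) => tau fl tau0; rewrite /= in_itv/= => /andP[h1 h2].
  have taup : 0 < tau by rewrite lt0r tau0.
  by apply: key => /=; [rewrite in_itv/= taup|apply: fl; rewrite /= in_itv/= taup (le_trans h2)].
rewrite /F ge0_integralD//; last 2 first.
- by move=> tau _; exact: adde_ge0.
- exact: emeasurable_funD.
rewrite ge0_integralD// ge0_integralZl// ge0_integralZl//; last by move=> tau _; rewrite lee_fin powR_ge0.
rewrite ge0_integralZl//; last by move=> tau _; rewrite lee_fin sqr_ge0.
apply: leeD; last first.
  rewrite le_eqVlt; apply/orP; left; apply/eqP; congr (_ * _)%E.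
  apply: eq_integral => tau /set_mem; rewrite /= in_itv/= => /andP[_ taut].
  by rewrite BE ?(le_trans taut)// -EFin_expe.
apply: leeD => //.
(* the power tau `^ (2 / q - 2) is integrable at 0 because q < 2, that is p > 2 *)
apply: (@le_trans _ _ (K%:E * (t `^ (2 / q - 1) / (2 / q - 1))%:E)%E).
  by apply: lee_wpmul2l; [rewrite lee_fin|exact: integral_powR_le].
rewrite GE NE -EFin_expe -!EFinM lee_fin le_eqVlt; apply/orP; left; apply/eqP.
rewrite /K; move: (2 / q - 1) a0 => a a0; field.
by rewrite lt0r_neq0.
Qed.
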